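(* Let $\alpha(x)$ be a sub-polynomial such that $\lim_{x\to+\infty}\alpha(x)=+\infty$ and such that, for every $p\in\mathbb{Q}[x]$ and every $c\in\mathbb{R}$, $$\lim_{x\to+\infty}\frac{|\alpha(x)-c\,p(x)|}{\log x}=+\infty.$$ Let $k,l\in\mathbb{N}$, and let $A\subseteq\mathbb{N}$ have positive upper density. Then there exist $x,y\in A$ and $n\in\mathbb{N}$ such that $$kx+ly=\lfloor\alpha(n)\rfloor.$$
   Context: $\mathbb{N}=\{1,2,\dots\}$. The upper density of $A\subseteq\mathbb{N}$ is $\overline{d}(A)=\limsup_{N\to\infty}\frac{|A\cap[1,N]|}{N}$. Let $\mathcal{G}$ be the ring (under pointwise addition and multiplication) of germs at $+\infty$ of continuous real-valued functions defined on half-lines $(a,+\infty)$; two functions have the same germ if they agree for all sufficiently large $x$. A Hardy field is a subfield of $\mathcal{G}$ closed under differentiation (each element is eventually differentiable and its derivative's germ lies in the field). A sub-polynomial is a function $\alpha$ whose germ belongs to some Hardy field and which satisfies $\lim_{x\to+\infty}\alpha(x)/x^l=0$ for some $l>0$. Functions and germs are not distinguished; when values $\alpha(n)$, $n\in\mathbb{N}$, appear, $\alpha$ denotes a fixed real-valued representative defined on $[1,+\infty)$. *)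

(* Defs.v *)
From HB Require Import structures.
From mathcomp Require Import all_boot all_order all_algebra finmap.
From mathcomp Require Import all_classical all_reals all_analysis.

Set Implicit Arguments.
Unset Strict Implicit.
Unset Printing Implicit Defensive.

Import Order.TTheory GRing.Theory Num.Theory.
Import numFieldNormedType.Exports.

Local Open Scope classical_set_scope.
Local Open Scope ring_scope.

(* A function on a half-line is represented by a total function R -> R whose
   values off the half-line are irrelevant; a germ at +oo is a class for
   [same_germ], and a set of germs is a set of functions saturated for it. *)
Definition same_germ (R : realType) (f g : R -> R) : Prop :=
  \forall x \near +oo, f x = g x.

Definition continuous_germ (R : realType) (f : R -> R) : Prop :=
  \forall x \near +oo, {for x, continuous f}.

Record hardy_field (R : realType) (H : set (R -> R)) : Prop := {
  hardy_continuous : forall f, H f -> continuous_germ f ;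
  hardy_saturated : forall f g, same_germ f g -> H f -> H g ;
  hardy_one : H (fun=> 1) ;
  hardy_sub : forall f g, H f -> H g -> H (fun x => f x - g x) ;
  hardy_mul : forall f g, H f -> H g -> H (fun x => f x * g x) ;
  hardy_inv : forall f, H f -> ~ same_germ f (fun=> 0) ->
    exists2 g, H g & same_germ (fun x => f x * g x) (fun=> 1) ;
  hardy_derivable : forall f, H f -> \forall x \near +oo, derivable f x 1 ;
  (* [derive1 f] takes junk values only where [f] is not derivable, hence nowhere
     near +oo. *)
  hardy_derive : forall f, H f -> H (derive1 f)
}.

Definition sub_polynomial (R : realType) (alpha : R -> R) : Prop :=
  (exists2 H : set (R -> R), hardy_field H & H alpha) /\
  (exists2 l : R, 0 < l & alpha x / x `^ l @[x --> +oo] --> (0 : R)).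

(* The term N = 0 is 0 / 0 = 0 and does not affect the limsup. *)
Definition upper_density (R : realType) (A : set nat) : \bar R :=
  limn_esup (fun N : nat =>
    (#|` fset_set (A `&` [set n | (1 <= n <= N)%N]) |%:R / N%:R : R)%:E).

(* Main.v *)
(* Weyl sums of theta * alpha over n < X are o(X), uniformly for K / alpha(X) <= theta
   <= theta1.  Let D be the last order for which alpha^(D) does not tend to 0.  If some
   theta * alpha^(i)(X) with 1 <= i <= D is small, or if the derivative of order D + 1
   decays slowly, a van der Corput derivative test applies on short windows; the
   derivatives are controlled because elements of a Hardy field are eventually
   monotone.  Otherwise alpha is a real polynomial up to a slowly varying error, and the
   logarithmic hypothesis forces theta times one of its nonconstant coefficients to be
   irrational for every theta > 0; compactness in theta gives uniformity.

   Write B = 3 b and a_n = floor (B alpha(n)).  A value a_n = B k x + i + B l y + i' + i''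
   with i, i', i'' < b gives floor (alpha(n)) = k x + l y.  The number of such
   representations with x, y in A is compared with the number obtained after smoothing
   (a_n) over intervals of length L: by the Weyl sum estimate the difference is small,
   while the smoothed count is large because alpha(n) has gaps O (alpha(X) / X).  When
   alpha' tends to 0 this is unnecessary: floor (alpha(n)) takes all large values. *)

Require Import Defs.
From mathcomp Require Import all_boot all_order all_algebra finmap.
From mathcomp Require Import all_classical all_reals all_analysis.
From mathcomp Require Import complex ring lra zify.

Set Implicit Arguments.
Unset Strict Implicit.
Unset Printing Implicit Defensive.

Import Order.TTheory GRing.Theory Num.Theory.
Import numFieldNormedType.Exports.
Import ComplexField.Normc.

Local Open Scope classical_set_scope.
Local Open Scope ring_scope.
Local Open Scope complex_scope.


(** The Weyl estimate starts only at K / alpha(X), because lower frequencies show no cancellation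
    over n < X. This dictates the shape of the count, whose three exponential factors each control
    one range of frequencies tau: smoothing over L changes almost nothing when tau is small compared
    with 1 / L; the Weyl sum is small in the middle; the sum over i'' is small once tau exceeds
    theta1 / B. The dilation by B removes the discontinuity of floor from the middle range: there
    tau <= theta1 / B, so replacing a_n by B alpha(n) costs O(tau) per term. The digits i and i'
    give back the density lost by dilating; without them eta would have to be small in terms of b,
    while b is itself of order eta^-2. With X chosen so that alpha(X) is of the order of a scale N
    at which A is dense, consecutive values up to X differ by O(N / X), and with L proportional to N
    it only remains for the density of A to beat eta. *)

(** * The character exp(2 pi i t): elementary upper and lower bounds *)

Section ExponentialSums.
Variable R : realType.
Implicit Types (f g : nat -> R) (z : nat -> R[i]) (s t : R).

Definition e2pi t : R[i] := cos (2 * pi * t) +i* sin (2 * pi * t).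

Lemma le_of_eq (x y : R) : x = y -> x <= y.
Proof. by move=> ->. Qed.

Lemma normc_le_sum (I : Type) (r : seq I) (P : pred I) (F : I -> R[i]) :
  normc (\sum_(i <- r | P i) F i) <= \sum_(i <- r | P i) normc (F i).
Proof.
elim/big_rec2: _ => [|i y x _ xy]; first by rewrite normc0.
by apply: (le_trans (le_normcD _ _)); rewrite lerD2l.
Qed.

Lemma normc_ge0 (x : R[i]) : 0 <= normc x.
Proof. by case: x => a b; rewrite /normc sqrtr_ge0. Qed.

Lemma le_normcB (x y : R[i]) : normc (x - y) <= normc x + normc y.
Proof. by apply: (le_trans (le_normcD _ _)); rewrite normcN. Qed.

Lemma normcBC (x y : R[i]) : normc (x - y) = normc (y - x).
Proof. by rewrite -normcN opprB. Qed.

Lemma e2piD s t : e2pi (s + t) = e2pi s * e2pi t.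
Proof.
rewrite /e2pi mulrDr cosD sinD; apply/eqP; rewrite eq_complex /=.
by apply/andP; split; apply/eqP; ring.
Qed.

Lemma e2pi0 : e2pi 0 = 1.
Proof. by rewrite /e2pi mulr0 cos0 sin0. Qed.

Lemma normc_e2pi t : normc (e2pi t) = 1.
Proof. by rewrite /e2pi /= cos2Dsin2 sqrtr1. Qed.

Lemma e2piN t : e2pi (- t) = (e2pi t)^*.
Proof. by rewrite /e2pi mulrN cosN sinN. Qed.

Lemma e2piB s t : e2pi (s - t) = e2pi s * (e2pi t)^*.
Proof. by rewrite e2piD e2piN. Qed.

Lemma normc_conj (x : R[i]) : normc (x^*) = normc x.
Proof. by case: x => a b /=; rewrite sqrrN. Qed.

Lemma e2pi_nat (n : nat) : e2pi n%:R = 1.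
Proof.
elim: n => [|n IH]; first exact: e2pi0.
rewrite -natr1 e2piD IH mul1r /e2pi mulr1.
by rewrite (_ : 2 * pi = pi *+ 2) ?cos2pi ?sin2pi // mulr_natl.
Qed.

Lemma e2pi_int (k : int) : e2pi k%:~R = 1.
Proof.
case: k => n; first exact: e2pi_nat.
rewrite NegzE mulrNz e2piN -pmulrn e2pi_nat.
by apply/eqP; rewrite eq_complex /= oppr0 !eqxx.
Qed.

Lemma e2piMn t n : e2pi (t *+ n) = e2pi t ^+ n.
Proof.
by elim: n => [|n IH]; rewrite ?mulr0n ?e2pi0 // mulrS e2piD IH exprS.
Qed.

Lemma normc_leD (x : R[i]) : normc x <= `|complex.Re x| + `|complex.Im x|.
Proof.
case: x => a b /=; rewrite -(@ler_pXn2r _ 2%N) // ?nnegrE ?sqrtr_ge0 ?addr_ge0 //.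
rewrite sqr_sqrtr ?addr_ge0 ?sqr_ge0 // sqrrD !real_normK ?num_real //.
by rewrite lerD2r lerDl mulrn_wge0 // mulr_ge0.
Qed.

Lemma cos_lip (x y : R) : `|cos x - cos y| <= `|x - y|.
Proof.
wlog xy : x y / x <= y.
  by case: (leP x y) => [xy|/ltW xy] H; [|rewrite distrC (distrC x)]; apply: H.
have [c cxy E] := MVT_segment xy (fun u _ => is_derive_cos u)
  (continuous_subspaceT (@continuous_cos R)).
rewrite distrC E normrM normrN (distrC x).
by rewrite ler_piMl // sin_max.
Qed.

Lemma sin_lip (x y : R) : `|sin x - sin y| <= `|x - y|.
Proof.
wlog xy : x y / x <= y.
  by case: (leP x y) => [xy|/ltW xy] H; [|rewrite distrC (distrC x)]; apply: H.
have [c cxy E] := MVT_segment xy (fun u _ => is_derive_sin u)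
  (continuous_subspaceT (@continuous_sin R)).
rewrite distrC E normrM (distrC x).
by rewrite ler_piMl // cos_max.
Qed.

Lemma pi_lt4 : pi < 4 :> R.
Proof. by have := pihalf_lt2 R; lra. Qed.

Lemma normc_e2piB s t : normc (e2pi s - e2pi t) <= 16 * `|s - t|.
Proof.
apply: (le_trans (normc_leD _)) => /=.
have := cos_lip (2 * pi * s) (2 * pi * t).
have := sin_lip (2 * pi * s) (2 * pi * t).
rewrite -mulrBr normrM (ger0_norm (_ : 0 <= 2 * pi)); last first.
  by rewrite mulr_ge0 // pi_ge0.
have := pi_lt4; have := normr_ge0 (s - t); have := pi_ge0 R; nra.
Qed.

Lemma cos_half (x : R) : 1 - cos x = (sin (x / 2) ^+ 2) *+ 2.
Proof.
have {1}-> : x = (x / 2) *+ 2 by rewrite -mulr_natr mulfVK ?pnatr_eq0.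
by rewrite cos_mulr2n cos2sin2; ring.
Qed.

Lemma cos_ge (x : R) : 1 - x ^+ 2 / 2 <= cos x.
Proof.
have hs := sin_lip (x / 2) 0; rewrite sin0 !subr0 in hs.
have := ler_pM (normr_ge0 _) (normr_ge0 _) hs hs.
rewrite -!normrM !ger0_norm -?expr2 ?sqr_ge0 // => hs2.
have := cos_half x; lra.
Qed.

(* The constant 256 is crude; only the order of the remainder matters. *)
Lemma e2pi_taylor t :
  normc (e2pi t - 1 - (0 +i* (2 * pi * t))) <= 256 * t ^+ 2.
Proof.
set x := 2 * pi * t.
have bx : x ^+ 2 <= 64 * t ^+ 2.
  rewrite /x exprMn ler_wpM2r ?sqr_ge0 //.
  by have := pi_lt4; have := pi_ge0 R; nra.
have Hc (y : R) : `|cos y - 1| <= y ^+ 2.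
  rewrite distrC ger0_norm ?subr_ge0 ?cos_le1 //.
  have := cos_ge y; have := sqr_ge0 y; lra.
have Hs : `|sin x - x| <= x ^+ 2.
  have [c cy E] : exists2 c : R, `|c| <= `|x| & sin x - x = (cos c - 1) * x.
    have [y0|y0] := leP 0 x.
      have [c cxy E] := MVT_segment y0 (fun u _ => is_derive_sin u)
        (continuous_subspaceT (@continuous_sin R)).
      exists c; last by rewrite mulrBl mul1r -[X in X - _]subr0 -(sin0 R) E subr0.
      by move: cxy; rewrite in_itv /= => /andP[c0 cy]; rewrite !ger0_norm.
    have [c cxy E] := MVT_segment (ltW y0) (fun u _ => is_derive_sin u)
      (continuous_subspaceT (@continuous_sin R)).
    exists c; last first.
      rewrite mulrBl mul1r -[X in X - _ = _]opprK -[X in - X]add0r -(sin0 R) E.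
      by ring.
    move: cxy; rewrite in_itv /= => /andP[cy c0]; rewrite !ler0_norm ?lerN2 //.
    exact: ltW.
  rewrite E normrM; have := cos_lip c 0; rewrite cos0 subr0 => h.
  have -> : x ^+ 2 = `|x| * `|x| by rewrite -normrM ger0_norm -?expr2 ?sqr_ge0.
  by rewrite ler_wpM2r // (le_trans h).
apply: (le_trans (normc_leD _)) => /=.
rewrite !oppr0 !addr0 -/x.
have := Hc x; have := sqr_ge0 t; nra.
Qed.

(** A crude Jordan inequality drawn from [cos_ge] alone: the mean value theorem up to 1, the
    doubling formula up to 4/3, and the cosine of the complementary angle beyond. *)
Lemma sin_ge_third (x : R) : 0 <= x <= pi / 2 -> x / 3 <= sin x.
Proof.
move=> /andP[x0 xp].
have p2 := pihalf_lt2 R; have p1 := pihalf_ge1 R.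
have key (y : R) : 0 <= y <= 1 -> y / 2 <= sin y.
  move=> /andP[y0 y1].
  have [c] := MVT_segment y0 (fun u _ => is_derive_sin u)
        (continuous_subspaceT (@continuous_sin R)).
  rewrite sin0 !subr0 in_itv /= => /andP[c0 cy] ->.
  by rewrite mulrC ler_wpM2r //; have := cos_ge c; nra.
have [x1|x1] := leP x 1.
  by apply: (le_trans _ (key x _)); [nra|rewrite x0 x1].
have [x43|x43] := leP x (4/3).
  have -> : sin x = 2 * (sin (x/2) * cos (x/2)).
    have {1}-> : x = (x / 2) *+ 2 by rewrite -mulr_natr mulfVK ?pnatr_eq0.
    by rewrite sin_mulr2n; ring.
  have h1 : (x/2)/2 <= sin (x/2) by apply: key; apply/andP; split; lra.
  have h2 : 7/9 <= cos (x/2) by have := cos_ge (x/2); nra.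
  nra.
have -> : sin x = cos (pi/2 - x).
  by rewrite cosB cos_pihalf sin_pihalf mul0r add0r mul1r.
have y0 : 0 <= pi/2 - x by lra.
have y1 : pi/2 - x <= 2/3 by lra.
have := cos_ge (pi/2 - x); nra.
Qed.

(** The chord has length [2 * sin (pi * t)]; [sin_ge_third] and pi >= 2 give it slope at least
    4/3. *)
Lemma e2pi_lower t : `|t| <= 1 / 2 -> `|t| <= normc (1 - e2pi t).
Proof.
wlog t0 : t / 0 <= t.
  move=> H h; have [t0|/ltW t0] := leP 0 t; first exact: H.
  rewrite -normc_conj; have := H (- t).
  rewrite oppr_ge0 normrN => /(_ t0 h).
  by rewrite e2piN rmorphB rmorph1.
rewrite ger0_norm // => t1.
have -> : normc (1 - e2pi t) = 2 * sin (pi * t).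
  have p0 := pi_ge0 R; have s0 : 0 <= sin (pi * t).
    by apply: sin_ge0_pi; apply/andP; split; nra.
  rewrite /e2pi /= sub0r sqrrN.
  have -> : 2 * pi * t = (pi * t) *+ 2 by ring.
  rewrite cos_mulr2n sin_mulr2n -[RHS]ger0_norm ?mulr_ge0 // -sqrtr_sqr.
  congr Num.sqrt; have := cos2sin2 (pi * t).
  set c := cos _; set s := sin _ => E.
  transitivity (4 * ((1 - c ^+ 2) ^+ 2 + c ^+ 2 * s ^+ 2)); first by ring.
  by rewrite E; ring.
have /sin_ge_third : 0 <= pi * t <= pi / 2.
  by have := pi_ge0 R => p0; apply/andP; split; nra.
have := pi_ge2 R; nra.
Qed.

Lemma e2pi_eq1 t : e2pi t = 1 -> exists k : int, t = k%:~R.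
Proof.
move=> E; exists (Num.floor (t + 1 / 2)).
set k := Num.floor _; apply/eqP; rewrite -subr_eq0 -normr_eq0 eq_le normr_ge0 andbT.
have /andP[k1 k2] := floor_itv (t + 1/2).
have h : `|t - k%:~R| <= 1 / 2.
  rewrite ler_norml; move: k1 k2; rewrite -/k intrD => k1 k2.
  by apply/andP; split; lra.
apply: (le_trans (e2pi_lower h)).
rewrite e2piB E e2pi_int mul1r.
rewrite (_ : 1 - 1^* = 0) ?normc0 //.
by apply/eqP; rewrite eq_complex /= subrr oppr0 subr0 !eqxx.
Qed.

End ExponentialSums.

(** * The van der Corput inequality *)

Section VanDerCorput.
Variable R : realType.
Implicit Types (f g : nat -> R) (z : nat -> R[i]).

(** Each unit shift loses one term and gains one. *)
Lemma shift_sum z (X h : nat) : (forall n, normc (z n) <= 1) ->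
  normc (\sum_(n < X) z (n + h)%N - \sum_(n < X) z n) <= 2 * h%:R.
Proof.
move=> z1; elim: h => [|h IH].
  by under eq_bigr do rewrite addn0; rewrite subrr normc0 mulr0.
set s1 := (X in normc (X - _)); set s0 := (X in normc (_ - X)).
pose s2 := \sum_(n < X) z (n + h)%N.
have -> : s1 - s0 = (s1 - s2) + (s2 - s0) by rewrite addrA subrK.
apply: (le_trans (le_normcD _ _)).
have -> : 2 * h.+1%:R = 2 + 2 * h%:R :> R by rewrite -natr1; ring.
apply: lerD; last exact: IH.
have -> : s1 - s2 = z (X + h)%N - z h.
  rewrite /s1 /s2 -sumrB -(big_mkord xpredT (fun n => z (n + h.+1)%N - z (n + h)%N)).
  by rewrite (@telescope_sumr_eq _ 0%N X (fun n => z (n + h)%N)) // => n _; rewrite addSnnS.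
apply: (le_trans (le_normcB _ _)).
by rewrite (_ : 2 = 1 + 1) ?lerD.
Qed.

(** Average the sum over its W translates by multiples of q, each of which costs at most 2 q W. The
    step q is kept general because rational coefficients later require windows along
    progressions. *)
Lemma smoothing z (q X W : nat) : (forall n, normc (z n) <= 1) ->
  normc (\sum_(n < X) z n) * W%:R <=
  2 * q%:R * W%:R ^+ 2 + \sum_(a < X) normc (\sum_(m < W) z (a + q * m)%N).
Proof.
move=> z1.
have H : normc (\sum_(m < W) (\sum_(n < X) z (n + q * m)%N - \sum_(n < X) z n)) <=
   2 * q%:R * W%:R ^+ 2.
  apply: (le_trans (normc_le_sum _ _ _)).
  apply: (le_trans (y := \sum_(m < W) (2 * q%:R * W%:R))).
    apply: ler_sum => m _; apply: (le_trans (shift_sum _ _ z1)).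
    rewrite -mulrA ler_wpM2l // -natrM ler_nat leq_mul2l.
    by rewrite ltnW ?orbT.
  by rewrite sumr_const card_ord -mulr_natr; apply/le_of_eq; ring.
rewrite sumrB sumr_const card_ord exchange_big /= in H.
rewrite mulr_natr -normcMn -lerBlDr.
apply: (le_trans _ H).
rewrite normcBC lerBlDr.
set s := (X in normc X <= _); set t := (X in s - X).
apply: (@le_trans _ _ (normc (s - t) + normc t)).
  by rewrite -{1}(subrK t s) le_normcD.
by rewrite lerD2l; exact: normc_le_sum.
Qed.

Lemma phase_le1 f n : normc (e2pi (f n)) <= 1.
Proof. by rewrite normc_e2pi. Qed.

Lemma conj_mul_conj (x y : R[i]) : (x * y^*)^* = y * x^*.
Proof. by rewrite rmorphM mulrC; case: y => a b /=; rewrite opprK. Qed.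

Lemma normc_sqr (x : R[i]) : (normc x ^+ 2)%:C = x * x^*.
Proof.
by rewrite -sqr_normc rmorphXn.
Qed.

Lemma normc_real_ge0 (x : R) : 0 <= x -> normc x%:C = x.
Proof. by move=> x0; rewrite /normc /= expr0n addr0 sqrtr_sqr ger0_norm. Qed.

Definition corr f (W d : nat) : R := normc (\sum_(n < W) e2pi (f (n + d)%N - f n)).

Lemma corr_le f W d : corr f W d <= W%:R.
Proof.
apply: (le_trans (normc_le_sum _ _ _)).
by under eq_bigr do rewrite normc_e2pi; rewrite sumr_const card_ord.
Qed.

Lemma corr_shift f (W m m' h : nat) : (m' <= m < h)%N ->
  normc (\sum_(n < W) (e2pi (f (n + m)%N) * (e2pi (f (n + m')%N))^*)) <=
  corr f W (m - m') + 2 * h%:R.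
Proof.
move=> /andP[m'm mh].
pose z n := e2pi (f (n + (m - m'))%N - f n).
have -> : \sum_(n < W) (e2pi (f (n + m)%N) * (e2pi (f (n + m')%N))^*) =
   \sum_(n < W) z (n + m')%N.
  apply: eq_bigr => n _; rewrite /z -e2piB; congr (e2pi (f _ - _)); lia.
have z1 n : normc (z n) <= 1 by rewrite normc_e2pi.
have := shift_sum W m' z1; rewrite /corr.
set s1 := \sum_(n < W) z (n + m')%N; set s0 := \sum_(n < W) z n => H.
rewrite -(subrK s0 s1) addrC; apply: (le_trans (le_normcD _ _)).
rewrite lerD2l; apply: (le_trans H); rewrite ler_wpM2l // ler_nat.
by rewrite ltnW // (leq_ltn_trans m'm).
Qed.

(** Expand the square: up to a shift of the summation range, the pair (m, m') contributes the
    correlation at lag |m - m'|, and the diagonal contributes W. *)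
Lemma corr_sum f (W h : nat) (B : R) :
  \sum_(1 <= d < h) corr f W d <= B ->
  \sum_(n < W) normc (\sum_(m < h) e2pi (f (n + m)%N)) ^+ 2 <=
    h%:R * W%:R + 2 * h%:R ^+ 3 + 2 * h%:R * B.
Proof.
move=> HB.
pose c m m' := \sum_(n < W) (e2pi (f (n + m)%N) * (e2pi (f (n + m')%N))^*).
have E : ((\sum_(n < W) normc (\sum_(m < h) e2pi (f (n + m)%N)) ^+ 2)%:C) =
   \sum_(m < h) \sum_(m' < h) c m m'.
  rewrite rmorph_sum /=.
  under eq_bigr => n _ do rewrite normc_sqr rmorph_sum mulr_suml /=.
  rewrite exchange_big /=; apply: eq_bigr => m _.
  under eq_bigr do rewrite mulr_sumr.
  by rewrite exchange_big.
set s := \sum_(n < W) _ in E *.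
have s0 : 0 <= s by apply: sumr_ge0 => n _; rewrite exprn_ge0 // normc_ge0.
rewrite -(normc_real_ge0 s0) E.
apply: (le_trans (normc_le_sum _ _ _)).
have key (m : 'I_h) : normc (\sum_(m' < h) c m m') <= W%:R + 2 * h%:R ^+ 2 + 2 * B.
  apply: (le_trans (normc_le_sum _ _ _)).
  (* Subtraction on [nat] is truncated, so the value 0 at lag 0 leaves at most one of [F (m - m')]
     and [F (m' - m)] nonzero. *)
  pose F (d : nat) := if d == 0%N then 0 else corr f W d.
  have F0 d : 0 <= F d by rewrite /F; case: ifP => // _; exact: normc_ge0.
  have bd (m' : 'I_h) : normc (c m m') <=
      (if m' == m then W%:R else 0) + F (m - m')%N + F (m' - m)%N + 2 * h%:R.
    have h0 : 0 <= 2 * h%:R :> R by rewrite mulr_ge0.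
    case: (ltngtP m' m) => [lt|gt|eq].
    - rewrite -val_eqE /= (ltn_eqF lt) add0r (_ : (m' - m)%N = 0%N); last by lia.
      rewrite {2}/F eqxx addr0 {1}/F ifF; last by apply/eqP; lia.
      by apply: corr_shift; rewrite ltnW //=.
    - rewrite -val_eqE /= (gtn_eqF gt) add0r (_ : (m - m')%N = 0%N); last by lia.
      rewrite {1}/F eqxx add0r {1}/F ifF; last by apply/eqP; lia.
      rewrite -normc_conj rmorph_sum.
      rewrite (eq_bigr (fun n : 'I_W => e2pi (f (n + m')%N) * (e2pi (f (n + m)%N))^*));
        last by move=> n _; exact: conj_mul_conj.
      by apply: corr_shift; rewrite ltnW //=.
    - rewrite -val_eqE /= eq eqxx subnn /F eqxx !addr0.
      apply: (@le_trans _ _ W%:R); last by rewrite lerDl.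
      apply: (le_trans (normc_le_sum _ _ _)).
      under eq_bigr do rewrite normcM normc_conj !normc_e2pi mulr1.
      by rewrite sumr_const card_ord.
  apply: (le_trans (ler_sum _ (fun m' _ => bd m'))).
  rewrite !big_split /= -big_mkcond /= big_pred1_eq sumr_const card_ord.
  have L1 : \sum_(m' < h) F (m - m')%N <= B.
    apply: (le_trans _ HB).
    rewrite [leRHS]big_nat_cond [leRHS]big_mkcond /=.
    rewrite -(big_mkord xpredT (fun m' => F (m - m')%N)).
    rewrite (big_cat_nat (n := m)) //=; last by rewrite ltnW.
    rewrite [X in _ + X]big_nat_cond [X in _ + X]big1 ?addr0; last first.
      by move=> i /andP[/andP[mi _] _]; rewrite (_ : (m - i)%N = 0%N) //; lia.
    rewrite big_nat_rev /= add0n -big_mkcond -big_nat_cond /=.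
    apply: (@le_trans _ _ (\sum_(1 <= d < m.+1) F d)).
      rewrite big_add1 /= !big_nat; apply: ler_sum => i im.
      by rewrite (_ : (m - (m - i.+1))%N = i.+1) //; lia.
    rewrite (big_cat_nat (n := m.+1) (p := h)) //=.
    rewrite -[leLHS]addr0; apply: lerD; last by apply: sumr_ge0 => i _; exact: normc_ge0.
    by rewrite !big_nat; apply: ler_sum => i /andP[i1 _]; rewrite /F ifF //; apply/eqP; lia.
  have L2 : \sum_(m' < h) F (m' - m)%N <= B.
    apply: (le_trans _ HB).
    rewrite -(big_mkord xpredT (fun m' => F (m' - m)%N)).
    rewrite (big_cat_nat (n := m)) //=; last by rewrite ltnW.
    rewrite big_nat_cond big1 ?add0r; last first.
      by move=> i /andP[/andP[_ mi] _]; rewrite (_ : (i - m)%N = 0%N) //; lia.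
    rewrite -{1}[val m]add0n big_addn.
    have hm : (h - m = (h - m).-1.+1)%N by have := ltn_ord m; lia.
    rewrite hm big_nat_recl // add0n subnn {1}/F eqxx add0r.
    have -> : \sum_(0 <= i < (h - m).-1) F (i.+1 + m - m)%N = \sum_(1 <= d < h - m) F d.
      by rewrite [RHS]big_add1; apply: eq_bigr => i _; rewrite addnK.
    rewrite (big_cat_nat (n := (h - m)%N) (p := h)) /= ?leq_subr ?subn_gt0 //.
    rewrite -[leLHS]addr0; apply: lerD; last by apply: sumr_ge0 => i _; exact: normc_ge0.
    by rewrite !big_nat; apply: ler_sum => i /andP[i1 _]; rewrite /F ifF //; apply/eqP; lia.
  rewrite -mulr_natr -addrA -addrA.
  by nra.
apply: (le_trans (ler_sum _ (fun m _ => key m))).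
rewrite sumr_const card_ord -mulr_natr.
by apply/le_of_eq; ring.
Qed.

(** Smoothing over windows of length h, followed by Cauchy-Schwarz in the form 2 c x <= x^2 + c^2,
    where c = tau h is the intended size of a window sum. *)
Lemma van_der_corput f (W h : nat) (B tau : R) :
  (0 < h)%N -> (0 < W)%N -> 0 < tau ->
  \sum_(1 <= d < h) corr f W d <= B ->
  W%:R + 2 * h%:R ^+ 2 + 2 * B <= tau ^+ 2 * h%:R * W%:R ->
  normc (\sum_(n < W) e2pi (f n)) <= 2 * h%:R + tau * W%:R.
Proof.
move=> h0 W0 t0 HB Hm.
have hp : 0 < h%:R :> R by rewrite ltr0n.
have Wp : 0 < W%:R :> R by rewrite ltr0n.
have Hs := smoothing 1 W h (phase_le1 f).
rewrite -(ler_pM2r hp); apply: (le_trans Hs).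
rewrite (_ : (2 * h%:R + tau * W%:R) * h%:R = 2 * 1 * h%:R ^+ 2 + tau * W%:R * h%:R);
  last by ring.
rewrite lerD2l.
have Hc := corr_sum HB.
under eq_bigr do under eq_bigr do rewrite mul1n.
set x := fun n : nat => normc (\sum_(m < h) e2pi (f (n + m)%N)).
set c := tau * h%:R.
have c0 : 0 < c by rewrite mulr_gt0.
have H2 : 2 * c * \sum_(n < W) x n <= \sum_(n < W) x n ^+ 2 + W%:R * c ^+ 2.
  have -> : W%:R * c ^+ 2 = \sum_(n < W) c ^+ 2.
    by rewrite sumr_const card_ord mulr_natl.
  rewrite mulr_sumr -big_split /=; apply: ler_sum => n _.
  by have := sqr_ge0 (x n - c); lra.
have H3 : \sum_(n < W) x n ^+ 2 <= W%:R * c ^+ 2.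
  apply: (le_trans Hc).
  have -> : h%:R * W%:R + 2 * h%:R ^+ 3 + 2 * h%:R * B =
     h%:R * (W%:R + 2 * h%:R ^+ 2 + 2 * B) by ring.
  apply: (@le_trans _ _ (h%:R * (tau ^+ 2 * h%:R * W%:R))); first by rewrite ler_wpM2l // ltW.
  by rewrite /c; apply/le_of_eq; ring.
have -> : tau * W%:R * h%:R = W%:R * c by rewrite /c; ring.
have c2 : 0 < 2 * c by rewrite mulr_gt0.
rewrite -(ler_pM2l c2); apply: (le_trans H2).
by apply: (le_trans (lerD H3 (lexx _))); apply/le_of_eq; ring.
Qed.

End VanDerCorput.

(** * Derivative tests for sequences of phases *)

Section DerivativeTests.
Variable R : realType.
Implicit Types (f g : nat -> R).

Definition fdiff f n := f n.+1 - f n.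

(** Differencing at lag d lowers the order by one at the price of a factor d; this drives the
    inductions below. *)
Lemma fdiff_iter_shift k f d n :
  iter k fdiff (fun n => f (n + d)%N - f n) n =
  \sum_(j < d) iter k.+1 fdiff f (n + j)%N.
Proof.
have -> : iter k fdiff (fun n => f (n + d)%N - f n) n =
    iter k fdiff f (n + d)%N - iter k fdiff f n.
  elim: k n => [//|k IH] n; rewrite !iterS /fdiff !IH !addSn; ring.
rewrite -(big_mkord xpredT (fun j => iter k.+1 fdiff f (n + j)%N)).
rewrite (@telescope_sumr_eq _ 0%N d (fun j => iter k fdiff f (n + j)%N)) ?addn0 //.
by move=> j _; rewrite iterS /fdiff addnS.
Qed.

Lemma fdiff_shift_bounds k f d (a b : R) n :
  (forall j, (j < d)%N -> a <= iter k.+1 fdiff f (n + j)%N <= b) ->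
  d%:R * a <= iter k fdiff (fun n => f (n + d)%N - f n) n <= d%:R * b.
Proof.
move=> H; rewrite (fdiff_iter_shift k f d n).
apply/andP; split; rewrite -[d in d%:R]card_ord mulr_natl -sumr_const;
  by apply: ler_sum => j _; have /andP[] := H j (ltn_ord j).
Qed.

Lemma phase_step f n : e2pi (f n.+1) - e2pi (f n) = e2pi (f n) * (e2pi (fdiff f n) - 1).
Proof. by rewrite mulrBr mulr1 -e2piD /fdiff [f n + _]addrC subrK. Qed.

(** Summation by parts: the two boundary terms cost 2 M, and the variation of a monotone weight
    telescopes. *)
Lemma abel_monotone (z : nat -> R[i]) (c : nat -> R) (W : nat) (M : R) :
  (forall n, normc (z n) <= 1) ->
  (forall n, (n <= W)%N -> 0 <= c n <= M) ->
  (forall n, (n < W)%N -> c n <= c n.+1) \/ (forall n, (n < W)%N -> c n.+1 <= c n) ->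
  normc (\sum_(n < W) (z n.+1 - z n) * (c n)%:C) <= 4 * M.
Proof.
move=> z1 cM mon.
have -> : \sum_(n < W) (z n.+1 - z n) * (c n)%:C =
   (z W * (c W)%:C - z 0%N * (c 0%N)%:C) - \sum_(n < W) z n.+1 * (c n.+1 - c n)%:C.
  rewrite -(big_mkord xpredT (fun n => z n.+1 * (c n.+1 - c n)%:C)).
  rewrite -(big_mkord xpredT (fun n => (z n.+1 - z n) * (c n)%:C)).
  apply/eqP; rewrite eq_sym subr_eq -big_split /=; apply/eqP.
  rewrite (@telescope_sumr_eq _ 0%N W (fun n => z n * (c n)%:C)) //.
  by move=> n _; rewrite rmorphB; ring.
have bz n (x : R) : 0 <= x -> normc (z n * x%:C) <= x.
  by move=> x0; rewrite normcM normc_real_ge0 // ler_piMl.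
have bz' n (x : R) : normc (z n * x%:C) <= `|x|.
  have [x0|x0] := leP 0 x; first by rewrite ger0_norm ?bz.
  rewrite -normcN -mulrN -rmorphN ltr0_norm //; apply: bz.
  by rewrite oppr_ge0 ltW.
have [cW0 cWM] := andP (cM W (leqnn _)).
have [c00 c0M] := andP (cM 0%N (leq0n _)).
apply: (le_trans (le_normcB _ _)).
have -> : 4 * M = M + M + (M + M) by ring.
apply: lerD.
  apply: (le_trans (le_normcB _ _)); apply: lerD.
    exact: (le_trans (bz _ _ _)).
  exact: (le_trans (bz _ _ _)).
apply: (le_trans (normc_le_sum _ _ _)).
apply: (le_trans (ler_sum _ (fun (n : 'I_W) _ => bz' n.+1 (c n.+1 - c n)))).
apply: (@le_trans _ _ `|c W - c 0%N|); last first.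
  by apply: (le_trans (ler_normB _ _)); rewrite !ger0_norm //; apply: lerD.
rewrite -(telescope_sumr c (leq0n W)) big_mkord.
case: mon => mon.
  rewrite ger0_norm; last by apply: sumr_ge0 => n _; rewrite subr_ge0 mon.
  by apply: ler_sum => n _; rewrite ger0_norm // subr_ge0 mon.
rewrite ler0_norm; last by apply: sumr_le0 => n _; rewrite subr_le0 mon.
by rewrite -sumrN; apply: ler_sum => n _; rewrite ler0_norm // subr_le0 mon.
Qed.

(** To first order, e(f(n+1)) - e(f(n)) is 2 pi i (f(n+1) - f(n)) e(f(n)). Dividing by the monotone
    difference and summing by parts leaves 4 / lam, plus a Taylor error 256 C lam per term. *)
Lemma first_derivative_test (C eta : R) : 1 <= C -> 0 < eta ->
  exists2 K : R, 1 <= K & forall (W : nat) (lam : R) f,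
    0 < lam -> lam * K <= 1 -> K <= lam * W%:R ->
    (forall n, (n <= W)%N -> lam <= fdiff f n <= C * lam) ->
    (forall n, (n <= W)%N -> 0 <= fdiff (fdiff f) n) \/
    (forall n, (n <= W)%N -> fdiff (fdiff f) n <= 0) ->
    normc (\sum_(n < W) e2pi (f n)) <= eta * W%:R.
Proof.
move=> C1 eta0; have e1 : 0 <= eta^-1 by rewrite invr_ge0 ltW.
have Ce : 0 <= C * eta^-1 by rewrite mulr_ge0 //; lra.
(* The last two summands make the boundary terms and the Taylor errors at most eta W / 2 each. *)
exists (1 + 8 * eta^-1 + 512 * (C * eta^-1)); first by lra.
set K := 1 + _ + _ => W lam f lam0 lamK KW df mon.
have KE : K * eta = eta + 8 + 512 * C by rewrite /K; field; lra.
have W0 : 0 <= W%:R :> R by [].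
have d0 n : (n <= W)%N -> 0 < fdiff f n.
  by move=> /df /andP[h _]; exact: lt_le_trans h.
pose c n := (fdiff f n)^-1.
have Abel : normc (\sum_(n < W) (e2pi (f n.+1) - e2pi (f n)) * (c n)%:C) <= 4 * lam^-1.
  apply: (abel_monotone (z := fun n => e2pi (f n))) => [n|n nW|].
  - by rewrite normc_e2pi.
  - rewrite /c invr_ge0 ltW ?d0 //= lef_pV2 ?posrE ?d0 //.
    by have /andP[] := df n nW.
  - case: mon => mon; [right|left] => n nW; rewrite /c lef_pV2 ?posrE ?d0 // ?(ltnW nW) //.
      by have := mon n (ltnW nW); rewrite {1}/fdiff subr_ge0.
    by have := mon n (ltnW nW); rewrite {1}/fdiff subr_le0.
pose r n := (e2pi (fdiff f n) - 1 - (0 +i* (2 * pi * fdiff f n) : R[i])) * (c n)%:C.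
have rb (n : 'I_W) : normc (e2pi (f n) * r n) <= 256 * (C * lam).
  rewrite normcM normc_e2pi mul1r /r normcM.
  have dn := d0 n (ltnW (ltn_ord n)); have /andP[_ dC] := df n (ltnW (ltn_ord n)).
  rewrite normc_real_ge0; last by rewrite invr_ge0 ltW.
  rewrite ler_pdivrMr //; apply: (le_trans (e2pi_taylor _)).
  have h : fdiff f n ^+ 2 <= C * lam * fdiff f n by rewrite expr2 ler_pM2r.
  lra.
pose tpi : R[i] := 0 +i* (2 * pi).
have E : (\sum_(n < W) e2pi (f n)) * tpi =
   \sum_(n < W) (e2pi (f n.+1) - e2pi (f n)) * (c n)%:C - \sum_(n < W) e2pi (f n) * r n.
  rewrite -sumrB mulr_suml; apply: eq_bigr => n _.
  rewrite phase_step /r; set z := e2pi (f n).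
  have dn : fdiff f n != 0 by rewrite gt_eqF // d0 // ltnW.
  have -> : (0 +i* (2 * pi * fdiff f n) : R[i]) = tpi * (fdiff f n)%:C.
    apply/eqP; rewrite eq_complex /=; apply/andP; split; apply/eqP; ring.
  have cd : (fdiff f n)%:C * (c n)%:C = 1 by rewrite -rmorphM /c divff // rmorph1.
  by transitivity (z * tpi * ((fdiff f n)%:C * (c n)%:C)); [rewrite cd mulr1|ring].
have H : normc ((\sum_(n < W) e2pi (f n)) * tpi) <=
    4 * lam^-1 + 256 * (C * lam) * W%:R.
  rewrite E; apply: (le_trans (le_normcB _ _)); apply: lerD => //.
  apply: (le_trans (normc_le_sum _ _ _)).
  apply: (le_trans (ler_sum _ (fun n _ => rb n))).
  by rewrite sumr_const card_ord mulr_natr.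
rewrite normcM in H.
have N : 1 <= normc tpi.
  have p2 := pi_ge2 R; rewrite /= expr0n add0r sqrtr_sqr ger0_norm; lra.
have s0 := normc_ge0 (\sum_(n < W) e2pi (f n)).
have H2 : normc (\sum_(n < W) e2pi (f n)) <= 4 * lam^-1 + 256 * (C * lam) * W%:R.
  by apply: (le_trans _ H); rewrite ler_peMr.
apply: (le_trans H2).
have h1 : lam^-1 * K <= W%:R by rewrite mulrC ler_pdivrMr // mulrC.
have h2 : 8 * lam^-1 <= eta * W%:R.
  have : lam^-1 * K * eta <= W%:R * eta by rewrite ler_wpM2r // ltW.
  rewrite -mulrA KE; have : 0 < lam^-1 by rewrite invr_gt0.
  nra.
have h3 : 512 * (C * lam) <= eta.
  have : lam * K * eta <= 1 * eta by rewrite ler_wpM2r // ltW.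
  rewrite -mulrA KE; nra.
have h4 : 512 * (C * lam) * W%:R <= eta * W%:R by rewrite ler_wpM2r.
by lra.
Qed.

Lemma count_below (d0 : R) (h : nat) : 0 <= d0 ->
  \sum_(1 <= d < h) (if d%:R < d0 then 1 else 0 : R) <= d0.
Proof.
move=> d00; case: h => [|h]; first by rewrite big_geq.
suff : \sum_(1 <= d < h.+1) (if d%:R < d0 then 1 else 0 : R) <= d0 /\
  \sum_(1 <= d < h.+1) (if d%:R < d0 then 1 else 0 : R) <= h%:R by case.
elim: h => [|h [IH1 IH2]]; first by rewrite big_geq.
rewrite big_nat_recr //=; case: ifPn => hd.
  rewrite -natr1; split; last by rewrite lerD2r.
  by apply: (le_trans _ (ltW hd)); rewrite -natr1 lerD2r.
by rewrite addr0; split => //; rewrite (le_trans IH2) // ler_nat.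
Qed.

(** At small lags the differenced phase moves too little for a derivative test; those lags, at most
    d0 in number, take the trivial bound W. *)
Lemma corr_sum_bound f (W h : nat) (d0 c : R) : 0 <= d0 -> 0 <= c ->
  (forall d, (0 < d < h)%N -> d0 <= d%:R -> corr f W d <= c * W%:R) ->
  \sum_(1 <= d < h) corr f W d <= d0 * W%:R + c * W%:R * h%:R.
Proof.
move=> d00 c0 H.
have cW : 0 <= c * W%:R by rewrite mulr_ge0.
apply: (@le_trans _ _ (\sum_(1 <= d < h)
      ((if d%:R < d0 then 1 else 0) * W%:R + c * W%:R))).
  rewrite !big_nat; apply: ler_sum => d dh.
  case: ifPn => [_|].
    by rewrite mul1r; apply: (le_trans (corr_le _ _ _)); rewrite lerDl.
  by rewrite -leNgt mul0r add0r => d0d; exact: H.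
rewrite big_split /= -mulr_suml; apply: lerD.
  by rewrite ler_wpM2r // count_below.
by rewrite sumr_const_nat -[leLHS]mulr_natr ler_wpM2l // ler_nat leq_subr.
Qed.

(** Under these hypotheses each of the four terms W, 2 h^2, 2 d0 W and tau^2 W h / 4 is at most a
    quarter of tau^2 h W. *)
Lemma van_der_corput_scale f (W h : nat) (d0 tau : R) :
  (0 < h)%N -> (0 < W)%N -> 0 < tau ->
  4 <= tau ^+ 2 * h%:R -> 8 * h%:R <= tau ^+ 2 * W%:R -> 8 * d0 <= tau ^+ 2 * h%:R ->
  \sum_(1 <= d < h) corr f W d <= d0 * W%:R + tau ^+ 2 / 8 * W%:R * h%:R ->
  normc (\sum_(n < W) e2pi (f n)) <= 2 * h%:R + tau * W%:R.
Proof.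
move=> h0 W0 t0 H1 H2 H3 Bsum; apply: (van_der_corput h0 W0 t0 Bsum).
have hr : 0 <= h%:R :> R by []. have Wr : 0 <= W%:R :> R by [].
have i1 := ler_wpM2r Wr H1.
have i2 := ler_wpM2l hr H2.
have i3 := ler_wpM2r Wr H3.
move: (W%:R : R) (h%:R : R) i1 i2 i3 => w u; clear; move: (tau ^+ 2) => t i1 i2 i3.
rewrite expr2; lra.
Qed.

(** Together the last two bounds on K give K^2 <= W^k. *)
Lemma scale_large (W k : nat) (lam K w : R) : 0 < lam -> 1 <= K -> 0 <= w ->
  w ^+ k < K -> lam * K <= 1 -> K <= lam * W%:R ^+ k -> w <= W%:R.
Proof.
move=> lam0 K1 w0 wK lamK KW; rewrite leNgt; apply/negP => Ww.
have h0 : W%:R ^+ k <= w ^+ k by rewrite lerXn2r ?nnegrE // ltW.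
have h1 : K * K <= K * (lam * W%:R ^+ k) by rewrite ler_wpM2l //; lra.
rewrite mulrA (mulrC K lam) in h1.
have h3 : lam * K * W%:R ^+ k <= 1 * W%:R ^+ k by rewrite ler_wpM2r ?exprn_ge0.
have h4 : K <= K * K by rewrite ler_peMr //; lra.
move: h0 h1 h3 h4 wK; clear; lra.
Qed.

(* The differencing range h is of order min (W, 1 / lam): then the differenced
   phases, of size d lam with d of order h, still satisfy the hypotheses of the
   test of one order less. *)
Lemma differencing_range (k : nat) (K1 t c : R) : 1 <= K1 -> 0 < t -> 0 < c ->
  exists2 K : R, 1 <= K & forall (W : nat) (lam : R),
    0 < lam -> lam * K <= 1 -> K <= lam * W%:R ^+ k.+2 ->
    (0 < W)%N /\ exists2 h : nat, (0 < h)%N &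
      [/\ 4 <= t * h%:R, h%:R <= c * W%:R, h%:R * (K1 * lam) <= 1 &
          8 * (K1 / (lam * W%:R ^+ k.+1)) <= t * h%:R].
Proof.
move=> K11 t0 c0.
pose m0 := 8 / t + 2; have m00 : 2 < m0 by rewrite /m0 ltrDr divr_gt0.
have m0t : 8 <= t * m0.
  by rewrite /m0 mulrDr mulrCA divff ?gt_eqF // mulr1 lerDl mulr_ge0 // ltW.
pose w := 1 + m0 / c + 16 * K1 ^+ 2 / t.
have w0 : 0 <= m0 / c by rewrite divr_ge0 // ltW //; lra.
have w1 : 0 <= 16 * K1 ^+ 2 / t.
  by apply: divr_ge0 (ltW t0); apply: mulr_ge0 (sqr_ge0 _).
have w2 : 1 <= w by rewrite /w; lra.
have q0 : 0 <= 16 * K1 / (t * c).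
  by apply: divr_ge0; apply: mulr_ge0; rewrite ?(ltW t0) ?(ltW c0) //; lra.
have K1m : 0 <= K1 * m0 by rewrite mulr_ge0 //; lra.
have wk : 0 <= w ^+ k.+2 by rewrite exprn_ge0 //; lra.
exists (1 + w ^+ k.+2 + K1 * m0 + 16 * K1 / (t * c)); first by lra.
set K := 1 + _ + _ + _ => W lam lam0 lamK KW.
have [Kge1 Kw Km Kq] : [/\ 1 <= K, w ^+ k.+2 < K, K1 * m0 <= K & 16 * K1 / (t * c) <= K].
  by rewrite /K; clear -q0 K1m wk; split; lra.
have Ww : w <= W%:R by apply: scale_large Kw lamK KW => //; clear -w2; lra.
have [Wm WK W1] : [/\ m0 / c <= W%:R, 16 * K1 ^+ 2 / t <= W%:R & 1 <= W%:R :> R].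
  by rewrite /w in Ww; clear -w0 w1 Ww; split; lra.
clearbody K w.
have K10 : 0 < K1 by lra.
have Wpos : (0 < W)%N by rewrite -(ltr_nat R) (lt_le_trans _ W1).
have Wr : 0 < W%:R :> R by rewrite ltr0n.
split => //.
pose m := Num.min (c * W%:R) ((K1 * lam)^-1).
have K1l : 0 < K1 * lam by rewrite mulr_gt0.
have mm0 : m0 <= m.
  rewrite /m le_min mulrC -ler_pdivrMr // Wm /= -div1r ler_pdivlMr //.
  apply: le_trans lamK; rewrite mulrA mulrC ler_wpM2l ?(ltW lam0) //.
  by rewrite mulrC.
have /andP[hm2 hm] : m / 2 <= (Num.truncn m)%:R <= m.
  have m2 : 2 <= m by apply: le_trans mm0; rewrite ltW.
  have m_ge0 : 0 <= m by apply: le_trans m2.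
  have /andP[h1 h2] := truncn_itv m_ge0; rewrite h1 andbT.
  by move: h2 m2; rewrite -natr1; clear; lra.
set h := Num.truncn m in hm2 hm.
have tm : t * m / 2 <= t * h%:R by rewrite -mulrA ler_wpM2l // ltW.
have h4 : 4 <= t * h%:R.
  apply: le_trans tm; have := ler_wpM2l (ltW t0) mm0; move: m0t; clear; lra.
exists h.
  have : 0 < t * h%:R by apply: lt_le_trans h4.
  by rewrite pmulr_rgt0 // ltr0n.
split => //.
- by apply: (le_trans hm); rewrite /m ge_min lexx.
- by rewrite -ler_pdivlMr // div1r; apply: (le_trans hm); rewrite /m ge_min lexx orbT.
apply: (le_trans _ tm).
have Wk0 : 0 < lam * W%:R ^+ k.+1 by rewrite mulr_gt0 // exprn_gt0.
rewrite ler_pdivlMr //.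
have -> : 8 * (K1 / (lam * W%:R ^+ k.+1)) * 2 = 16 * K1 / (lam * W%:R ^+ k.+1) by ring.
rewrite ler_pdivrMr // {1}/m; have [cc|cc] := leP (c * W%:R) ((K1 * lam)^-1).
  have : 16 * K1 / (t * c) <= lam * W%:R ^+ k.+2 by apply: le_trans KW.
  rewrite ler_pdivrMr ?mulr_gt0 // exprS => h5.
  by apply: (le_trans h5); apply: le_of_eq; ring.
rewrite -(ler_pM2l K10) mulrCA -expr2.
have -> : K1 * (t * (K1 * lam)^-1 * (lam * W%:R ^+ k.+1)) = W%:R ^+ k.+1 * t.
  by field; rewrite !gt_eqF.
rewrite -ler_pdivrMr //; apply: (le_trans WK).
by rewrite -[leLHS]mul1r exprSr ler_wpM2r ?(ltW Wr) // exprn_ege1.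
Qed.

(** Induction on the order through [fdiff_iter_shift]: at lag d, size lam becomes size d lam. The
    range [k.+1 * W] leaves room for k successive lags, each shorter than W. *)
Lemma kth_derivative_test k (C eta : R) : 1 <= C -> 0 < eta ->
  exists2 K : R, 1 <= K & forall (W : nat) (lam : R) f,
    0 < lam -> lam * K <= 1 -> K <= lam * W%:R ^+ k.+1 ->
    (forall n, (n <= k.+1 * W)%N -> lam <= iter k.+1 fdiff f n <= C * lam) ->
    (forall n, (n <= k.+1 * W)%N -> 0 <= iter k.+2 fdiff f n) \/
    (forall n, (n <= k.+1 * W)%N -> iter k.+2 fdiff f n <= 0) ->
    normc (\sum_(n < W) e2pi (f n)) <= eta * W%:R.
Proof.
move=> C1; elim: k eta => [|k IH] eta eta0.
  have [K K1 HK] := first_derivative_test C1 eta0.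
  exists K => // W lam f lam0 lamK; rewrite expr1 mul1n; exact: HK.
pose tau := eta / 2; have tau0 : 0 < tau by rewrite /tau divr_gt0.
have tau20 : 0 < tau ^+ 2 by rewrite exprn_gt0.
have t8 : 0 < tau ^+ 2 / 8 by rewrite divr_gt0.
have [K1 K11 HK1] := IH _ t8.
pose c := Num.min 1 (Num.min (tau ^+ 2 / 8) (eta / 4)).
have c0 : 0 < c by rewrite /c !lt_min t8 ltr01 divr_gt0.
have [K Kge1 HK] := differencing_range k K11 tau20 c0.
exists K => // W lam f lam0 lamK KW df mon.
have [Wpos [h hpos [h4 hcW hKl d0h]]] := HK W lam lam0 lamK KW.
have Wr : 0 < W%:R :> R by rewrite ltr0n.
have hc (x : R) : c <= x -> h%:R <= x * W%:R.
  by move=> cx; apply: (le_trans hcW); rewrite ler_wpM2r // ltW.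
have h8 : 8 * h%:R <= tau ^+ 2 * W%:R.
  have /hc : c <= tau ^+ 2 / 8 by rewrite /c !ge_min lexx orbT.
  by clear; lra.
have h2 : 2 * h%:R <= tau * W%:R.
  have /hc : c <= eta / 4 by rewrite /c !ge_min lexx !orbT.
  by rewrite /tau; clear; lra.
have hW : (h <= W)%N.
  by rewrite -(ler_nat R) -[leRHS]mul1r; apply: hc; rewrite /c ge_min lexx.
have Wk0 : 0 < lam * W%:R ^+ k.+1 by rewrite mulr_gt0 // exprn_gt0.
have K10 : 0 < K1 by exact: lt_le_trans K11.
(* This is the least lag at which the lower bound required by the induction hypothesis holds for
   [d * lam]. *)
have d00 : 0 <= K1 / (lam * W%:R ^+ k.+1) by rewrite divr_ge0 // ltW.
have Bsum := corr_sum_bound (f := f) (W := W) (h := h) d00 (ltW t8).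
have := van_der_corput_scale hpos Wpos tau0 h4 h8 d0h (Bsum _).
move=> H; apply: (le_trans (H _)); last by move: h2; rewrite /tau; clear; lra.
clear Bsum H => d /andP[d1 dh] d0d; rewrite /corr.
have dp : 0 < d%:R :> R by rewrite ltr0n.
have idx n j : (n <= k.+1 * W -> j < d -> n + j <= k.+2 * W)%N.
  move=> nW jd; rewrite (mulSn k.+1) addnC leq_add //.
  by rewrite ltnW // (leq_trans jd) // ltnW // (leq_trans dh).
have dhr : d%:R <= h%:R :> R by rewrite ler_nat ltnW.
apply: (HK1 W (d%:R * lam) (fun n => f (n + d)%N - f n)).
- by rewrite mulr_gt0.
- apply: le_trans hKl; rewrite -mulrA (mulrC lam) ler_wpM2r // ltW //.
  by rewrite mulr_gt0.
- by rewrite -(mulrA d%:R) -ler_pdivrMr.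
- move=> n nW; rewrite mulrCA; apply: fdiff_shift_bounds => j jd.
  by apply: df; exact: idx jd.
- case: mon => mon; [left|right] => n nW; rewrite (fdiff_iter_shift k.+2 f d n).
    by apply: sumr_ge0 => j _; apply: mon; exact: idx (ltn_ord j).
  by apply: sumr_le0 => j _; apply: mon; exact: idx (ltn_ord j).
Qed.

(** By monotonicity of [P], the least kap and the largest W over finitely many d serve all of
    them. *)
Lemma finite_thresholds (P : nat -> R -> nat -> Prop) (h : nat) :
  (forall d kap kap' W W', kap' <= kap -> (W <= W')%N -> P d kap W -> P d kap' W') ->
  (forall d, (0 < d)%N -> exists2 kap, 0 < kap & exists W, P d kap W) ->
  exists2 kap, 0 < kap & exists W, forall d, (0 < d < h)%N -> P d kap W.
Proof.
move=> mono ex; elim: h => [|h [kap kap0 [W HW]]].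
  by exists 1 => //; exists 0%N => d; rewrite andbF.
case: h HW => [|h] HW; first by exists 1 => //; exists 0%N => -[].
have [kap' kap'0 [W' HW']] := ex h.+1 isT.
exists (Num.min kap kap'); first by rewrite lt_min kap0.
exists (maxn W W') => d /andP[d0]; rewrite ltnS leq_eqVlt => /orP[/eqP ->|dh].
  by apply: mono HW'; rewrite ?ge_min ?lexx ?orbT ?leq_maxr.
by apply: (mono _ _ _ _ _ _ _ (HW d _)); rewrite ?ge_min ?lexx ?leq_maxl ?d0.
Qed.

(** In the base case e(gam) differs from 1 and the sum is nearly geometric. Lag d multiplies the
    limit by d, so irrationality of gam, rather than nonintegrality, is what survives the induction.
    The number h of lags depends only on eta, so finitely many thresholds occur. *)
Lemma irrational_test t (gam eta : R) :
  (forall (d : nat) (j : int), (0 < d)%N -> gam * d%:R <> j%:~R) -> 0 < eta ->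
  exists2 kap : R, 0 < kap & exists W0 : nat, forall (W : nat) f,
    (W0 <= W)%N ->
    (forall n, (n <= t.+1 * W)%N -> `|iter t.+1 fdiff f n - gam| <= kap) ->
    normc (\sum_(n < W) e2pi (f n)) <= eta * W%:R.
Proof.
elim: t gam eta => [|t IH] gam eta irr eta0.
  set del := normc (e2pi gam - 1).
  have del0 : 0 < del.
    rewrite lt_neqAle normc_ge0 andbT eq_sym; apply/eqP => /eq0_normc /eqP.
    rewrite subr_eq0 => /eqP /e2pi_eq1 [j gj].
    by apply: (irr 1%N j) => //; rewrite mulr1.
  exists (eta * del / 32); first by rewrite divr_gt0 // mulr_gt0.
  exists (Num.truncn (4 / (eta * del))).+1 => W f W0 df.
  have WR : 4 / (eta * del) <= W%:R.
    have : 4 / (eta * del) < (Num.truncn (4 / (eta * del))).+1%:R by exact: truncnS_gt.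
    by move=> /ltW h; apply: (le_trans h); rewrite ler_nat.
  rewrite -(ler_pM2r del0) /del -normcM mulr_suml.
  have -> : \sum_(n < W) e2pi (f n) * (e2pi gam - 1) =
     \sum_(n < W) (e2pi (f n.+1) - e2pi (f n)) -
     \sum_(n < W) e2pi (f n) * (e2pi (fdiff f n) - e2pi gam).
    by rewrite -sumrB; apply: eq_bigr => n _; rewrite phase_step; ring.
  apply: (le_trans (le_normcB _ _)).
  rewrite -(big_mkord xpredT (fun n => e2pi (f n.+1) - e2pi (f n))).
  rewrite (telescope_sumr (fun n => e2pi (f n))) //.
  have T : normc (e2pi (f W) - e2pi (f 0%N)) <= 2.
    by apply: (le_trans (le_normcB _ _)); rewrite !normc_e2pi; lra.
  have T2 : normc (\sum_(n < W) e2pi (f n) * (e2pi (fdiff f n) - e2pi gam)) <=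
      eta * del / 2 * W%:R.
    apply: (le_trans (normc_le_sum _ _ _)).
    rewrite -[W in leRHS]card_ord mulr_natr -sumr_const; apply: ler_sum => n _.
    rewrite normcM normc_e2pi mul1r; apply: (le_trans (normc_e2piB _ _)).
    have := df n; rewrite mul1n => /(_ (ltnW (ltn_ord n))) /=; lra.
  have : 4 <= W%:R * (eta * del) by rewrite -ler_pdivrMr // mulr_gt0.
  by rewrite -/del; lra.
pose tau := eta / 2; have tau0 : 0 < tau by rewrite /tau; lra.
have tau20 : 0 < tau ^+ 2 by rewrite exprn_gt0.
have t8 : 0 < tau ^+ 2 / 8 by lra.
pose h := (Num.truncn (4 / tau ^+ 2)).+1.
have hr : 4 / tau ^+ 2 <= h%:R by apply/ltW/truncnS_gt.
have hp : 0 < h%:R :> R by rewrite ltr0n.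
pose P (d : nat) (kap : R) (W0 : nat) := forall (W : nat) f, (W0 <= W)%N ->
    (forall n, (n <= t.+1 * W)%N -> `|iter t.+1 fdiff f n - gam * d%:R| <= kap) ->
    normc (\sum_(n < W) e2pi (f n)) <= tau ^+ 2 / 8 * W%:R.
have [kap kap0 [W0 HW0]] : exists2 kap, 0 < kap & exists W, forall d, (0 < d < h)%N -> P d kap W.
  apply: finite_thresholds => [d k1 k2 W1 W2 k12 W12 H W f WW df|d dp].
    apply: H => [|n nW]; first exact: leq_trans WW.
    exact: le_trans (df n nW) k12.
  apply: IH => // d' j d'0; rewrite -mulrA -natrM; apply: irr.
  by rewrite muln_gt0 dp.
exists (kap / h%:R); first by rewrite divr_gt0.
exists (maxn h (maxn W0 (Num.truncn (8 * h%:R / tau ^+ 2 + 4 * h%:R / eta)).+1)).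
move=> W f; rewrite !geq_max => /andP[hW /andP[W0W]] WW df.
have WR : 8 * h%:R / tau ^+ 2 + 4 * h%:R / eta <= W%:R.
  by apply: (le_trans (ltW (truncnS_gt _))); rewrite ler_nat.
have j1 : 0 <= 8 * h%:R / tau ^+ 2 by rewrite divr_ge0 // ?mulr_ge0 // ltW.
have j2 : 0 <= 4 * h%:R / eta by rewrite divr_ge0 // ?mulr_ge0 // ltW.
have Wpos : (0 < W)%N by exact: leq_trans WW.
have Bsum : \sum_(1 <= d < h) corr f W d <= tau ^+ 2 / 8 * W%:R * h%:R.
  apply: (@le_trans _ _ (\sum_(1 <= d < h) (tau ^+ 2 / 8 * W%:R))); last first.
    rewrite sumr_const_nat -[leLHS]mulr_natr ler_wpM2l // ?ler_nat ?leq_subr //.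
    by rewrite mulr_ge0 // ltW.
  rewrite !big_nat; apply: ler_sum => d dh; rewrite /corr.
  apply: (HW0 d dh W (fun n => f (n + d)%N - f n) W0W) => n nW.
  move: dh => /andP[d1 dh].
  rewrite fdiff_iter_shift -[d in gam * d%:R]card_ord mulr_natr -sumr_const -sumrB.
  apply: (le_trans (ler_norm_sum _ _ _)).
  apply: (@le_trans _ _ (\sum_(j < d) (kap / h%:R))).
    apply: ler_sum => j _; apply: df.
    have := ltn_ord j; have := ltn_trans dh (leq_ltn_trans hW (ltnSn W)).
    rewrite ltnS => dW jd; rewrite mulSn addnC leq_add //.
    by rewrite ltnW // (leq_trans jd).
  rewrite sumr_const card_ord -[leLHS]mulr_natr -mulrA ler_piMr //; first exact: ltW.
  by rewrite mulrC ler_pdivrMr // mul1r ler_nat ltnW.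
have := van_der_corput (isT : (0 < h)%N) Wpos tau0 Bsum.
have -> : W%:R + 2 * h%:R ^+ 2 + 2 * (tau ^+ 2 / 8 * W%:R * h%:R) <=
        tau ^+ 2 * h%:R * W%:R.
  have i1 : 4 * W%:R <= tau ^+ 2 * h%:R * W%:R.
    by rewrite ler_wpM2r // mulrC -ler_pdivrMr.
  have i2 : 8 * h%:R ^+ 2 <= tau ^+ 2 * h%:R * W%:R.
    have : h%:R * 8 <= tau ^+ 2 * W%:R.
      by rewrite [leRHS]mulrC -ler_pdivrMr // mulrC; lra.
    move=> /(ler_wpM2l (ltW hp)); rewrite expr2; lra.
  lra.
move=> /(_ isT) H; apply: (le_trans H).
have : 4 * h%:R <= W%:R * eta by rewrite -ler_pdivrMr //; lra.
rewrite /tau; lra.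
Qed.

End DerivativeTests.

(** * From sequences to smooth functions on short windows *)

Section Windows.
Variable R : realType.
Implicit Types (f g : nat -> R) (a : nat -> R -> R).

Lemma mean_value (f df : R -> R) (u v : R) : u <= v ->
  (forall x, u <= x <= v -> is_derive x 1 f (df x)) ->
  exists2 c, u <= c <= v & f v - f u = df c * (v - u).
Proof.
move=> uv D.
have [x|x|c cuv E] := @MVT_segment R f df u v uv.
- by rewrite in_itv /= => /andP[ux xv]; apply: D; rewrite !ltW.
- move: x; apply: derivable_within_continuous => x; rewrite in_itv /= => xuv.
  by have [] := D x xuv.
- by exists c => //; move: cuv; rewrite in_itv.
Qed.

(** All derivatives are carried along as a family, so that scaling, differencing and adding a
    polynomial act on it termwise. *)
Definition deriv_chain (N : nat) a (x0 : R) :=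
  forall i x, (i < N)%N -> x0 <= x -> is_derive x 1 (a i) (a i.+1 x).

Definition sdiff (q : R) (g : R -> R) x := g (x + q) - g x.

Lemma is_derive_translate (g : R -> R) (q x d : R) :
  is_derive (x + q) 1 g d -> is_derive x 1 (fun y => g (y + q)) d.
Proof.
move=> D; have H : is_derive x 1 (fun y : R => y + q) 1.
  by have := is_deriveD (is_derive_id x (1 : R)) (is_derive_cst q x (1 : R)); rewrite addr0.
by have := @is_derive1_comp R g (fun y => y + q) x d 1 D H; rewrite mulr1.
Qed.

Lemma sdiff_chain N a x0 q : 0 <= q -> deriv_chain N a x0 ->
  deriv_chain N (fun i => sdiff q (a i)) x0.
Proof.
move=> q0 ch i x iN x0x; apply: is_deriveB; last exact: ch.
by apply: is_derive_translate; apply: ch; rewrite // (le_trans x0x) // lerDl.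
Qed.

Lemma iter_sdiff_chain N k a x0 q : 0 <= q -> deriv_chain N a x0 ->
  deriv_chain N (fun i => iter k (sdiff q) (a i)) x0.
Proof.
move=> q0 ch; elim: k => [//|k IH].
exact: (sdiff_chain (a := fun i => iter k (sdiff q) (a i))).
Qed.

(** One application of the mean value theorem per difference, each moving the point by at most q. *)
Lemma iter_sdiff_mean N k a x0 q i x : 0 <= q -> deriv_chain N a x0 ->
  (i + k <= N)%N -> x0 <= x ->
  exists2 y, x <= y <= x + k%:R * q &
    iter k (sdiff q) (a i) x = q ^+ k * a (i + k)%N y.
Proof.
move=> q0 ch; elim: k i x => [|k IH] i x iN x0x.
  by exists x; rewrite ?mul0r ?addr0 ?lexx // expr0 mul1r addn0.
rewrite iterS {1}/sdiff.
have xq : x <= x + q by rewrite lerDl.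
have [|c /andP[c1 c2] ->] := @mean_value (iter k (sdiff q) (a i))
   (iter k (sdiff q) (a i.+1)) x (x + q) xq.
  move=> y /andP[xy _]; apply: (iter_sdiff_chain k q0 ch).
    by apply: leq_trans iN; rewrite addnS ltnS leq_addr.
  exact: le_trans xy.
have [||y /andP[y1 y2] ->] := IH i.+1 c; [by rewrite addSnnS|exact: le_trans c1|].
exists y; last by rewrite addSnnS (addrC x) addrK exprS; ring.
rewrite (le_trans c1 y1) /=; apply: (le_trans y2).
by rewrite -natr1 mulrDl mul1r; lra.
Qed.

Lemma iter_fdiff_sdiff k (g : R -> R) (x q : R) n :
  iter k (@fdiff R) (fun m : nat => g (x + q * m%:R)) n = iter k (sdiff q) g (x + q * n%:R).
Proof.
elim: k n => [//|k IH] n; rewrite !iterS {1}/fdiff {1}/sdiff !IH.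
by rewrite -natr1 mulrDr mulr1 addrA.
Qed.

Lemma normc_phase_opp f (W : nat) :
  normc (\sum_(n < W) e2pi (- f n)) = normc (\sum_(n < W) e2pi (f n)).
Proof.
rewrite -[RHS]normc_conj rmorph_sum; congr normc.
by apply: eq_bigr => n _; rewrite e2piN.
Qed.

(** Conjugation; it allows a derivative of constant sign to be taken positive. *)
Lemma normc_phase_sign (s : R) f (W : nat) : `|s| = 1 ->
  normc (\sum_(n < W) e2pi (s * f n)) = normc (\sum_(n < W) e2pi (f n)).
Proof.
move=> s1; have [s0|s0] := leP 0 s.
  by move: s1; rewrite ger0_norm // => ->; under eq_bigr do rewrite mul1r.
move: s1; rewrite ltr0_norm // => s1; have -> : s = -1 by rewrite -s1 opprK.
by under eq_bigr do rewrite mulN1r; exact: normc_phase_opp.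
Qed.

Lemma truncn_half (x : R) : 2 <= x -> x / 2 <= (Num.truncn x)%:R <= x.
Proof.
move=> x2; have /truncn_itv/andP[h1 h2] : 0 <= x by lra.
by rewrite h1 andbT; move: h2; rewrite -natr1; lra.
Qed.

(** Keeps every point met by k-fold differencing of a window inside [ka X, 2 X], the range on which
    sizes of derivatives are controlled. *)
Lemma window_range (k : nat) (ka eps : R) (q p X n : nat) (y : R) :
  0 <= eps -> eps * q%:R * k%:R <= 1 / 2 -> 2 * (k%:R * q%:R) <= X%:R :> R ->
  ka * X%:R <= p%:R -> (p <= X)%N -> (n <= k * Num.truncn (eps * X%:R))%N ->
  p%:R + q%:R * n%:R <= y <= p%:R + q%:R * n%:R + k%:R * q%:R ->
  ka * X%:R <= y <= 2 * X%:R.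
Proof.
move=> e0 e1 X2 kp pX nW /andP[y1 y2].
have q0 : 0 <= q%:R :> R by []. have n0 : 0 <= n%:R :> R by [].
have X0 : 0 <= X%:R :> R by [].
have qn : 0 <= q%:R * n%:R :> R by rewrite mulr_ge0.
have eX : 0 <= eps * X%:R by rewrite mulr_ge0.
have pXr : p%:R <= X%:R :> R by rewrite ler_nat.
have nr : n%:R <= k%:R * (eps * X%:R).
  apply: (@le_trans _ _ (k * Num.truncn (eps * X%:R))%:R); first by rewrite ler_nat.
  rewrite natrM ler_wpM2l //.
  by have /andP[] := truncn_itv eX.
have h : q%:R * n%:R <= X%:R / 2 :> R.
  apply: (@le_trans _ _ (q%:R * (k%:R * (eps * X%:R)))); first by rewrite ler_wpM2l.
  have -> : q%:R * (k%:R * (eps * X%:R)) = eps * q%:R * k%:R * X%:R by ring.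
  by apply: (le_trans (ler_wpM2r X0 e1)); lra.
by apply/andP; split; lra.
Qed.

Lemma window_kth k (C eta ka eps : R) (q : nat) :
  1 <= C -> 0 < eta -> 0 < eps -> (0 < q)%N -> eps * q%:R * k.+2%:R <= 1 / 2 ->
  exists2 K : R, 1 <= K & forall (X : nat) a (x0 lam s : R),
    K <= X%:R -> deriv_chain k.+2 a x0 -> x0 <= ka * X%:R ->
    0 < lam -> lam * K <= 1 -> K <= lam * X%:R ^+ k.+1 -> `|s| = 1 ->
    (forall y, ka * X%:R <= y <= 2 * X%:R -> lam <= s * a k.+1 y <= C * lam) ->
    (forall y, ka * X%:R <= y <= 2 * X%:R -> 0 <= a k.+2 y) \/
    (forall y, ka * X%:R <= y <= 2 * X%:R -> a k.+2 y <= 0) ->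
    forall p : nat, ka * X%:R <= p%:R -> (p <= X)%N ->
    normc (\sum_(m < Num.truncn (eps * X%:R)) e2pi (a 0%N (p%:R + q%:R * m%:R))) <=
      eta * (Num.truncn (eps * X%:R))%:R.
Proof.
move=> C1 eta0 eps0 q0 epsk.
have [K1 K11 HK] := kth_derivative_test k C1 eta0.
have qr : 0 < q%:R :> R by rewrite ltr0n.
have qk0 : 0 < q%:R ^+ k.+1 :> R by rewrite exprn_gt0.
have e2k : 0 < (eps / 2) ^+ k.+1 by rewrite exprn_gt0 //; lra.
have t1 : 0 <= q%:R ^+ k.+1 * K1 by rewrite mulr_ge0 ?ltW //; lra.
have t2 : 0 <= K1 / (eps / 2) ^+ k.+1 by rewrite divr_ge0 ?ltW //; lra.
have t3 : 0 <= 2 / eps by rewrite divr_ge0 // ltW.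
have t4 : 0 <= 2 * (k.+2%:R * q%:R) :> R by rewrite !mulr_ge0.
(* The step q multiplies the difference of order k+1 by q^(k+1); the window length W is at least eps
   X / 2 once eps X >= 2; the last term serves [window_range]. *)
exists (1 + q%:R ^+ k.+1 * K1 + K1 / (eps / 2) ^+ k.+1 + 2 / eps + 2 * (k.+2%:R * q%:R)).
  by lra.
set K := 1 + _ + _ + _ + _ => X a x0 lam s KX ch x0X lam0 lamK KlX s1 bd mon p kp pX.
set W := Num.truncn _.
have XX : 2 / eps <= X%:R by rewrite /K in KX; lra.
have /truncn_half/andP[] : 2 <= eps * X%:R by rewrite mulrC -ler_pdivrMr.
rewrite -/W => W1 W2.
pose c i x := s * a i x.
have chc : deriv_chain k.+2 c x0 by move=> i x iN x0x; apply: is_deriveZ; exact: ch.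
pose f (m : nat) := c 0%N (p%:R + q%:R * m%:R).
have -> : normc (\sum_(m < W) e2pi (a 0%N (p%:R + q%:R * m%:R))) =
    normc (\sum_(m < W) e2pi (f m)).
  by rewrite -(normc_phase_sign (fun m => a 0%N (p%:R + q%:R * m%:R)) W s1).
have rg j n y : (j <= k.+2)%N -> (n <= k.+1 * W)%N ->
    p%:R + q%:R * n%:R <= y <= p%:R + q%:R * n%:R + j%:R * q%:R ->
    ka * X%:R <= y <= 2 * X%:R.
  move=> jk nW /andP[y1 y2]; apply: (@window_range k.+2 ka eps q p X n y) => //.
  - exact: ltW.
  - by rewrite /K in KX; lra.
  - by apply: (leq_trans nW); rewrite leq_mul2r leqnSn orbT.
  - rewrite y1 /=; apply: (le_trans y2); rewrite lerD2l ler_wpM2r ?ler_nat //; exact: ltW.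
have x0p n : x0 <= p%:R + q%:R * n%:R.
  by apply: (le_trans x0X); apply: (le_trans kp); rewrite lerDl mulr_ge0.
apply: (HK W (q%:R ^+ k.+1 * lam)).
- by rewrite mulr_gt0.
- apply: le_trans lamK; rewrite (mulrC _ lam) -mulrA ler_wpM2l ?(ltW lam0) //.
  by rewrite /K; lra.
- have h1 : (eps / 2) ^+ k.+1 * X%:R ^+ k.+1 <= W%:R ^+ k.+1.
    rewrite -exprMn lerXn2r ?nnegrE //; first by rewrite mulr_ge0 //; lra.
    by lra.
  have h2 : K1 <= (eps / 2) ^+ k.+1 * (lam * X%:R ^+ k.+1).
    by rewrite mulrC -ler_pdivrMr //; apply: le_trans KlX; rewrite /K; lra.
  have h3 : 1 <= q%:R ^+ k.+1 :> R by rewrite exprn_ege1 // ler1n.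
  apply: (le_trans h2); rewrite mulrCA -mulrA.
  rewrite -[leLHS]mul1r; apply: ler_pM => //.
    apply: mulr_ge0 (ltW lam0) _; apply: mulr_ge0 (ltW e2k) _.
    by rewrite exprn_ge0.
  by rewrite ler_wpM2l // ltW.
- move=> n nW; rewrite iter_fdiff_sdiff mulrCA.
  have [y yb ->] := @iter_sdiff_mean _ k.+1 _ _ _ 0%N _ (ltW qr) chc (leqnSn _) (x0p n).
  have /andP[b1 b2] := bd y (rg _ _ _ (leqnSn _) nW yb).
  by rewrite add0n !ler_wpM2l // ltW.
- have H n : (n <= k.+1 * W)%N -> exists2 y, ka * X%:R <= y <= 2 * X%:R &
      iter k.+2 (@fdiff R) f n = q%:R ^+ k.+2 * (s * a k.+2 y).
    move=> nW; rewrite iter_fdiff_sdiff.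
    have [y yb ->] := @iter_sdiff_mean _ k.+2 _ _ _ 0%N _ (ltW qr) chc (leqnn _) (x0p n).
    by exists y => //; apply: (rg k.+2 n).
  have q20 : 0 <= q%:R ^+ k.+2 :> R by rewrite exprn_ge0.
  case: mon => mon; have [s0|/ltW s0] := leP 0 s; [left|right|right|left] => n /H[y yb ->].
  + by rewrite mulr_ge0 // mulr_ge0 // mon.
  + by rewrite mulr_ge0_le0 // mulr_le0_ge0 // mon.
  + by rewrite mulr_ge0_le0 // mulr_ge0_le0 // mon.
  + by rewrite mulr_ge0 // mulr_le0 // mon.
Qed.

Lemma window_irrational t (gam eta ka eps : R) (q : nat) :
  (forall (d : nat) (j : int), (0 < d)%N -> gam * d%:R <> j%:~R) ->
  0 < eta -> 0 < eps -> (0 < q)%N -> eps * q%:R * t.+1%:R <= 1 / 2 ->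
  exists2 kap : R, 0 < kap & exists2 K : R, 1 <= K & forall (X : nat) a (x0 : R),
    K <= X%:R -> deriv_chain t.+1 a x0 -> x0 <= ka * X%:R ->
    (forall y, ka * X%:R <= y <= 2 * X%:R -> `|a t.+1 y - gam| <= kap) ->
    forall p : nat, ka * X%:R <= p%:R -> (p <= X)%N ->
    normc (\sum_(m < Num.truncn (eps * X%:R)) e2pi (a 0%N (p%:R + q%:R * m%:R))) <=
      eta * (Num.truncn (eps * X%:R))%:R.
Proof.
move=> irr eta0 eps0 q0 epst.
have qr : 0 < q%:R :> R by rewrite ltr0n.
have qk0 : 0 < q%:R ^+ t.+1 :> R by rewrite exprn_gt0.
(* Along a progression of step q the limit of the differences becomes q^(t+1) gam, which is still
   irrational. *)
have irr' (d : nat) (j : int) : (0 < d)%N -> (q%:R ^+ t.+1 * gam) * d%:R <> j%:~R.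
  move=> d0; rewrite mulrAC mulrC -natrX -natrM; apply: irr.
  by rewrite muln_gt0 expn_gt0 q0.
have [kap kap0 [W0 HW]] := irrational_test t irr' eta0.
exists (kap / q%:R ^+ t.+1); first by rewrite divr_gt0.
have t1 : 0 <= (2 + 2 * W0%:R) / eps by rewrite divr_ge0 ?addr_ge0 ?mulr_ge0 // ltW.
have t2 : 0 <= 2 * (t.+1%:R * q%:R) :> R by rewrite !mulr_ge0.
exists (1 + (2 + 2 * W0%:R) / eps + 2 * (t.+1%:R * q%:R)); first by lra.
move=> X a x0 KX ch x0X bd p kp pX; set W := Num.truncn _.
have eX : 2 + 2 * W0%:R <= eps * X%:R.
  by rewrite [leRHS]mulrC -ler_pdivrMr //; lra.
have W00 : 0 <= W0%:R :> R by [].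
have /truncn_half/andP[W1 W2] : 2 <= eps * X%:R by lra.
rewrite -/W in W1 W2.
apply: (HW W (fun m : nat => a 0%N (p%:R + q%:R * m%:R))).
  by rewrite -(ler_nat R); lra.
move=> n nW; rewrite iter_fdiff_sdiff.
have x0p : x0 <= p%:R + q%:R * n%:R.
  by apply: (le_trans x0X); apply: (le_trans kp); rewrite lerDl mulr_ge0.
have [y yb ->] := @iter_sdiff_mean _ t.+1 _ _ _ 0%N _ (ltW qr) ch (leqnn _) x0p.
rewrite add0n -mulrBr normrM gtr0_norm // mulrC -ler_pdivlMr //; apply: bd.
apply: (@window_range t.+1 ka eps q p X n y) => //; first exact: ltW.
by lra.
Qed.

(** Windows starting below ka X, where nothing is known, take the trivial bound; they form a
    proportion ka of all. *)
Lemma sum_of_windows f (X W q : nat) (ka eta eps : R) :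
  0 < ka -> 0 <= eta -> (0 < W)%N -> W%:R <= eps * X%:R ->
  (forall p : nat, ka * X%:R <= p%:R -> (p <= X)%N ->
    normc (\sum_(m < W) e2pi (f (p + q * m)%N)) <= eta * W%:R) ->
  normc (\sum_(n < X) e2pi (f n)) <= (2 * q%:R * eps + ka + eta) * X%:R + 1.
Proof.
move=> ka0 eta0 W0 WX H.
have Wr : 0 < W%:R :> R by rewrite ltr0n.
rewrite -(ler_pM2r Wr).
apply: (le_trans (smoothing q X W (phase_le1 f))).
have kX0 : 0 <= ka * X%:R by rewrite mulr_ge0 // ltW.
have S1 : \sum_(p < X) normc (\sum_(m < W) e2pi (f (p + q * m)%N)) <=
   \sum_(p < X) ((if (p%:R < ka * X%:R) then 1 else 0) * W%:R + eta * W%:R).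
  apply: ler_sum => p _; case: ifPn => [_|].
    rewrite mul1r; apply: (@le_trans _ _ W%:R); last by rewrite lerDl mulr_ge0.
    apply: (le_trans (normc_le_sum _ _ _)).
    by under eq_bigr do rewrite normc_e2pi; rewrite sumr_const card_ord.
  by rewrite -leNgt mul0r add0r => kp; apply: H => //; rewrite ltnW.
(* The extra 1 accounts for p = 0, since [count_below] starts at 1. *)
have S2 : \sum_(p < X) (if (p%:R < ka * X%:R) then 1 else 0 : R) <= ka * X%:R + 1.
  rewrite -(big_mkord xpredT (fun p => if (p%:R < ka * X%:R) then 1 else 0 : R)).
  have [->|X0] := posnP X; first by rewrite big_geq // mulr0 add0r.
  rewrite big_ltn // addrC; apply: lerD; first exact: count_below.
  by case: ifP.
rewrite big_split /= -mulr_suml sumr_const card_ord -[eta * _ *+ X]mulr_natr in S1.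
apply: (le_trans (lerD (lexx _) S1)).
have h1 : 2 * q%:R * W%:R ^+ 2 <= 2 * q%:R * eps * X%:R * W%:R.
  by rewrite expr2 mulrA ler_wpM2r // -[leRHS]mulrA ler_wpM2l // mulr_ge0.
have h2 := ler_wpM2r (ltW Wr) S2.
by lra.
Qed.

End Windows.

(** * Eventual properties and eventual signs *)

Section Eventually.
Variable R : realType.
Implicit Types (P Q : R -> Prop) (f g df : R -> R).

(** An explicit threshold at +oo, as mean value arguments on tails and integer sequences need
    one. *)
Definition evt P := exists M : R, forall x, M <= x -> P x.

Lemma near_evt P : (\forall x \near +oo, P x) -> evt P.
Proof.
move=> [M [_ H]]; exists (M + 1) => x Mx; apply: H.
by rewrite (lt_le_trans _ Mx) // ltrDl.
Qed.

Lemma evt_and P Q : evt P -> evt Q -> evt (fun x => P x /\ Q x).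
Proof.
move=> [M HM] [N HN]; exists (Num.max M N) => x; rewrite ge_max => /andP[Mx Nx].
by split; [exact: HM|exact: HN].
Qed.

Lemma evt_mono P Q : (forall x, P x -> Q x) -> evt P -> evt Q.
Proof. by move=> PQ [M HM]; exists M => x /HM; exact: PQ. Qed.

Lemma evt_ge (c : R) : evt (fun x => c <= x).
Proof. by exists c. Qed.

Lemma evt_tail P : evt P -> evt (fun x => forall y, x <= y -> P y).
Proof. by move=> [M HM]; exists M => x Mx y xy; apply: HM; exact: le_trans xy. Qed.

Lemma evt_ex P : evt P -> exists x, P x.
Proof. by move=> [M HM]; exists M; exact: HM. Qed.

Lemma evt_scale (c : R) P : 0 < c -> evt P -> evt (fun x => P (c * x)).
Proof.
move=> c0 [M HM]; exists (M / c) => x; rewrite ler_pdivrMr // mulrC => Mx.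
exact: HM.
Qed.

Lemma evt_all (P : nat -> R -> Prop) (n : nat) :
  (forall i, (i < n)%N -> evt (P i)) -> evt (fun x => forall i, (i < n)%N -> P i x).
Proof.
elim: n => [|n IH] H; first by exists 0.
have /IH h1 : forall i, (i < n)%N -> evt (P i) by move=> i /ltnW; rewrite -ltnS; exact: H.
have := evt_and h1 (H n (ltnSn n)); apply: evt_mono => x [h2 h3] i.
by rewrite ltnS leq_eqVlt => /orP[/eqP ->|/h2].
Qed.

Definition trich f :=
  [\/ evt (fun x => 0 < f x), evt (fun x => f x < 0) | evt (fun x => f x = 0)].

Lemma trich_ext f g : evt (fun x => f x = g x) -> trich f -> trich g.
Proof.
move=> fg [] h; [apply: Or31|apply: Or32|apply: Or33];
  by have := evt_and fg h; apply: evt_mono => x [->].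
Qed.

Lemma trichN f : trich f -> trich (fun x => - f x).
Proof.
case=> h; [apply: Or32|apply: Or31|apply: Or33]; apply: evt_mono h => x.
- by rewrite oppr_lt0.
- by rewrite oppr_gt0.
- by move=> ->; rewrite oppr0.
Qed.

Lemma trichM f g : trich f -> trich g -> trich (fun x => f x * g x).
Proof.
case=> h; last by move=> _; apply: Or33; apply: evt_mono h => x ->; rewrite mul0r.
- case=> k; [apply: Or31|apply: Or32|apply: Or33]; have := evt_and h k; apply: evt_mono => x [].
  + exact: mulr_gt0.
  + by move=> a b; rewrite pmulr_rlt0.
  + by move=> _ ->; rewrite mulr0.
- case=> k; [apply: Or32|apply: Or31|apply: Or33]; have := evt_and h k; apply: evt_mono => x [].
  + by move=> a b; rewrite pmulr_llt0.
  + by move=> a b; rewrite nmulr_rgt0.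
  + by move=> _ ->; rewrite mulr0.
Qed.

Lemma trich_nge f : trich f -> evt (fun x => 0 <= f x) \/ evt (fun x => f x <= 0).
Proof.
case=> h; [left|right|left]; apply: evt_mono h => x; [exact: ltW|exact: ltW|by move=> ->].
Qed.

Lemma nondecr_trich f (M : R) : (forall x y, M <= x -> x <= y -> f x <= f y) -> trich f.
Proof.
move=> mon; have [[x [Mx fx]]|N] := pselect (exists x, M <= x /\ 0 < f x).
  apply: Or31; exists x => y xy; exact: lt_le_trans (mon x y Mx xy).
have npos x : M <= x -> f x <= 0.
  by move=> Mx; rewrite leNgt; apply/negP => fx; apply: N; exists x.
have [[x [Mx fx]]|N'] := pselect (exists x, M <= x /\ 0 = f x).
  apply: Or33; exists x => y xy; apply/eqP; rewrite eq_le npos ?(le_trans Mx) //=.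
  by rewrite fx mon.
apply: Or32; exists M => x Mx; rewrite lt_neqAle npos // andbT.
by apply/eqP => fx; apply: N'; exists x.
Qed.

Lemma nondecr_of_derive f df (M : R) :
  (forall x, M <= x -> is_derive x 1 f (df x)) -> (forall x, M <= x -> 0 <= df x) ->
  forall x y, M <= x -> x <= y -> f x <= f y.
Proof.
move=> D pos x y Mx xy.
have [z /andP[xz _]|c /andP[xc _] E] := @mean_value R f df x y xy.
  by apply: D; exact: le_trans xz.
by rewrite -subr_ge0 E mulr_ge0 ?subr_ge0 // pos // (le_trans Mx).
Qed.

Lemma nonincr_of_derive f df (M : R) :
  (forall x, M <= x -> is_derive x 1 f (df x)) -> (forall x, M <= x -> df x <= 0) ->
  forall x y, M <= x -> x <= y -> f y <= f x.
Proof.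
move=> D neg x y Mx xy.
have [z /andP[xz _]|c /andP[xc _] E] := @mean_value R f df x y xy.
  by apply: D; exact: le_trans xz.
by rewrite -subr_le0 E mulr_le0_ge0 ?subr_ge0 // neg // (le_trans Mx).
Qed.

(** A derivative of constant sign makes f eventually monotone, and a monotone function has an
    eventual sign relative to any c. *)
Lemma trich_of_derive f df (c : R) :
  evt (fun x => is_derive x 1 f (df x)) -> trich df -> trich (fun x => f x - c).
Proof.
move=> D /trich_nge[] h; have [M HM] := evt_and D h.
  apply: (nondecr_trich (M := M)) => x y Mx xy; rewrite lerD2r.
  by apply: (nondecr_of_derive (M := M) (df := df)) => // z /HM[].
apply: (trich_ext (f := fun x => - (c - f x))).
  by exists 0 => x _; rewrite opprB.
apply: trichN; apply: (nondecr_trich (M := M)) => x y Mx xy; rewrite lerD2l lerN2.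
by apply: (nonincr_of_derive (M := M) (df := df)) => // z /HM[].
Qed.

Lemma is_derive_pow (x : R) (m : nat) : 0 < x ->
  is_derive x 1 (fun y : R => y ^+ m) (m%:R * (x ^+ m / x)).
Proof.
move=> x0; have := @is_deriveX R R id m x 1 1 (is_derive_id _ _).
have -> : (m%:R * x ^+ m.-1) *: (1 : R) = m%:R * (x ^+ m / x).
  rewrite -[_ *: _]/(_ * _) mulr1; case: m => [|m]; first by rewrite !mul0r.
  by rewrite exprSr mulfK // gt_eqF.
by congr (is_derive x 1 _ _); apply: funext => y; rewrite fctE.
Qed.

Lemma is_derive_invpow (x : R) (m : nat) : 0 < x ->
  is_derive x 1 (fun y : R => (y ^+ m)^-1) (- m%:R * ((x ^+ m)^-1 / x)).
Proof.
move=> x0; have xm : x ^+ m != 0 by rewrite expf_neq0 // gt_eqF.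
have := @is_deriveV R (fun y => y ^+ m) x _ 1 xm (is_derive_pow m x0).
congr (is_derive x 1 _ _).
rewrite -[_ *: _]/(_ * _); field.
by rewrite xm gt_eqF.
Qed.

End Eventually.

(** * Signs and monotonicity in a Hardy field *)

Section HardyFields.
Variables (R : realType) (H : set (R -> R)) (hH : hardy_field H).
Implicit Types (f g : R -> R).

Lemma hardy_zero : H (fun=> 0).
Proof.
have := hardy_sub hH (hardy_one hH) (hardy_one hH).
by congr H; apply: funext => x; rewrite subrr.
Qed.

Lemma hardy_opp f : H f -> H (fun x => - f x).
Proof.
by move=> hf; have := hardy_sub hH hardy_zero hf; congr H; apply: funext => x; rewrite sub0r.
Qed.

Lemma hardy_add f g : H f -> H g -> H (fun x => f x + g x).
Proof.
move=> hf hg; have := hardy_sub hH hf (hardy_opp hg).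
by congr H; apply: funext => x; rewrite opprK.
Qed.

Lemma hardy_nat (n : nat) : H (fun=> n%:R).
Proof.
elim: n => [|n IH]; first exact: hardy_zero.
by have := hardy_add (hardy_one hH) IH; congr H; apply: funext => x; rewrite -nat1r.
Qed.

Lemma hardy_int (c : int) : H (fun=> c%:~R).
Proof.
case: c => n; first exact: hardy_nat.
rewrite NegzE; have := hardy_opp (hardy_nat n.+1).
by congr H; apply: funext => x; rewrite mulrNz.
Qed.

Lemma hardy_is_derive f : H f -> evt (fun x => is_derive x 1 f (f^`()%classic x)).
Proof.
move=> hf; have := near_evt (hardy_derivable hH hf); apply: evt_mono => x fx.
by rewrite derive1E; apply: DeriveDef.
Qed.

(** A nonzero germ is invertible, so it has no zeros far out, and by continuity it keeps one sign
    there. *)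
Lemma hardy_trich f : H f -> trich f.
Proof.
move=> hf; have [z|nz] := pselect (same_germ f (fun=> 0)).
  by apply: Or33; exact: near_evt z.
have [g _ fg] := hardy_inv hH hf nz.
have [M HM] := evt_and (near_evt fg) (near_evt (hardy_continuous hH hf)).
have f0 x : M <= x -> f x != 0.
  move=> /HM[E _]; apply/eqP => E0; move: E; rewrite E0 mul0r => /esym/eqP.
  by rewrite oner_eq0.
have ivt x : M <= x -> ~ (Num.min (f M) (f x) <= 0 <= Num.max (f M) (f x)).
  move=> Mx h; have [|c] := IVT Mx _ h.
    apply: continuous_in_subspaceT => y; rewrite inE /= in_itv /= => /andP[My _].
    by have [_] := HM y My.
  by rewrite in_itv /= => /andP[Mc _] fc; move: (f0 c Mc); rewrite fc eqxx.
have := f0 M (lexx _); rewrite neq_lt => /orP[fM|fM].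
  apply: Or32; exists M => x Mx; rewrite ltNge; apply/negP => fx; apply: (ivt x Mx).
  by rewrite ge_min (ltW fM) le_max fx orbT.
apply: Or31; exists M => x Mx; rewrite ltNge; apply/negP => fx; apply: (ivt x Mx).
by rewrite ge_min fx orbT le_max (ltW fM).
Qed.

(* The germ of x need not belong to H; but x + g has derivative 1 + g' in H, hence
   is eventually monotone, which is all that is needed. *)
Lemma hardy_trich_lin f (c : int) : H f ->
  trich (fun x => x * f^`()%classic x + c%:~R * f x).
Proof.
move=> hf; have hd := hardy_derive hH hf.
have [z|nz] := pselect (same_germ f^`()%classic (fun=> 0)).
  apply: (trich_ext (f := fun x => c%:~R * f x)).
    by apply: evt_mono (near_evt z) => x ->; rewrite mulr0 add0r.
  apply: hardy_trich; exact: (hardy_mul hH (hardy_int c) hf).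
have [g hg fg] := hardy_inv hH hd nz.
pose u := fun x => c%:~R * f x * g x.
have hu : H u by apply: (hardy_mul hH _ hg); exact: (hardy_mul hH (hardy_int c) hf).
have tu : trich (fun x => x + u x - 0).
  apply: (trich_of_derive (df := fun x => 1 + u^`()%classic x)).
    by apply: evt_mono (hardy_is_derive hu) => x D; exact: is_deriveD.
  apply: hardy_trich; apply: hardy_add; [exact: hardy_one|exact: hardy_derive].
have := trichM (hardy_trich hd) tu; apply: trich_ext.
apply: evt_mono (near_evt fg) => x E.
have -> : c%:~R * f x = c%:~R * f x * (f^`()%classic x * g x) by rewrite E mulr1.
by rewrite /u subr0; ring.
Qed.

(** The equation x p' = c p characterises multiples of x^c, and treats positive and negative powers
    at once. *)
Definition power_like (p : R -> R) (c : int) :=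
  forall x, 0 < x -> 0 < p x /\ is_derive x 1 p (c%:~R * (p x / x)).

Lemma power_like_pow (m : nat) : power_like (fun x => x ^+ m) m.
Proof. by move=> x x0; split; [rewrite exprn_gt0|exact: is_derive_pow]. Qed.

Lemma power_like_inv (m : nat) : power_like (fun x => (x ^+ m)^-1) (- m%:Z).
Proof.
move=> x x0; split; first by rewrite invr_gt0 exprn_gt0.
by rewrite mulrNz; exact: is_derive_invpow.
Qed.

(** The derivative of [f * p] has the sign of x f' + c f, which [hardy_trich_lin] decides even when
    the power p is not in H. *)
Lemma is_derive_twist f (p : R -> R) (c : int) : H f -> power_like p c ->
  evt (fun x => [/\ 0 < x, 0 < p x / x & is_derive x 1 (fun y => f y * p y)
    ((x * f^`()%classic x + c%:~R * f x) * (p x / x))]).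
Proof.
move=> hf hp; have := evt_and (hardy_is_derive hf) (evt_ge 1).
apply: evt_mono => x [D x1]; have x0 : 0 < x by rewrite (lt_le_trans _ x1).
have [p0 Dp] := hp x x0; split => //; first by rewrite divr_gt0.
have := is_deriveM D Dp; congr (is_derive x 1 _ _).
rewrite -![_ *: _]/(_ * _); field.
by rewrite gt_eqF.
Qed.

Lemma hardy_trich_twist f (p : R -> R) (c : int) (d : R) : H f -> power_like p c ->
  trich (fun x => f x * p x - d).
Proof.
move=> hf hp; have D := is_derive_twist hf hp.
apply: (trich_of_derive
  (df := fun x => (x * f^`()%classic x + c%:~R * f x) * (p x / x))).
  by apply: evt_mono D => x [].
apply: trichM; first exact: hardy_trich_lin.
by apply: Or31; apply: evt_mono D => x [].
Qed.

Lemma hardy_twist_mono f (p : R -> R) (c : int) : H f -> power_like p c ->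
  (exists2 M, 0 < M & forall x y, M <= x -> x <= y -> f x * p x <= f y * p y) \/
  (exists2 M, 0 < M & forall x y, M <= x -> x <= y -> f y * p y <= f x * p x).
Proof.
move=> hf hp; have D := is_derive_twist hf hp.
have [h|h] := trich_nge (hardy_trich_lin c hf); [left|right];
  have [M HM] := evt_and (evt_and D h) (evt_ge 1); exists (Num.max M 1);
  rewrite ?lt_max ?ltr01 ?orbT // => x y; rewrite ge_max => /andP[Mx x1] xy.
- apply: (nondecr_of_derive (M := M) (f := fun y => f y * p y)
    (df := fun x => (x * f^`()%classic x + c%:~R * f x) * (p x / x))) => // z /HM[[[z0 pz Dz] hz] _] //.
  by rewrite mulr_ge0 // ltW.
- apply: (nonincr_of_derive (M := M) (f := fun y => f y * p y)
    (df := fun x => (x * f^`()%classic x + c%:~R * f x) * (p x / x))) => // z /HM[[[z0 pz Dz] hz] _] //.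
  by rewrite mulr_le0_ge0 // ltW.
Qed.

End HardyFields.

(** * Growth rates of elements of a Hardy field *)

Section Growth.
Variable R : realType.
Implicit Types (f g : R -> R).

Definition small f (m : nat) := forall c, 0 < c -> evt (fun x => `|f x| <= c * x ^+ m).

Lemma evt_pow_gt (m : nat) (c C : R) : 0 < c -> evt (fun x => C < c * x ^+ m.+1).
Proof.
move=> c0; have := evt_and (evt_ge 1) (evt_ge (C / c + 1)); apply: evt_mono => x [x1 Cx].
have : C < c * x by rewrite mulrC -ltr_pdivrMr //; lra.
move=> h; apply: (lt_le_trans h); rewrite ler_wpM2l ?(ltW c0) // exprS ler_peMr //.
  by rewrite (le_trans _ x1).
by rewrite exprn_ege1.
Qed.

(** Subtracting c x^(m+1) / (m+1) leaves a nondecreasing function; the factor 1/2 absorbs its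
    initial value. *)
Lemma growth_of_derive f (df : R -> R) (m : nat) (c : R) : 0 < c ->
  evt (fun x => is_derive x 1 f (df x)) -> evt (fun x => c * x ^+ m <= df x) ->
  evt (fun x => c / m.+1%:R / 2 * x ^+ m.+1 <= f x).
Proof.
move=> c0 D h; have [M HM] := evt_and (evt_and D h) (evt_ge 1).
pose d := c / m.+1%:R; have d0 : 0 < d by rewrite divr_gt0.
have mono : forall x y, Num.max M 1 <= x -> x <= y ->
    f x - d * x ^+ m.+1 <= f y - d * y ^+ m.+1.
  apply: (nondecr_of_derive (f := fun x => f x - d * x ^+ m.+1)
    (df := fun x => df x - d * (m.+1%:R * (x ^+ m.+1 / x)))).
    move=> x; rewrite ge_max => /andP[Mx x1]; have [[Dx _] _] := HM x Mx.
    apply: is_deriveB; apply: is_deriveZ; apply: is_derive_pow.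
    exact: lt_le_trans x1.
  move=> x; rewrite ge_max => /andP[Mx x1]; have [[_ hx] _] := HM x Mx.
  rewrite subr_ge0; apply: le_trans hx; apply: le_of_eq.
  rewrite mulrA /d divfK ?pnatr_eq0 // exprSr mulfK // gt_eqF //.
  exact: lt_le_trans x1.
set M1 := Num.max M 1 in mono.
have d2 : 0 < d / 2 by rewrite divr_gt0.
have := evt_and (evt_ge M1) (evt_pow_gt m (`|f M1| + d * M1 ^+ m.+1) d2).
apply: evt_mono => x [Mx hx].
have := mono M1 x (lexx _) Mx; have := ler_norm (- f M1); rewrite normrN.
move: hx; rewrite -/d; lra.
Qed.

Lemma unbounded_of_derive f (df : R -> R) (c C : R) : 0 < c ->
  evt (fun x => is_derive x 1 f (df x)) -> evt (fun x => c <= df x) ->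
  evt (fun x => C <= f x).
Proof.
move=> c0 D h.
have h1 : evt (fun x => c * x ^+ 0 <= df x).
  by apply: evt_mono h => x; rewrite expr0 mulr1.
have c2 : 0 < c / 1%:R / 2 by rewrite !divr_gt0.
have := evt_and (growth_of_derive c0 D h1) (evt_pow_gt 0 C c2).
by apply: evt_mono => x [h2 h3]; exact: le_trans (ltW h3) h2.
Qed.

(** A doubling condition for eventually positive functions; ka is free because windows start at ka
    X. *)
Definition comparable_at_scale f := forall ka : R, 0 < ka -> ka <= 1 ->
  exists2 C, 1 <= C & evt (fun x => forall y, ka * x <= y <= 2 * x ->
    [/\ 0 < f y, f y <= C * f x & f x <= C * f y]).

Lemma small_not_ge f m c : 0 < c -> small f m -> ~ evt (fun x => c * x ^+ m <= f x).
Proof.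
move=> c0 sf h; have c2 : 0 < c / 2 by rewrite divr_gt0.
have [x [[h1 h2] x1]] := evt_ex (evt_and (evt_and h (sf _ c2)) (evt_ge 1)).
have : 0 < c * x ^+ m by rewrite mulr_gt0 // exprn_gt0 // (lt_le_trans _ x1).
have := ler_norm (f x); lra.
Qed.

Variables (H : set (R -> R)) (hH : hardy_field H).

(** False for general functions. Here f' / x^m is eventually on one side of c and of -c, and the
    wrong side would integrate to growth of order x^(m+1). *)
Lemma hardy_small_derive f m : H f -> small f m.+1 -> small f^`()%classic m.
Proof.
move=> hf sf c c0; have hd := hardy_derive hH hf.
have D := hardy_is_derive hH hf.
have T (d : R) := hardy_trich_twist hH d hd (@power_like_inv R m).
have up : evt (fun x => f^`()%classic x <= c * x ^+ m).
  have [h|h|h] := T c.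
  - exfalso; have h' : evt (fun x => c * x ^+ m <= f^`()%classic x).
      have := evt_and h (evt_ge 1); apply: evt_mono => x [hx x1].
      rewrite -ler_pdivlMr ?exprn_gt0 ?(lt_le_trans _ x1) //.
      by rewrite -subr_ge0 ltW.
    by apply: (small_not_ge _ sf (growth_of_derive c0 D h')); rewrite !divr_gt0.
  - have := evt_and h (evt_ge 1); apply: evt_mono => x [hx x1].
    rewrite -ler_pdivrMr ?exprn_gt0 ?(lt_le_trans _ x1) //.
    by rewrite -subr_le0 ltW.
  - have := evt_and h (evt_ge 1); apply: evt_mono => x [hx x1].
    rewrite -ler_pdivrMr ?exprn_gt0 ?(lt_le_trans _ x1) //.
    by rewrite -subr_le0 hx.
have dn : evt (fun x => - (c * x ^+ m) <= f^`()%classic x).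
  have [h|h|h] := T (- c).
  - have := evt_and h (evt_ge 1); apply: evt_mono => x [hx x1].
    rewrite -mulNr -ler_pdivlMr ?exprn_gt0 ?(lt_le_trans _ x1) //.
    by rewrite -subr_ge0 ltW.
  - exfalso; have h' : evt (fun x => c * x ^+ m <= - f^`()%classic x).
      have := evt_and h (evt_ge 1); apply: evt_mono => x [hx x1].
      rewrite lerNr -mulNr -ler_pdivrMr ?exprn_gt0 ?(lt_le_trans _ x1) //.
      by rewrite -subr_le0 ltW.
    have D' : evt (fun x => is_derive x 1 (fun y => - f y) (- f^`()%classic x)).
      by apply: evt_mono D => x Dx; exact: is_deriveN.
    have sN : small (fun y => - f y) m.+1.
      by move=> e e0; apply: evt_mono (sf e e0) => x; rewrite normrN.
    by apply: (small_not_ge _ sN (growth_of_derive c0 D' h')); rewrite !divr_gt0.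
  - have := evt_and h (evt_ge 1); apply: evt_mono => x [hx x1].
    rewrite -mulNr -ler_pdivlMr ?exprn_gt0 ?(lt_le_trans _ x1) //.
    by rewrite -subr_ge0 hx.
by have := evt_and up dn; apply: evt_mono => x [h1 h2]; rewrite ler_norml h2 h1.
Qed.

(** Each f - d has an eventual sign, so an f that is eventually neither above c nor below -c, for
    every c > 0, tends to 0. *)
Lemma hardy_away f : H f -> ~ small f 0 ->
  exists2 c, 0 < c & evt (fun x => c <= f x) \/ evt (fun x => f x <= - c).
Proof.
move=> hf ns; apply: contrapT => N; apply: ns => c c0.
have T (d : R) : trich (fun x => f x - d).
  have := hardy_trich_twist hH d hf (@power_like_pow R 0).
  by apply: trich_ext; exists 0 => x _; rewrite expr0 mulr1.
have up : evt (fun x => f x <= c).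
  have [h|h|h] := T c; last 2 first.
  - by apply: evt_mono h => x; rewrite subr_lt0 => /ltW.
  - by apply: evt_mono h => x /eqP; rewrite subr_eq0 => /eqP ->.
  exfalso; apply: N; exists c => //; left; apply: evt_mono h => x.
  by rewrite subr_gt0 => /ltW.
have dn : evt (fun x => - c <= f x).
  have [h|h|h] := T (- c).
  - by apply: evt_mono h => x; rewrite subr_gt0 => /ltW.
  - exfalso; apply: N; exists c => //; right; apply: evt_mono h => x.
    by rewrite subr_lt0 => /ltW.
  - by apply: evt_mono h => x /eqP; rewrite subr_eq0 => /eqP ->.
have := evt_and up dn; apply: evt_mono => x [h1 h2].
by rewrite expr0 mulr1 ler_norml h2 h1.
Qed.

(** Both f / x^m and f x^(n+1) are eventually monotone. The growth bounds force the first to be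
    nonincreasing and the second nondecreasing, which bounds f(v) / f(u) in terms of v / u from both
    sides. *)
Lemma hardy_comparable f (m n : nat) (c : R) : H f -> evt (fun x => 0 < f x) ->
  small f m -> 0 < c -> evt (fun x => c <= f x * x ^+ n) -> comparable_at_scale f.
Proof.
move=> hf fpos sf c0 lf.
have [M [M0 up dn]] : exists M, [/\ 0 < M,
    forall x y, M <= x -> x <= y -> f y / y ^+ m <= f x / x ^+ m &
    forall x y, M <= x -> x <= y -> f x * x ^+ n.+1 <= f y * y ^+ n.+1].
  have [M1 M10 H1] : exists2 M, 0 < M &
      forall x y, M <= x -> x <= y -> f y / y ^+ m <= f x / x ^+ m.
    have [[M M0 mono]|//] := hardy_twist_mono hH hf (@power_like_inv R m).
    exfalso; have [N HN] := evt_and (evt_and fpos (evt_ge M)) (evt_ge 1).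
    have [[fN MN] N1] := HN N (lexx _).
    have N0 : 0 < N by rewrite (lt_le_trans _ N1).
    apply: (@small_not_ge f m (f N / N ^+ m)) => //.
      by rewrite divr_gt0 // exprn_gt0.
    exists N => x Nx; have [[_ Mx] x1] := HN x Nx.
    rewrite -ler_pdivlMr; first exact: mono.
    by rewrite exprn_gt0 // (lt_le_trans _ x1).
  have [M2 M20 H2] : exists2 M, 0 < M &
      forall x y, M <= x -> x <= y -> f x * x ^+ n.+1 <= f y * y ^+ n.+1.
    have [//|[M M0 mono]] := hardy_twist_mono hH hf (@power_like_pow R n.+1).
    exfalso; have := evt_and (evt_and lf (evt_ge M)) (evt_pow_gt 0 (f M * M ^+ n.+1) c0).
    move=> /evt_ex[x [[h1 h2] h3]].
    have := mono M x (lexx _) h2; rewrite (exprSr x) mulrA; rewrite expr1 in h3.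
    have x0 : 0 < x by rewrite (lt_le_trans _ h2).
    have := ler_wpM2r (ltW x0) h1; move: h3; lra.
  exists (Num.max M1 M2); split; first by rewrite lt_max M10.
    by move=> x y; rewrite ge_max => /andP[h _]; exact: H1.
  by move=> x y; rewrite ge_max => /andP[_ h]; exact: H2.
(* An upper bound for the ratio of x to any point of [ka x, 2 x], in either direction. *)
move=> ka ka0 ka1; pose r := 2 / ka.
have r2 : 2 <= r by rewrite /r ler_pdivlMr //; lra.
have rk : ka^-1 <= r by rewrite /r ler_peMl ?ler1n // invr_ge0 ltW.
have r0 : 0 < r by lra.
clearbody r.
have key u v : M <= u -> 0 < f u -> 0 < f v -> u <= v -> v <= r * u ->
    f v <= r ^+ m * f u /\ f u <= r ^+ n.+1 * f v.
  move=> Mu fu fv uv vr; have u0 : 0 < u by exact: lt_le_trans Mu.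
  have v0 : 0 < v by exact: lt_le_trans uv.
  split.
    have := up u v Mu uv; rewrite ler_pdivrMr ?exprn_gt0 // => h; apply: (le_trans h).
    rewrite -mulrA mulrC ler_wpM2r ?(ltW fu) //.
    by rewrite mulrC ler_pdivrMr ?exprn_gt0 // -exprMn lerXn2r ?nnegrE ?mulr_ge0 // ltW.
  have := dn u v Mu uv; rewrite -ler_pdivlMr ?exprn_gt0 // => h; apply: (le_trans h).
  rewrite -mulrA mulrC ler_wpM2r ?(ltW fv) //.
  by rewrite ler_pdivrMr ?exprn_gt0 // -exprMn lerXn2r ?nnegrE ?mulr_ge0 // ltW.
have rm : 1 <= r ^+ m by rewrite exprn_ege1 //; lra.
have rn : 1 <= r ^+ n.+1 by rewrite exprn_ege1 //; lra.
exists (r ^+ m + r ^+ n.+1); first by lra.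
have [N HN] := fpos.
have := evt_scale ka0 (evt_and (evt_ge M) (evt_ge N)).
move=> h2; have := evt_and (evt_ge (0 : R)) h2; apply: evt_mono => x [x0 [kM kN]] y /andP[y1 y2].
have kx : ka * x <= x by rewrite ler_piMl.
have fx : 0 < f x by apply: HN; lra.
have fy : 0 < f y by apply: HN; lra.
have w1 : 0 <= r ^+ m * f x by rewrite mulr_ge0 ?ltW //; lra.
have w2 : 0 <= r ^+ m * f y by rewrite mulr_ge0 ?ltW //; lra.
have w3 : 0 <= r ^+ n.+1 * f x by rewrite mulr_ge0 ?ltW //; lra.
have w4 : 0 <= r ^+ n.+1 * f y by rewrite mulr_ge0 ?ltW //; lra.
rewrite !mulrDl; case: (leP x y) => xy.
  have [] := @key x y _ fx fy xy; [by lra| |by split => //; lra].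
  by apply: (le_trans y2); rewrite ler_wpM2r.
have [] := @key y x _ fy fx (ltW xy); [by lra| |by split => //; lra].
apply: (@le_trans _ _ (ka^-1 * y)); first by rewrite mulrC ler_pdivlMr // mulrC.
by rewrite ler_wpM2r //; lra.
Qed.

End Growth.

(** * The derivatives of alpha and the last order that does not vanish *)

Section Profile.
Variable R : realType.

(* [a i] is the i-th derivative of [a 0], and D is the last order at which it does
   not tend to 0. *)
Record growth_profile (a : nat -> R -> R) (D : nat) : Prop := {
  profile_chain : forall N, evt (fun x0 => deriv_chain N a x0) ;
  profile_trich : forall i, trich (a i) ;
  profile_unbounded : forall C, evt (fun x => C <= a 0%N x) ;
  profile_lower : forall i, (i <= D)%N -> exists2 c, 0 < c & evt (fun x => c <= a i x) ;
  profile_comparable : forall i, (i <= D)%N -> comparable_at_scale (a i) ;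
  profile_ratio : forall i, (i < D)%N ->
    exists2 c, 0 < c & evt (fun x => c * a i x <= x * a i.+1 x)
}.

(* Either the derivative of order D + 1 decays slowly enough to be used in a
   derivative test, or [a 0] is a polynomial of degree at most D plus a slowly varying
   function. *)
Definition vanishing_next (a : nat -> R -> R) (D : nat) (s : R) :=
  [/\ `|s| = 1, comparable_at_scale (fun x => s * a D.+1 x), small (a D.+1) 0 &
      forall C, evt (fun x => C * a D x <= s * a D.+1 x * x ^+ D.+1)].

Definition almost_polynomial (a : nat -> R -> R) (D : nat) (C : R) :=
  evt (fun x => a D x <= C) /\ evt (fun x => `|a D.+1 x| * x ^+ D.+1 <= C).

Variables (H : set (R -> R)) (hH : hardy_field H) (alpha : R -> R) (l : nat).
Hypotheses (halpha : H alpha) (hinf : forall C, evt (fun x => C <= alpha x))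
  (hl : small alpha l).

Let a i : R -> R := derive1n i alpha.

Lemma hardy_iter i : H (a i).
Proof. by elim: i => [//|i IH]; rewrite /a derive1nS; exact: hardy_derive. Qed.

Lemma iter_is_derive i : evt (fun x => is_derive x 1 (a i) (a i.+1 x)).
Proof. by rewrite [a i.+1]derive1nS; apply: (hardy_is_derive hH); exact: hardy_iter. Qed.

Lemma iter_chain N : evt (fun x0 => deriv_chain N a x0).
Proof.
have H1 i : (i < N)%N -> evt (fun x => forall y, x <= y -> is_derive y 1 (a i) (a i.+1 y)).
  by move=> _; apply: evt_tail; exact: iter_is_derive.
have := evt_all H1.
by apply: evt_mono => x h i y iN xy; exact: h.
Qed.

Lemma small_iter i : (i <= l)%N -> small (a i) (l - i).
Proof.
elim: i => [|i IH] il; first by rewrite subn0.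
rewrite /a derive1nS; apply: (hardy_small_derive hH); first exact: hardy_iter.
by rewrite -subSn //; apply: IH; exact: ltnW.
Qed.

(** Each differentiation lowers the growth exponent by one, so a_l tends to 0; take the least such
    order. It is positive because alpha is unbounded. *)
Lemma vanishing_order : exists k : nat,
  [/\ (0 < k)%N, (k <= l)%N, small (a k) 0 & forall i, (i < k)%N -> ~ small (a i) 0].
Proof.
have ex : exists n, `[< small (a n) 0 >].
  by exists l; apply/asboolP; have := small_iter (leqnn l); rewrite subnn.
case: (ex_minnP ex) => k /asboolP sk mink; exists k; split=> //.
- rewrite lt0n; apply/eqP => k0; move: sk; rewrite k0 => s0.
  have [x [h1 h2]] := evt_ex (evt_and (hinf 2) (s0 1 ltr01)).
  have := ler_norm (alpha x); move: h2; rewrite /a derive1n0 expr0; lra.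
- by apply: mink; apply/asboolP; have := small_iter (leqnn l); rewrite subnn.
- by move=> i ik si; have := mink i; rewrite leqNgt ik => /(_ (asboolT si)).
Qed.

Section FixedOrder.
Variable k : nat.
Hypotheses (kl : (k <= l)%N) (sk : small (a k) 0) (mink : forall i, (i < k)%N -> ~ small (a i) 0).

(** [hardy_away] leaves only the sign open; if a_(i+1) were below some -c, integration would drive
    a_i to -oo, against its own lower bound. *)
Lemma iter_lower i : (i < k)%N -> exists2 c, 0 < c & evt (fun x => c <= a i x).
Proof.
elim: i => [|i IH] ik; first by exists 1 => //; exact: hinf.
have [c c0 [h|h]] := hardy_away hH (hardy_iter i.+1) (mink ik); first by exists c.
have [d d0 hd] := IH (ltnW ik).
have D : evt (fun x => is_derive x 1 (fun y => - a i y) (- a i.+1 x)).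
  by apply: evt_mono (iter_is_derive i) => x Dx; exact: is_deriveN.
have h' : evt (fun x => c <= - a i.+1 x) by apply: evt_mono h => x; rewrite lerNr.
have [x [h1 h2]] := evt_ex (evt_and hd (unbounded_of_derive 1 c0 D h')).
lra.
Qed.

Lemma iter_linear i : (i.+1 < k)%N -> exists2 c, 0 < c & evt (fun x => c * x <= a i x).
Proof.
move=> ik; have [c c0 h] := iter_lower ik.
have h1 : evt (fun x => c * x ^+ 0 <= a i.+1 x).
  by apply: evt_mono h => x; rewrite expr0 mulr1.
exists (c / 1%:R / 2); first by rewrite !divr_gt0.
by apply: evt_mono (growth_of_derive c0 (iter_is_derive i) h1) => x; rewrite expr1.
Qed.

Lemma iter_comparable i : (i < k)%N -> comparable_at_scale (a i).
Proof.
move=> ik; have [c c0 h] := iter_lower ik.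
apply: (@hardy_comparable _ _ hH (a i) (l - i) 0 c) => //.
- exact: hardy_iter.
- by apply: evt_mono h => x; exact: lt_le_trans.
- by apply: small_iter; apply: leq_trans kl; exact: ltnW.
- by apply: evt_mono h => x; rewrite expr0 mulr1.
Qed.

(** If a_(i+1) is nondecreasing, the mean value theorem bounds a_i(x) - a_i(M) by a_(i+1)(x) (x -
    M), and the linear growth of a_i absorbs a_i(M). If it is nonincreasing, a_i grows at most
    linearly while a_(i+1) stays above c. *)
Lemma iter_ratio i : (i.+1 < k)%N ->
  exists2 c, 0 < c & evt (fun x => c * a i x <= x * a i.+1 x).
Proof.
move=> ik; have [c c0 h] := iter_lower ik; have [d d0 hd] := iter_linear ik.
have [M0 D] := iter_is_derive i.
have [[M1 M10 mono]|[M1 M10 mono]] := hardy_twist_mono hH (hardy_iter i.+1) (@power_like_pow R 0).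
  pose M := Num.max M0 M1.
  have MM0 : M0 <= M by rewrite le_max lexx.
  have MM1 : M1 <= M by rewrite le_max lexx orbT.
  exists (1 / 2); first by rewrite divr_gt0.
  have := evt_and (evt_and (evt_ge M) h) (evt_and hd (evt_ge (2 * `|a i M| / d))).
  apply: evt_mono => x [[Mx hx] [dx xd]].
  have [y /andP[My _]|y /andP[My yx] E] := @mean_value R (a i) (a i.+1) M x Mx.
    by apply: D; exact: le_trans My.
  have := mono y x (le_trans MM1 My) yx; rewrite !expr0 !mulr1 => h1.
  have h2 : a i.+1 y * (x - M) <= a i.+1 x * (x - M) by rewrite ler_wpM2r // subr_ge0.
  have h3 : 0 <= a i.+1 x * M.
    by apply: mulr_ge0; [lra|rewrite (le_trans _ MM1) // ltW].
  have h4 : 2 * `|a i M| <= d * x by rewrite [leRHS]mulrC -ler_pdivrMr.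
  have h5 := ler_norm (a i M).
  move: E h2 h3 h4 h5 dx; lra.
pose M := Num.max 1 (Num.max M0 M1).
have M_1 : 1 <= M by rewrite le_max lexx.
have MM0 : M0 <= M by rewrite !le_max lexx orbT.
have MM1 : M1 <= M by rewrite !le_max lexx !orbT.
pose B := `|a i M| + `|a i.+1 M| + 1.
have B0 : 0 < B by rewrite /B ltr_wpDl ?addr_ge0.
exists (c / B); first by rewrite divr_gt0.
have := evt_and (evt_ge M) h; apply: evt_mono => x [Mx hx].
have [y /andP[My _]|y /andP[My yx] E] := @mean_value R (a i) (a i.+1) M x Mx.
  by apply: D; exact: le_trans My.
have := mono M y MM1 My; rewrite !expr0 !mulr1 => h1.
have x1 : 1 <= x by exact: le_trans Mx.
have h2 : a i.+1 y * (x - M) <= `|a i.+1 M| * (x - M).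
  by rewrite ler_wpM2r ?subr_ge0 // (le_trans h1) // ler_norm.
have h3 : 0 <= `|a i.+1 M| * M by rewrite mulr_ge0 // (le_trans _ M_1).
have h4 : `|a i M| <= `|a i M| * x by rewrite ler_peMr.
have h6 : a i x <= B * x.
  have h5 := ler_norm (a i M); move: E h2 h3 h4 h5 x1; rewrite /B; lra.
apply: (@le_trans _ _ (c / B * (B * x))).
  by rewrite ler_wpM2l // divr_ge0 // ltW.
have -> : c / B * (B * x) = x * c by field; rewrite gt_eqF.
by rewrite ler_wpM2l // (le_trans _ x1).
Qed.

End FixedOrder.

Lemma profile_of_order D : (D.+1 <= l)%N -> small (a D.+1) 0 ->
  (forall i, (i < D.+1)%N -> ~ small (a i) 0) -> growth_profile a D.
Proof.
move=> kl sk mink; split.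
- exact: iter_chain.
- by move=> i; apply: (hardy_trich hH); exact: hardy_iter.
- exact: hinf.
- by move=> i iD; apply: (iter_lower mink); rewrite ltnS.
- by move=> i iD; apply: (iter_comparable kl mink); rewrite ltnS.
- by move=> i iD; apply: (iter_ratio mink); rewrite ltnS.
Qed.

(** Let f be the logarithmic derivative a_(D+1) / a_D, formed inside H. Since f x^(D+1) minus any
    constant has an eventual sign, its absolute value tends to infinity or stays bounded. In the
    second case f is O(x^-2), as D >= 1, and a_D is bounded. *)
Lemma vanishing_dichotomy D : (0 < D)%N -> (D.+1 <= l)%N -> small (a D.+1) 0 ->
  (forall i, (i < D.+1)%N -> ~ small (a i) 0) ->
  (exists s, vanishing_next a D s) \/ (exists C, almost_polynomial a D C).
Proof.
move=> D0 kl sk mink; have [c c0 hc] := iter_lower mink (ltnSn D).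
have nz : ~ same_germ (a D) (fun=> 0).
  move=> /near_evt z; have [x [h1 h2]] := evt_ex (evt_and hc z).
  by move: c0; rewrite ltNge -h2 h1.
have [g hg /near_evt ag] := hardy_inv hH (hardy_iter D) nz.
pose f := fun x => a D.+1 x * g x.
have hf : H f by apply: (hardy_mul hH) => //; exact: hardy_iter.
have fE : evt (fun x => `|a D.+1 x| = `|f x| * a D x).
  have := evt_and ag hc; apply: evt_mono => x [E cx].
  have aD0 : 0 <= a D x by rewrite (le_trans (ltW c0)).
  rewrite /f -[X in _ = _ * X](ger0_norm aD0) -normrM; congr `|_|.
  by rewrite -mulrA (mulrC (g x)) E mulr1.
have T d : trich (fun x => f x * x ^+ D.+1 - d).
  exact: (hardy_trich_twist hH d hf (@power_like_pow R D.+1)).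
have [G|nG] := pselect (forall C, evt (fun x => C <= `|f x| * x ^+ D.+1)).
  left; have [s [s1 hs sH]] : exists s, [/\ `|s| = 1, evt (fun x => 0 < s * a D.+1 x) &
      H (fun x => s * a D.+1 x)].
    have hk := hardy_iter D.+1.
    have [h|h|h] := hardy_trich hH hk.
    - exists 1; rewrite normr1; split => //; first by apply: evt_mono h => x; rewrite mul1r.
      by move: hk; congr H; apply: funext => x; rewrite mul1r.
    - exists (-1); rewrite normrN1; split => //.
        by apply: evt_mono h => x; rewrite mulN1r oppr_gt0.
      by have := hardy_opp hH hk; congr H; apply: funext => x; rewrite mulN1r.
    - exfalso; have [x [[h1 h2] [h3 h4]]] := evt_ex (evt_and (evt_and h fE) (evt_and hc (G 1))).
      move: h2; rewrite h1 normr0 => /esym/eqP; rewrite mulf_eq0 => /orP[]/eqP E.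
        by move: h4; rewrite E mul0r ler10.
      by move: h3; rewrite E leNgt c0.
  have aE : evt (fun x => s * a D.+1 x = `|f x| * a D x).
    have := evt_and hs fE; apply: evt_mono => x [h1 <-].
    by rewrite -[LHS]gtr0_norm // normrM s1 mul1r.
  exists s; split=> //; last first.
    move=> C; have := evt_and (evt_and aE (G C)) hc; apply: evt_mono => x [[-> h1] h2].
    by rewrite mulrAC ler_wpM2r // (le_trans (ltW c0)).
  apply: (@hardy_comparable _ _ hH _ 0 D.+1 c) => //.
    by move=> e e0; apply: evt_mono (sk e e0) => x; rewrite normrM s1 mul1r.
  have := evt_and (evt_and aE (G 1)) hc; apply: evt_mono => x [[-> h1] h2].
  have aD0 : 0 <= a D x by rewrite (le_trans (ltW c0)).
  by rewrite mulrAC (le_trans h2) // ler_peMl.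
right; move/existsNP: nG => [C nC].
have bound : evt (fun x => `|f x| * x ^+ D.+1 <= `|C|).
  have up : evt (fun x => f x * x ^+ D.+1 <= `|C|).
    have absurd : ~ evt (fun x => `|C| <= f x * x ^+ D.+1).
      move=> h; apply: nC; have := evt_and h (evt_ge 1); apply: evt_mono => x [h1 x1].
      apply: (le_trans (ler_norm C)); apply: (le_trans h1).
      by rewrite ler_wpM2r ?ler_norm // exprn_ge0 // (le_trans _ x1).
    have [h|h|h] := T `|C|.
    - by exfalso; apply: absurd; apply: evt_mono h => x; rewrite subr_gt0 => /ltW.
    - by apply: evt_mono h => x; rewrite subr_lt0 => /ltW.
    - by apply: evt_mono h => x /eqP; rewrite subr_eq0 => /eqP ->.
  have dn : evt (fun x => - `|C| <= f x * x ^+ D.+1).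
    have absurd : ~ evt (fun x => f x * x ^+ D.+1 <= - `|C|).
      move=> h; apply: nC; have := evt_and h (evt_ge 1); apply: evt_mono => x [h1 x1].
      apply: (le_trans (ler_norm C)); rewrite lerNr in h1; apply: (le_trans h1).
      rewrite -mulNr ler_wpM2r ?exprn_ge0 ?(le_trans _ x1) //.
      by rewrite -normrN ler_norm.
    have [h|h|h] := T (- `|C|).
    - by apply: evt_mono h => x; rewrite subr_gt0 => /ltW.
    - by exfalso; apply: absurd; apply: evt_mono h => x; rewrite subr_lt0 => /ltW.
    - by apply: evt_mono h => x /eqP; rewrite subr_eq0 => /eqP ->.
  have := evt_and (evt_and up dn) (evt_ge 1); apply: evt_mono => x [[h1 h2] x1].
  rewrite -[x ^+ _]ger0_norm ?exprn_ge0 ?(le_trans _ x1) // -normrM.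
  by rewrite ler_norml h2 h1.
pose C1 := `|C| + 1; have C10 : 0 < C1 by rewrite ltr_wpDl.
have bk : evt (fun x => `|a D.+1 x| * x ^+ D.+1 <= C1 * a D x).
  have := evt_and (evt_and bound fE) hc; apply: evt_mono => x [[h1 ->] h2].
  rewrite mulrAC ler_wpM2r //; first by rewrite (le_trans (ltW c0)).
  by rewrite (le_trans h1) // lerDl.
(* a_D' <= C1 a_D / x^2 makes a_D (1 + 2 C1 / x) nonincreasing, so a_D is bounded. *)
have [M HM] := evt_and (evt_and (iter_is_derive D) bk) (evt_and hc (evt_ge (Num.max 1 (2 * C1)))).
pose h y := a D y * (1 + 2 * C1 * (y ^+ 1)^-1).
have mono : forall x y, M <= x -> x <= y -> h y <= h x.
  apply: (nonincr_of_derive (f := h) (df := fun x =>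
      a D.+1 x * (1 + 2 * C1 * (x ^+ 1)^-1) - 2 * C1 * a D x * (x ^+ 2)^-1)).
    move=> x /HM[[Dx _] [_]]; rewrite ge_max => /andP[x1 _].
    have x0 : 0 < x by rewrite (lt_le_trans _ x1).
    have D2 : is_derive x 1 (fun y => 1 + 2 * C1 * (y ^+ 1)^-1)
        (0 + 2 * C1 * (- 1%:R * ((x ^+ 1)^-1 / x))).
      by apply: is_deriveD; apply: is_deriveZ; exact: is_derive_invpow.
    have := is_deriveM Dx D2; congr (is_derive x 1 _ _).
    rewrite -![_ *: _]/(_ * _) expr1; field.
    by rewrite gt_eqF.
  move=> x /HM[[_ hx] [cx]]; rewrite ge_max => /andP[x1 xC].
  have x0 : 0 < x by rewrite (lt_le_trans _ x1).
  have aD0 : 0 <= a D x by rewrite (le_trans (ltW c0)).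
  have x2 : 0 < x ^+ 2 by rewrite exprn_gt0.
  rewrite subr_le0 ler_pdivlMr //.
  have u1 : 0 <= 1 + 2 * C1 * (x ^+ 1)^-1 <= 2.
    have : 2 * C1 * (x ^+ 1)^-1 <= 1 by rewrite expr1 ler_pdivrMr // mul1r.
    have : 0 <= 2 * C1 * (x ^+ 1)^-1 by rewrite expr1 !mulr_ge0 ?invr_ge0 // ltW.
    by move=> p q; apply/andP; split; lra.
  have /andP[u10 u12] := u1.
  have h1 : `|a D.+1 x| * x ^+ 2 <= C1 * a D x.
    apply: le_trans hx; rewrite ler_wpM2l // ler_weXn2l //.
  have h2 : a D.+1 x * (1 + 2 * C1 * (x ^+ 1)^-1) <= `|a D.+1 x| * 2.
    apply: (@le_trans _ _ (`|a D.+1 x| * (1 + 2 * C1 * (x ^+ 1)^-1))).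
      by rewrite ler_wpM2r // ler_norm.
    by rewrite ler_wpM2l.
  apply: (le_trans (ler_wpM2r (ltW x2) h2)).
  rewrite mulrAC; move: h1; lra.
have bD : evt (fun x => a D x <= `|h M|).
  have := evt_ge M; exists M => x Mx.
  apply: (le_trans _ (ler_norm _)); apply: (le_trans _ (mono M x (lexx _) Mx)).
  have [[_ _] [cx]] := HM x Mx; rewrite ge_max => /andP[x1 _].
  have x0 : 0 < x by rewrite (lt_le_trans _ x1).
  rewrite /h ler_peMr //; first by rewrite (le_trans (ltW c0)).
  by rewrite lerDl !mulr_ge0 ?invr_ge0 ?exprn_ge0 // ltW.
exists (`|h M| + C1 * `|h M|); split.
  by apply: evt_mono bD => x h1; rewrite (le_trans h1) // lerDl mulr_ge0 // ltW.
have := evt_and bk bD; apply: evt_mono => x [h1 h2]; apply: (le_trans h1).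
apply: (@le_trans _ _ (C1 * `|h M|)); first by rewrite ler_wpM2l // ltW.
by rewrite lerDr.
Qed.

End Profile.

(** * Derivative tests with thresholds independent of the frequency *)

Section UniformBound.
Variable R : realType.
Implicit Types (a c : nat -> R -> R) (b bn g : R -> R).

Definition windows_small (ka eps eta : R) (q X : nat) g :=
  forall p : nat, ka * X%:R <= p%:R -> (p <= X)%N ->
    normc (\sum_(m < Num.truncn (eps * X%:R)) e2pi (g (p%:R + q%:R * m%:R))) <=
      eta * (Num.truncn (eps * X%:R))%:R.

(** [window_kth] with the derivative of order k+1 written, up to sign, as a fixed function b times
    an amplitude e depending on the frequency; a single kap then serves all frequencies. *)
Definition order_test (ka eps eta : R) (q k : nat) b bn (kap : R) (X0 : nat) :=
  0 < kap -> forall (X : nat) c (x0 e e' s : R), (X0 <= X)%N ->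
    deriv_chain k.+2 c x0 -> x0 <= ka * X%:R -> 0 < e -> `|s| = 1 ->
    (forall y, ka * X%:R <= y <= 2 * X%:R -> s * c k.+1 y = e * b y) ->
    (forall y, ka * X%:R <= y <= 2 * X%:R -> c k.+2 y = e' * bn y) ->
    e * b X%:R <= kap -> 1 <= kap * (e * b X%:R * X%:R ^+ k.+1) ->
    windows_small ka eps eta q X (c 0%N).

Lemma order_testW ka eps eta q k b bn kap kap' X0 X0' :
  kap' <= kap -> (X0 <= X0')%N ->
  order_test ka eps eta q k b bn kap X0 -> order_test ka eps eta q k b bn kap' X0'.
Proof.
move=> kk XX T k0 X c x0 e e' s XX' ch x0X e0 s1 h1 h2 h3 h4.
apply: (T (lt_le_trans k0 kk) X c x0 e e' s) => //.
- exact: leq_trans XX'.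
- exact: le_trans kk.
- apply: (le_trans h4); rewrite ler_wpM2r //.
  by rewrite -(pmulr_rge0 _ k0) (le_trans ler01).
Qed.

Lemma order_test_exists (ka eps eta : R) (q k : nat) b bn :
  0 < ka -> ka <= 1 -> 0 < eta -> 0 < eps -> (0 < q)%N ->
  eps * q%:R * k.+2%:R <= 1 / 2 ->
  comparable_at_scale b -> trich bn ->
  exists2 kap, 0 < kap & exists X0, order_test ka eps eta q k b bn kap X0.
Proof.
move=> ka0 ka1 eta0 eps0 q0 epsk cb tb.
have [C C1 [N HN]] := cb ka ka0 ka1.
have C0 : 0 < C by rewrite (lt_le_trans _ C1).
have CC : 1 <= C * C by rewrite (le_trans C1) // ler_peMr // ltW.
(* On [ka X, 2 X] the product e b lies between e b(X) / C and C e b(X), hence the ratio [C * C]. *)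
have [K K1 HK] := window_kth ka CC eta0 eps0 q0 epsk.
have K0 : 0 < K by rewrite (lt_le_trans _ K1).
have [N' HN'] : evt (fun x => (forall y, ka * x <= y -> 0 <= bn y) \/
                              (forall y, ka * x <= y -> bn y <= 0)).
  have [h|h] := trich_nge tb; have := evt_scale ka0 (evt_tail h); apply: evt_mono => x hx.
    by left.
  by right.
exists ((C * K)^-1); first by rewrite invr_gt0 mulr_gt0.
exists (Num.truncn (Num.max K (Num.max N N'))).+1 => _ X c x0 e e' s XX ch x0X e0 s1 hb hbn h3 h4.
have : Num.max K (Num.max N N') <= X%:R.
  by apply: (le_trans (ltW (truncnS_gt _))); rewrite ler_nat.
rewrite !ge_max => /and3P[KX NX NX'].
have X0 : 0 <= X%:R :> R by [].
have kX : ka * X%:R <= X%:R <= 2 * (X%:R : R).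
  by rewrite ler_piMl //=; lra.
have [bX _ _] := HN _ NX _ kX.
have lam0 : 0 < e * b X%:R / C by rewrite divr_gt0 // mulr_gt0.
apply: (HK X c x0 (e * b X%:R / C) s) => //.
- move: h3; rewrite invfM => h3.
  have : e * b X%:R * (C * K) <= 1 by rewrite -ler_pdivlMr ?mulr_gt0 // div1r invfM.
  have -> : e * b X%:R / C * K = e * b X%:R * (C * K) / (C * C).
    by field; rewrite gt_eqF.
  by move=> h; rewrite ler_pdivrMr ?mulr_gt0 // mul1r (le_trans h).
- move: h4; rewrite mulrC ler_pdivlMr ?mulr_gt0 // mul1r => h4.
  by rewrite mulrAC ler_pdivlMr // mulrC.
- move=> y yX; have [by0 h5 h6] := HN _ NX _ yX.
  rewrite hb //; apply/andP; split.
    rewrite ler_pdivrMr // -mulrA ler_wpM2l ?(ltW e0) //.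
    by rewrite mulrC.
  have -> : C * C * (e * b X%:R / C) = e * (C * b X%:R) by field; rewrite gt_eqF.
  by rewrite ler_wpM2l // ltW.
- have [hp|hn] := HN' _ NX'; have [e'0|/ltW e'0] := leP 0 e';
    [left|right|right|left] => y yX; rewrite hbn //; have /andP[y1 _] := yX.
  + by rewrite mulr_ge0 // hp.
  + by rewrite mulr_le0_ge0 // hp.
  + by rewrite mulr_ge0_le0 // hn.
  + by rewrite mulr_le0 // hn.
Qed.

Lemma profile_tests a D (ka eps eta : R) (q : nat) : growth_profile a D ->
  0 < ka -> ka <= 1 -> 0 < eta -> 0 < eps -> (0 < q)%N ->
  eps * q%:R * D.+2%:R <= 1 / 2 ->
  exists2 kap, 0 < kap & exists X0, forall k, (k < D)%N ->
    order_test ka eps eta q k (a k.+1) (a k.+2) kap X0.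
Proof.
move=> pr ka0 ka1 eta0 eps0 q0 epsD.
pose P d kap X0 := (d <= D)%N -> order_test ka eps eta q d.-1 (a d) (a d.+1) kap X0.
have [|d d0|kap kap0 [X0 T]] := @finite_thresholds R P D.+1.
- by move=> d k k' W W' kk WW T dD; exact: order_testW (T dD).
- have [dD|dD] := leqP d D; last first.
    by exists 1 => //; exists 0%N => dD'; move: dD; rewrite ltnNge dD'.
  case: d d0 dD => [//|d] _ dD.
  have epsd : eps * q%:R * d.+2%:R <= 1 / 2.
    apply: le_trans epsD; rewrite ler_wpM2l ?mulr_ge0 ?(ltW eps0) //.
    by rewrite ler_nat !ltnS ltnW.
  have [kap kap0 [X0 T]] := order_test_exists ka0 ka1 eta0 eps0 q0 epsd
    (profile_comparable pr dD) (profile_trich pr d.+2).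
  by exists kap => //; exists X0.
by exists kap => //; exists X0 => k kD; exact: (T k.+1).
Qed.

Lemma profile_ratios a D : growth_profile a D ->
  exists2 c, 0 < c & evt (fun x => forall i, (i < D)%N -> c * a i x <= x * a i.+1 x).
Proof.
move=> pr.
suff [c c0 h] : exists2 c, 0 < c & forall i, (i < D)%N -> evt (fun x => c * a i x <= x * a i.+1 x).
  by exists c => //; exact: evt_all.
have rt i (iD : (i < D)%N) := profile_ratio pr iD.
have lw i (iD : (i < D)%N) := profile_lower pr (ltnW iD).
clear pr; elim: D rt lw => [|D IH] rt lw; first by exists 1.
have [||c c0 hc] := IH.
- by move=> i iD; apply: rt; rewrite ltnS ltnW.
- by move=> i iD; apply: lw; rewrite ltnS ltnW.
have [d d0 hd] := rt D (ltnSn D).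
exists (Num.min c d); first by rewrite lt_min c0.
move=> i iD; have [e e0 he] := lw i iD.
have [f hf fm] : exists2 f, evt (fun x => f * a i x <= x * a i.+1 x) & Num.min c d <= f.
  move: iD; rewrite ltnS leq_eqVlt => /orP[/eqP ->|iD].
    by exists d => //; rewrite ge_min lexx orbT.
  by exists c; [exact: hc|rewrite ge_min lexx].
have := evt_and he hf; apply: evt_mono => x [h1 h2]; apply: le_trans h2.
by rewrite ler_wpM2r // (le_trans (ltW e0)).
Qed.

(** With P i saying that the derivative of order i is small, the k found is one where order k+1 is
    small enough for the test and order k still large enough to make it effective. *)
Lemma first_drop (P : pred nat) (t D : nat) : (t < D)%N -> ~~ P t -> P D ->
  exists2 k, (t <= k < D)%N & P k.+1 && ~~ P k.
Proof.
move=> tD nt; elim: D tD => [//|D IH]; rewrite ltnS leq_eqVlt => /orP[/eqP <-|tD] PD.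
  by exists t; rewrite ?leqnn ?PD.
have [pD|npD] := boolP (P D).
  have [k /andP[tk kD] h] := IH tD pD; exists k => //.
  by rewrite tk ltnS ltnW.
by exists D; rewrite ?PD ?ltnSn ?(ltnW tD).
Qed.

(** Passes a lower bound at order k to order k+1 through x a_(k+1) >= c a_k; this is the second
    condition of [order_test]. *)
Lemma ratio_power a (c kap mu e : R) (X : R) (k : nat) :
  0 < c -> 0 < kap -> 0 < mu -> 0 <= e -> 1 <= X ->
  c * a k X <= X * a k.+1 X ->
  mu <= e * a k X * X ^+ k -> (kap * c * mu)^-1 <= 1 ->
  1 <= kap * (e * a k.+1 X * X ^+ k.+1).
Proof.
move=> c0 k0 m0 e0 X1 h1 h2 h3.
have kcm : 0 < kap * c * mu by rewrite !mulr_gt0.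
have h4 : 1 <= kap * c * mu by move: h3; rewrite -[X in X <= 1]div1r ler_pdivrMr // mul1r.
apply: (le_trans h4); rewrite -mulrA ler_wpM2l ?(ltW k0) //.
apply: (@le_trans _ _ (c * (e * a k X * X ^+ k))); first by rewrite ler_wpM2l // ltW.
have Xk : 0 <= X ^+ k by rewrite exprn_ge0 // (le_trans _ X1).
have -> : c * (e * a k X * X ^+ k) = e * X ^+ k * (c * a k X) by ring.
have -> : e * a k.+1 X * X ^+ k.+1 = e * X ^+ k * (X * a k.+1 X) by rewrite exprS; ring.
by rewrite ler_wpM2l // mulr_ge0.
Qed.

Lemma windows_sum (ka eps eta : R) (X : nat) (q : nat) g :
  0 < ka -> 0 <= eta -> 0 < eps -> 1 <= eps * X%:R ->
  windows_small ka eps eta q X g ->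
  normc (\sum_(n < X) e2pi (g n%:R)) <= (2 * q%:R * eps + ka + eta) * X%:R + 1.
Proof.
move=> ka0 eta0 eps0 eX Hw.
have [W1 W2] : (0 < Num.truncn (eps * X%:R))%N /\ (Num.truncn (eps * X%:R))%:R <= eps * X%:R.
  have /truncn_itv/andP[h1 h2] : 0 <= eps * X%:R by rewrite (le_trans _ eX).
  split => //; rewrite lt0n; apply/eqP => h0; move: h2; rewrite h0.
  by rewrite ltNge eX.
apply: (@sum_of_windows R (fun n => g n%:R) X _ q ka eta eps ka0 eta0 W1 W2) => p h1 h2.
have := Hw p h1 h2; congr (normc _ <= _).
by apply: eq_bigr => m _; rewrite natrD natrM.
Qed.

End UniformBound.

(** * Polynomials with rational leading coefficients along progressions *)

Section RationalPart.
Variable R : realType.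

Definition rational (x : R) := exists r : rat, x = ratr r.

Lemma rational_denominator (f : nat -> R) (t n : nat) :
  (forall i, (t < i)%N -> rational (f i)) ->
  exists2 q, (0 < q)%N & forall i, (t < i < n)%N -> exists z : int, f i * q%:R = z%:~R.
Proof.
move=> rf; elim: n => [|n [q q0 IH]]; first by exists 1%N => // i; rewrite ltn0 andbF.
have [tn|nt] := ltnP t n; last first.
  exists q => // i /andP[ti]; rewrite ltnS => /(leq_trans ti); rewrite ltnNge nt //.
have [r fr] := rf n tn.
have dr0 : denq r != 0 by rewrite denq_eq0.
exists (q * `|denq r|)%N; first by rewrite muln_gt0 q0 absz_gt0.
have dE : `|denq r|%N%:R = (denq r)%:~R :> R.
  by rewrite -[X in _ = X%:~R]gez0_abs ?denq_ge0 // -pmulrn.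
move=> i /andP[ti]; rewrite ltnS leq_eqVlt => /orP[/eqP ->|iN]; last first.
  have [z hz] := IH i (introT andP (conj ti iN)).
  by exists (z * denq r); rewrite natrM mulrA hz dE intrM.
exists (numq r * q%:Z); rewrite fr natrM dE /ratr intrM -pmulrn.
by rewrite (mulrC q%:R) mulrA divfK // intr_eq0.
Qed.

Lemma pow_progression (p q m i : nat) : exists s, ((p + q * m) ^ i = p ^ i + q * s)%N.
Proof.
elim: i => [|i [s IH]]; first by exists 0%N; rewrite muln0 addn0 !expn0.
by exists (s * (p + q * m) + p ^ i * m)%N; rewrite !expnSr IH; lia.
Qed.

(** Choose q clearing the denominators of the coefficients of th P above degree t; then (p + q m)^i
    = p^i modulo q leaves the value unchanged modulo 1. *)
Lemma progression_invariant (P : {poly R}) (th : R) (t : nat) :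
  (forall i, (t < i)%N -> rational (th * P`_i)) ->
  exists2 q, (0 < q)%N & forall p m : nat,
    e2pi (th * (P - take_poly t.+1 P).[(p + q * m)%:R]) =
    e2pi (th * (P - take_poly t.+1 P).[p%:R]).
Proof.
move=> rP; have [q q0 Hq] := @rational_denominator (fun i => th * P`_i) t (size P) rP.
exists q => // p m; set Q := P - _.
have sQ : (size Q <= maxn (size P) t.+1)%N.
  apply: (leq_trans (size_polyD _ _)); rewrite size_polyN geq_max leq_maxl /=.
  by apply: (leq_trans (size_take_poly _ _)); rewrite leq_maxr.
have Qi i : Q`_i = if (t < i)%N then P`_i else 0.
  by rewrite coefB coef_take_poly ltnS leqNgt; case: (t < i)%N; rewrite /= ?subr0 ?subrr.
suff [z hz] : exists z : int, th * Q.[(p + q * m)%:R] - th * Q.[p%:R] = z%:~R.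
  by rewrite -(subrK (th * Q.[p%:R]) (th * Q.[(p + q * m)%:R])) hz e2piD e2pi_int mul1r.
rewrite -mulrBr !(horner_coef_wide _ sQ) -sumrB mulr_sumr.
apply: (big_ind (fun x => exists z : int, x = z%:~R)).
- by exists 0.
- by move=> x y [z ->] [w ->]; exists (z + w); rewrite intrD.
move=> i _; rewrite Qi -mulrBr; case: ifP => ti; last by exists 0; rewrite mul0r mulr0.
have [iP|iP] := ltnP i (size P); last by exists 0; rewrite (nth_default 0 iP) mul0r mulr0.
have [z hz] := Hq i (introT andP (conj ti iP)).
have [s hs] := pow_progression p q m i.
exists (z * s%:Z).
rewrite -!natrX hs natrD addrAC subrr add0r natrM !mulrA hz intrM -pmulrn //.
Qed.

Lemma derivn_top (p : {poly R}) (t : nat) : (size p <= t.+1)%N ->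
  p^`(t) = (p`_t *+ t`!)%:P.
Proof.
move=> sp; apply/polyP => i; rewrite coef_derivn coefC; case: i => [|i] /=.
  by rewrite addn0 ffactnn.
by rewrite nth_default ?mul0rn // (leq_trans sp) // addnS ltnS leq_addr.
Qed.

End RationalPart.

(** * Frequencies near a fixed th0 when alpha is almost a polynomial *)

Section NearResonance.
Variable R : realType.
Implicit Types (a : nat -> R -> R).

Lemma evt_nat (P : R -> Prop) : evt P -> exists N : nat, forall X : nat, (N <= X)%N -> P X%:R.
Proof.
move=> [M HM]; exists (Num.truncn M).+1 => X NX; apply: HM.
by apply: (le_trans (ltW (truncnS_gt _))); rewrite ler_nat.
Qed.

(** The integrated form of a derivative bounded by Cb / x. *)
Definition slowly_varying (be : R -> R) (Cb : R) :=
  evt (fun x => forall y, x <= y -> `|be y - be x| * x <= Cb * (y - x)).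

(** On a progression, h is constant modulo 1 and factors out. A window spans at most q eps X and
    starts beyond ka X, so be moves by at most Cb q eps / ka on it. *)
Lemma windows_small_perturb (ka eps eta Cb : R) (q X : nat) (g h be : R -> R) (th : R)
    (M : R) :
  0 < ka -> 0 < eps -> 0 < Cb -> 0 < th -> 0 < M ->
  (forall x y, M <= x -> x <= y -> `|be y - be x| * x <= Cb * (y - x)) ->
  M <= ka * X%:R -> 0 < X%:R :> R ->
  16 * th * (Cb * (q%:R * eps) / ka) <= eta ->
  (forall p m : nat, e2pi (h (p%:R + q%:R * m%:R)) = e2pi (h p%:R)) ->
  windows_small ka eps eta q X g ->
  windows_small ka eps (eta + eta) q X (fun y => h y + g y + th * be y).
Proof.
move=> ka0 eps0 Cb0 th0 M0 sv MX X0 small_eta hinv Hg p kp pX.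
set W := Num.truncn _; pose y (m : nat) : R := p%:R + q%:R * m%:R.
have E : \sum_(m < W) e2pi (h (y m) + g (y m) + th * be (y m)) =
  e2pi (h p%:R) * (\sum_(m < W) e2pi (g (y m)) * e2pi (th * be p%:R) +
   \sum_(m < W) e2pi (g (y m)) * (e2pi (th * be (y m)) - e2pi (th * be p%:R))).
  rewrite -big_split /= mulr_sumr; apply: eq_bigr => m _.
  by rewrite !e2piD hinv; ring.
rewrite E normcM normc_e2pi mul1r mulrDl; apply: (le_trans (le_normcD _ _)).
apply: lerD.
  rewrite -mulr_suml normcM normc_e2pi mulr1; exact: Hg.
apply: (le_trans (normc_le_sum _ _ _)).
rewrite -[W in leRHS]card_ord mulr_natr -sumr_const; apply: ler_sum => m _.
rewrite normcM normc_e2pi mul1r; apply: (le_trans (normc_e2piB _ _)).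
apply: le_trans small_eta; rewrite -mulrBr normrM (gtr0_norm th0) [leLHS]mulrA.
rewrite ler_wpM2l ?mulr_ge0 ?(ltW th0) //.
have py : p%:R <= y m by rewrite /y lerDl mulr_ge0.
have h1 := sv _ _ (le_trans MX kp) py.
have kX : 0 < ka * X%:R by rewrite mulr_gt0.
have p0 : 0 < p%:R :> R by rewrite (lt_le_trans _ kp).
have mW : m%:R <= eps * X%:R.
  have /truncn_itv/andP[h2 _] : 0 <= eps * X%:R by rewrite mulr_ge0 // ltW.
  by apply: le_trans h2; rewrite ler_nat ltnW.
have h3 : `|be (y m) - be p%:R| * (ka * X%:R) <= Cb * (q%:R * (eps * X%:R)).
  apply: (@le_trans _ _ (`|be (y m) - be p%:R| * p%:R)); first by rewrite ler_wpM2l.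
  apply: (le_trans h1); rewrite ler_wpM2l ?(ltW Cb0) // /y addrC addKr.
  by rewrite ler_wpM2l.
rewrite ler_pdivlMr // -(ler_pM2r X0); move: h3; lra.
Qed.

Lemma poly_chain (a : nat -> R -> R) (Q : {poly R}) (th e x0 : R) N :
  deriv_chain N a x0 ->
  deriv_chain N (fun i x => th * (Q^`(i)).[x] + e * a i x) x0.
Proof.
move=> ch i x iN x0x; apply: is_deriveD; apply: is_deriveZ; last exact: ch.
Qed.

(* th = th0 + e with e small.  The monomials of th0 P above the highest irrational
   coefficient, of degree t, are constant modulo 1 on progressions modulo q.
   Either e a_t(X) is small and the irrational coefficient th0 P_t governs the t-th
   differences, or e alpha dominates at some order in (t, D]. *)
Lemma near_resonance a D (P : {poly R}) (Ca Cb th0 eta : R) :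
  growth_profile a D -> (0 < D)%N -> evt (fun x => a D x <= Ca) ->
  (size P <= D.+1)%N -> 0 < Cb -> slowly_varying (fun x => a 0%N x - P.[x]) Cb ->
  0 < th0 -> (exists2 t, (0 < t <= D)%N & ~ rational (th0 * P`_t)) -> 0 < eta ->
  exists2 rho, 0 < rho & exists X0 : nat, forall (X : nat) (th : R), (X0 <= X)%N ->
    `|th - th0| <= rho -> normc (\sum_(n < X) e2pi (th * a 0%N n%:R)) <= eta * X%:R.
Proof.
move=> pr D0 aDb sP Cb0 [M0 sv] th00 [t1 t1D irr1] eta0.
have [t tD [irr maxt]] : exists2 t, (0 < t <= D)%N &
    ~ rational (th0 * P`_t) /\ forall i, (t < i)%N -> rational (th0 * P`_i).
  pose Q i := (0 < i <= D)%N && `[< ~ rational (th0 * P`_i) >].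
  have exQ : exists i, Q i by exists t1; rewrite /Q t1D; apply/asboolP.
  have bQ i : Q i -> (i <= D)%N by move=> /andP[/andP[]].
  case: (ex_maxnP exQ bQ) => t /andP[tD /asboolP irr] maxt; exists t => //; split => // i ti.
  have [iD|Di] := leqP i D; last first.
    by exists 0; rewrite nth_default ?(leq_trans sP) // mulr0 rmorph0.
  apply: contrapT => nr; have := maxt i; rewrite /Q iD (leq_ltn_trans _ ti) //=.
  by move=> /(_ (asboolT nr)); rewrite leqNgt ti.
have [q q0 inv] := progression_invariant maxt.
have qr : 0 < q%:R :> R by rewrite ltr0n.
pose e1 := eta / 8; have e10 : 0 < e1 by rewrite divr_gt0.
pose ka := Num.min 1 e1; have ka0 : 0 < ka by rewrite lt_min ltr01.
have ka1 : ka <= 1 by rewrite ge_min lexx.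
have kae : ka <= e1 by rewrite ge_min lexx orbT.
(* [S1], [S2] and [S3] are the lower bounds on 1 / eps required by [epsq], [epsD] and [epsb]. *)
pose S1 := 2 * q%:R / e1; pose S2 : R := 2 * (q%:R * D.+2%:R).
pose S3 := 16 * th0 * (Cb * q%:R / ka) / e1.
have S10 : 0 < S1 by rewrite /S1 divr_gt0 // mulr_gt0.
have S20 : 0 < S2 by rewrite /S2 !mulr_gt0.
have S30 : 0 < S3 by rewrite /S3 !(divr_gt0, mulr_gt0).
pose eps := (S1 + S2 + S3)^-1.
have S0 : 0 < S1 + S2 + S3 by rewrite !addr_gt0.
have eps0 : 0 < eps by rewrite invr_gt0.
have epsS x : x <= S1 + S2 + S3 -> eps * x <= 1 by move=> h; rewrite mulrC ler_pdivrMr // mul1r.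
have epsq : 2 * q%:R * eps <= e1.
  have : eps * S1 <= 1 by apply: epsS; rewrite -addrA lerDl addr_ge0 // ltW.
  by rewrite /S1 mulrA ler_pdivrMr // mul1r mulrC.
have epsD : eps * q%:R * D.+2%:R <= 1 / 2.
  have : eps * S2 <= 1 by apply: epsS; rewrite addrAC lerDr addr_ge0 // ltW.
  by rewrite /S2; lra.
have epsb : 16 * th0 * (Cb * (q%:R * eps) / ka) <= e1.
  have : eps * S3 <= 1 by apply: epsS; rewrite lerDr addr_ge0 // ltW.
  rewrite /S3 [eps * _]mulrA ler_pdivrMr // mul1r => h; apply: le_trans h.
  by apply: le_of_eq; ring.
pose Q := take_poly t.+1 P.
have sQ : (size Q <= t.+1)%N by exact: size_take_poly.
have [t0 tDl] := andP tD.
(* The derivative of order t of th0 Q, a constant because Q is P cut off above degree t. *)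
pose gam := th0 * (P`_t *+ t`!).
have gam_irr (d : nat) (j : int) : (0 < d)%N -> gam * d%:R <> j%:~R.
  move=> d0 E; apply: irr; exists (j%:~R / (t`! * d)%:R).
  rewrite fmorph_div rmorph_int rmorph_nat -E /gam natrM -mulr_natr.
  by field; rewrite !pnatr_eq0 -!lt0n fact_gt0 d0.
have epst : eps * q%:R * t.-1.+1%:R <= 1 / 2.
  apply: le_trans epsD; rewrite ler_wpM2l ?mulr_ge0 ?(ltW eps0) // ler_nat prednK //.
  by rewrite (leq_trans tDl) // -addn2 leq_addr.
have [kapi kapi0 [Ki Ki1 HKi]] := window_irrational ka gam_irr e10 eps0 q0 epst.
have [kap kap0 [X1 HT]] := profile_tests pr ka0 ka1 e10 eps0 q0 epsD.
have [C C1 Hcomp] := profile_comparable pr tDl ka0 ka1.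
have C0 : 0 < C by rewrite (lt_le_trans _ C1).
have [c c0 Hr] := profile_ratios pr.
(* Dividing by C passes from the value of a_t at X to its values on [ka X, 2 X]. *)
pose k1 := Num.min (kapi / C) kap.
have k10 : 0 < k1 by rewrite lt_min kap0 divr_gt0.
pose Ca1 := `|Ca| + 1; have Ca10 : 0 < Ca1 by rewrite ltr_wpDl.
(* Within this radius e a_D(X) is always at most [k1], so a drop occurs no later than order D. *)
exists (k1 / Ca1); first by rewrite divr_gt0.
have evX : evt (fun x => [/\ [/\ 1 <= x, Ki <= x & e1^-1 <= x], [/\ 1 <= eps * x, `|M0| + 1 <= ka * x &
    (kap * c * k1)^-1 <= x] , deriv_chain D.+1 a (ka * x),
    forall i, (i < D)%N -> c * a i x <= x * a i.+1 x &
    a D x <= Ca /\ forall y : R, ka * x <= y <= 2 * x ->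
      [/\ 0 < a t y, a t y <= C * a t x & a t x <= C * a t y]]).
  have h1 := evt_and (evt_ge 1) (evt_and (evt_ge Ki) (evt_ge e1^-1)).
  have h2 := evt_and (evt_scale eps0 (evt_ge 1)) (evt_and (evt_scale ka0 (evt_ge (`|M0| + 1)))
     (evt_ge (kap * c * k1)^-1)).
  have h3 := evt_and (evt_scale ka0 (profile_chain pr D.+1)) Hr.
  have := evt_and (evt_and h1 h2) (evt_and h3 (evt_and aDb Hcomp)).
  by apply: evt_mono => x [[[? [? ?]] [? [? ?]]] [[? ?] [? ?]]].
have [X2 HX2] := evt_nat evX.
exists (maxn X1 X2) => X th; rewrite geq_max => /andP[X1X /HX2[[Xg1 XKi Xe] [Xeps XM Xk] ch rat [aDX comp]]] the.
pose e := th - th0.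
pose cc i x := th0 * (Q^`(i)).[x] + e * a i x.
have chc : deriv_chain D.+1 cc (ka * X%:R) by exact: poly_chain.
have Xp : 0 < X%:R :> R by rewrite (lt_le_trans _ Xg1).
have kX : ka * X%:R <= X%:R <= 2 * (X%:R : R) by rewrite ler_piMl ?(ltW Xp) //= mulr_natl mulr2n lerDl ltW.
have [atX _ _] := comp _ kX.
suff Hw : windows_small ka eps e1 q X (cc 0%N).
  have inv' p m : e2pi (th0 * (P - Q).[p%:R + q%:R * m%:R]) = e2pi (th0 * (P - Q).[p%:R]).
    by rewrite -(inv p m) natrD natrM.
  have M10 : 0 < `|M0| + 1 by rewrite ltr_wpDl.
  have sv' : forall x y, `|M0| + 1 <= x -> x <= y ->
      `|a 0%N y - P.[y] - (a 0%N x - P.[x])| * x <= Cb * (y - x).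
    move=> x y Mx xy; apply: sv => //; apply: le_trans Mx.
    by rewrite (le_trans (ler_norm _)) // lerDl.
  have H := windows_small_perturb (be := fun x => a 0%N x - P.[x])
    (h := fun x => th0 * (P - Q).[x]) ka0 eps0 Cb0 th00 M10 sv' XM Xp epsb inv' Hw.
  have e120 : 0 <= e1 + e1 by rewrite addr_ge0 // ltW.
  have -> : \sum_(n < X) e2pi (th * a 0%N n%:R) =
     \sum_(n < X) e2pi (th0 * (P - Q).[n%:R] + cc 0%N n%:R + th0 * (a 0%N n%:R - P.[n%:R])).
    apply: eq_bigr => n _; congr (e2pi _); rewrite /cc derivn0 hornerD hornerN /e; ring.
  have := @windows_sum R ka eps (e1 + e1) X q (fun x => th0 * (P - Q).[x] + cc 0%N x +
    th0 * (a 0%N x - P.[x])) ka0 e120 eps0 Xeps H.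
  move=> h; apply: (le_trans h).
  have h1 : 1 <= e1 * X%:R by rewrite -ler_pdivrMl // mulr1.
  have h2 : (2 * q%:R * eps + ka + (e1 + e1)) * X%:R <= (e1 + e1 + (e1 + e1)) * X%:R.
    by rewrite ler_wpM2r ?(ltW Xp) // lerD2r lerD.
  have h3 : 0 < e1 * X%:R by rewrite mulr_gt0.
  rewrite (_ : eta = 8 * e1); last by rewrite /e1 mulrC divfK.
  by move: h1 h2 h3; clear; lra.
have [small_t|large_t] := leP (`|e| * a t X%:R) k1.
  apply: (HKi X cc (ka * X%:R) XKi _ (lexx _)).
    by move=> i x it; apply: chc; rewrite (leq_trans it) // prednK // leqW.
  move=> y yX; have [_ aty _] := comp y yX.
  rewrite prednK // /cc derivn_top // hornerC coef_take_poly ltnSn -/gam addrAC subrr add0r.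
  have [at0 _ _] := comp y yX.
  rewrite normrM (gtr0_norm at0); apply: (@le_trans _ _ (`|e| * (C * a t X%:R))).
    by rewrite ler_wpM2l.
  rewrite mulrCA mulrC -ler_pdivlMr //; apply: (le_trans small_t).
  by rewrite /k1 ge_min lexx.
have e0 : 0 < `|e|.
  by rewrite normr_gt0; apply/eqP => e0; move: large_t; rewrite e0 normr0 mul0r ltNge (ltW k10).
have smallD : `|e| * a D X%:R <= k1.
  apply: (@le_trans _ _ (`|e| * Ca1)); last by rewrite -ler_pdivlMr.
  rewrite ler_wpM2l // (le_trans aDX) // /Ca1 (le_trans (ler_norm Ca)) // lerDl //.
have tltD : (t < D)%N.
  rewrite ltn_neqAle tDl andbT; apply/eqP => tE.
  by move: large_t; rewrite tE ltNge smallD.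
have [k /andP[tk kD] /andP[ks kl]] := @first_drop (fun i => `|e| * a i X%:R <= k1) t D tltD
  (negbT (lt_geF large_t)) smallD.
(* Since k >= t, the derivatives of Q of order k+1 and k+2 vanish and only e times those of alpha
   remain. *)
apply: (HT k kD kap0 X cc (ka * X%:R) `|e| e (Num.sg e) X1X _ (lexx _) e0).
- by move=> i x ik; apply: chc; rewrite (leq_trans ik).
- by rewrite normr_sg (_ : e != 0) // -normr_gt0.
- move=> y _; rewrite /cc derivn_poly0; last by rewrite (leq_trans sQ).
  by rewrite horner0 mulr0 add0r mulrA normrEsg.
- move=> y _; rewrite /cc derivn_poly0; last by rewrite (leq_trans sQ) // leqW.
  by rewrite horner0 mulr0 add0r.
- by apply: (le_trans ks); rewrite /k1 ge_min lexx orbT.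
apply: (@ratio_power _ a c kap (k1 * X%:R) `|e| X%:R k) => //.
- by rewrite mulr_gt0.
- exact: rat.
- rewrite -ltNge in kl; apply: ler_pM; rewrite ?(ltW k10) ?(ltW Xp) ?(ltW kl) //.
  by case: k tk {kD ks kl} => [|k] tk; [move: tk; rewrite leqNgt t0|rewrite exprS ler_peMr ?(ltW Xp) // exprn_ege1].
by rewrite mulrA invfM ler_pdivrMr // mul1r.
Qed.

End NearResonance.

(** * The Weyl estimate, uniform in the frequency *)

Section Uniform.
Variable R : realType.
Implicit Types (a : nat -> R -> R).

(** The last clause is the form in which the logarithmic hypothesis is used. *)
Definition polynomial_regime a (D : nat) (Ca Cb : R) (P : {poly R}) :=
  [/\ evt (fun x => a D x <= Ca), (size P <= D.+1)%N, 0 < Cb,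
      slowly_varying (fun x => a 0%N x - P.[x]) Cb &
      forall th0, 0 < th0 -> exists2 t, (0 < t <= D)%N & ~ rational (th0 * P`_t)].

(** [near_resonance] gives each th0 its own radius and threshold; compactness of the segment merges
    the thresholds. *)
Lemma resonance_uniform a D Ca Cb P (eta del th1 : R) :
  growth_profile a D -> (0 < D)%N -> polynomial_regime a D Ca Cb P -> 0 < eta -> 0 < del ->
  exists X0 : nat, forall (X : nat) (th : R), (X0 <= X)%N -> del <= th <= th1 ->
    normc (\sum_(n < X) e2pi (th * a 0%N n%:R)) <= eta * X%:R.
Proof.
move=> pr D0 [aD sP Cb0 sv irr] eta0 del0.
pose Q (X : nat) (th : R) := normc (\sum_(n < X) e2pi (th * a 0%N n%:R)) <= eta * X%:R.
have /compact_near_coveringP cov : compact `[del, th1]%classic by exact: segment_compact.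
have [|X0 _ H] := cov nat \oo Q _.
  move=> th0 /=; rewrite in_itv /= => /andP[th0l _].
  have th00 : 0 < th0 by rewrite (lt_le_trans del0).
  have [rho rho0 [X0 HX]] := near_resonance pr D0 aD sP Cb0 sv th00 (irr _ th00) eta0.
  exists (ball th0 rho, [set X | (X0 <= X)%N]).
    by split; [exact: nbhsx_ballx|exists X0].
  move=> [th X] /= [bth XX]; apply: HX => //.
  by move: bth; rewrite -ball_normE /= distrC => /ltW.
exists X0 => X th XX thI; apply: (H X XX); rewrite /= in_itv /=; exact: thI.
Qed.

Lemma uniform_bound a D : growth_profile a D -> (0 < D)%N ->
  (exists s, vanishing_next a D s) \/ (exists Ca Cb P, polynomial_regime a D Ca Cb P) ->
  forall eta th1 : R, 0 < eta -> 0 < th1 ->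
  exists2 K, 0 < K & exists X0 : nat, forall (X : nat) (th : R), (X0 <= X)%N ->
    K <= th * a 0%N X%:R -> th <= th1 ->
    normc (\sum_(n < X) e2pi (th * a 0%N n%:R)) <= eta * X%:R.
Proof.
move=> pr D0 cases eta th1 eta0 th10.
pose e1 := eta / 4; have e10 : 0 < e1 by rewrite divr_gt0.
pose ka := Num.min 1 e1; have ka0 : 0 < ka by rewrite lt_min ltr01.
have ka1 : ka <= 1 by rewrite ge_min lexx.
have kae : ka <= e1 by rewrite ge_min lexx orbT.
pose eps := (2 / e1 + 2 * D.+2%:R)^-1.
have S10 : 0 < 2 / e1 by rewrite divr_gt0.
have S20 : 0 < 2 * D.+2%:R :> R by rewrite mulr_gt0.
have S0 : 0 < 2 / e1 + 2 * D.+2%:R by rewrite addr_gt0.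
have eps0 : 0 < eps by rewrite invr_gt0.
have epsS x : x <= 2 / e1 + 2 * D.+2%:R -> eps * x <= 1.
  by move=> h; rewrite mulrC ler_pdivrMr // mul1r.
have eps2 : 2 * 1%:R * eps <= e1.
  have : eps * (2 / e1) <= 1 by apply: epsS; rewrite lerDl ltW.
  by rewrite mulrA ler_pdivrMr // mul1r mulr1 mulrC.
have epsD : eps * 1%:R * D.+2%:R <= 1 / 2.
  have : eps * (2 * D.+2%:R) <= 1 by apply: epsS; rewrite lerDr ltW.
  by rewrite mulr1; lra.
have [c c0 Hr] := profile_ratios pr.
have [kap kap0 [X1 HT]] := profile_tests pr ka0 ka1 e10 eps0 (ltn0Sn 0) epsD.
(* No order up to D is usable here. Either a_(D+1) x^(D+1) dominates a_D and the test applies at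
   order D+1, or a_D is bounded, which keeps th in a compact interval away from 0. *)
have [X2 top] : exists X2 : nat, forall (X : nat) (th : R), (X2 <= X)%N ->
    0 < th -> th <= th1 -> kap < th * a D X%:R ->
    windows_small ka eps e1 1 X (fun x => th * a 0%N x) \/
    normc (\sum_(n < X) e2pi (th * a 0%N n%:R)) <= eta * X%:R.
  case: cases => [[s [s1 comp sm dom]]|[Ca [Cb [P reg]]]]; last first.
    have [aD _ _ _ _] := reg.
    pose Ca1 := `|Ca| + 1; have Ca10 : 0 < Ca1 by rewrite ltr_wpDl.
    have del0 : 0 < kap / Ca1 by rewrite divr_gt0.
    have [X2 H2] := resonance_uniform th1 pr D0 reg eta0 del0.
    have [X3 H3] := evt_nat aD.
    exists (maxn X2 X3) => X th; rewrite geq_max => /andP[XX2 XX3] th0 thl kl; right.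
    apply: H2 => //; rewrite thl andbT ler_pdivrMr //.
    apply: (le_trans (ltW kl)); rewrite ler_wpM2l ?(ltW th0) //.
    by rewrite (le_trans (H3 X XX3)) // /Ca1 (le_trans (ler_norm Ca)) // lerDl.
  have [kg kg0 [X2 T]] := order_test_exists ka0 ka1 e10 eps0 (ltn0Sn 0) epsD comp
    (profile_trich pr D.+2).
  have smc : 0 < kg / th1 by rewrite divr_gt0.
  have ev := evt_and (evt_and (sm _ smc) (dom (kg * kap)^-1))
    (evt_and (evt_scale ka0 (profile_chain pr D.+2)) (evt_ge 1)).
  have [X3 H3] := evt_nat ev.
  exists (maxn X2 X3) => X th; rewrite geq_max.
  move=> /andP[XX2 /H3[[smX domX] [chX X1']]] th0 thl kl; left.
  apply: (T kg0 X (fun i x => th * a i x) (ka * X%:R) th th s XX2 _ (lexx _) th0 s1) => //.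
  - by move=> i x iD x0; apply: is_deriveZ; exact: chX.
  - by move=> y _; rewrite mulrCA.
  - apply: (@le_trans _ _ (th1 * `|a D.+1 X%:R|)); last first.
      by move: smX; rewrite expr0 mulr1 ler_pdivlMr // mulrC.
    apply: (@le_trans _ _ (th * `|a D.+1 X%:R|)); last by rewrite ler_wpM2r.
    rewrite ler_wpM2l ?(ltW th0) // (le_trans (ler_norm _)) //.
    by rewrite normrM s1 mul1r.
  have h : kg * kap * (kg * kap)^-1 <= kg * (th * a D X%:R) * (kg * kap)^-1.
    by rewrite ler_wpM2r ?invr_ge0 ?mulr_ge0 ?(ltW kg0) ?(ltW kap0) // ler_wpM2l ?(ltW kg0) // ltW.
  rewrite divff ?gt_eqF ?mulr_gt0 // in h; apply: (le_trans h).
  rewrite -!mulrA ler_wpM2l ?(ltW kg0) // ler_wpM2l ?(ltW th0) //.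
  by rewrite mulrC mulrA.
(* [kap] makes th a_0(X) fail to be small; [(kap * c)^-1] is what [ratio_power] needs when the drop
   occurs at k = 0, where no power of X helps. *)
pose K := 1 + kap + (kap * c)^-1.
have kc0 : 0 < kap * c by rewrite mulr_gt0.
have K0 : 0 < K by rewrite /K !addr_gt0 // invr_gt0.
exists K => //.
have ev := evt_and (evt_and Hr (evt_scale eps0 (evt_ge 1)))
  (evt_and (evt_and (evt_ge 1) (evt_ge e1^-1)) (evt_and (evt_scale ka0 (profile_chain pr D.+1))
    (evt_and (evt_ge (kap * c * kap)^-1) (profile_unbounded pr 1)))).
have [X3 H3] := evt_nat ev.
exists (maxn X1 (maxn X2 X3)) => X th; rewrite !geq_max.
move=> /andP[XX1 /andP[XX2 /H3[[rat Xeps] [[Xg1 Xe] [chX [Xk a01]]]]]] hK thl.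
have a0X : 0 < a 0%N X%:R by rewrite (lt_le_trans _ a01).
have Xp : 0 < X%:R :> R by rewrite (lt_le_trans _ Xg1).
have th0 : 0 < th by rewrite -(pmulr_lgt0 _ a0X) (lt_le_trans K0).
have fin : windows_small ka eps e1 1 X (fun x => th * a 0%N x) ->
    normc (\sum_(n < X) e2pi (th * a 0%N n%:R)) <= eta * X%:R.
  move=> Hw; have := windows_sum ka0 (ltW e10) eps0 Xeps Hw => h; apply: (le_trans h).
  have h1 : 1 <= e1 * X%:R by rewrite -ler_pdivrMl // mulr1.
  have h2 : (2 * 1%:R * eps + ka + e1) * X%:R <= (e1 + e1 + e1) * X%:R.
    by rewrite ler_wpM2r ?(ltW Xp) // lerD2r lerD.
  rewrite (_ : eta = 4 * e1); last by rewrite /e1 mulrC divfK.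
  by move: h1 h2; clear; lra.
have [smallD|largeD] := leP (th * a D X%:R) kap; last by case: (top X th XX2 th0 thl largeD).
apply: fin.
have n0 : ~~ (th * a 0%N X%:R <= kap).
  rewrite -ltNge (lt_le_trans _ hK) // /K addrAC ltrDr addr_gt0 // invr_gt0 //.
have [k /andP[_ kD] /andP[ks kl]] := @first_drop (fun i => th * a i X%:R <= kap) 0 D D0 n0 smallD.
apply: (HT k kD kap0 X (fun i x => th * a i x) (ka * X%:R) th th 1 XX1 _ (lexx _) th0) => //.
- by move=> i x ik x0; apply: is_deriveZ; apply: chX => //; rewrite (leq_trans ik).
- by rewrite normr1.
- by move=> y _; rewrite mul1r.
have [mu mu0 [hmu muc]] : exists2 mu, 0 < mu &
    mu <= th * a k X%:R * X%:R ^+ k /\ (kap * c * mu)^-1 <= 1.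
  case: k {kD ks} kl => [|k] kl.
    exists K => //; split; first by rewrite expr0 mulr1.
    rewrite invf_le1 ?mulr_gt0 // -ler_pdivrMl // mulr1.
    by rewrite /K lerDr addr_ge0 // ltW.
  exists (kap * X%:R); first by rewrite mulr_gt0.
  rewrite -ltNge in kl; split.
    apply: ler_pM; rewrite ?(ltW kap0) ?(ltW Xp) ?(ltW kl) //.
    by rewrite exprS ler_peMr ?(ltW Xp) // exprn_ege1.
  by rewrite mulrA invfM ler_pdivrMr // mul1r.
apply: (@ratio_power _ a c kap mu th X%:R k c0 kap0 mu0 (ltW th0) Xg1 _ hmu muc).
exact: rat.
Qed.

End Uniform.

(** * Extracting the polynomial and its irrational coefficient *)

Section PolynomialRegime.
Variable R : realType.
Implicit Types (a : nat -> R -> R).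

(** With h = C / x^(s+1), g - h is nondecreasing and g + h nonincreasing; they enclose the supremum
    of the former. *)
Lemma limit_of_decay (g dg : R -> R) (C : R) (s : nat) :
  evt (fun x => is_derive x 1 g (dg x)) -> evt (fun x => `|dg x| * x ^+ s.+2 <= C) ->
  exists L C', evt (fun x => `|g x - L| * x ^+ s.+1 <= C').
Proof.
move=> D h; have [M HM] := evt_and (evt_and D h) (evt_ge 1).
have C0 : 0 <= C.
  have [[_ h1] M1] := HM M (lexx _); apply: le_trans h1.
  by rewrite mulr_ge0 // exprn_ge0 // (le_trans _ M1).
pose hh x : R := C * (x ^+ s.+1)^-1.
have dh (x : R) : 0 < x -> is_derive x 1 hh (C * (- s.+1%:R * ((x ^+ s.+1)^-1 / x))).
  by move=> x0; apply: is_deriveZ; exact: is_derive_invpow.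
have key (x : R) : M <= x -> `|dg x| <= C * (s.+1%:R * ((x ^+ s.+1)^-1 / x)).
  move=> Mx; have [[_ h1] x1] := HM x Mx; have x0 : 0 < x by rewrite (lt_le_trans _ x1).
  have xs : 0 < x ^+ s.+2 by rewrite exprn_gt0.
  rewrite -ler_pdivlMr // in h1; apply: (le_trans h1).
  rewrite ler_wpM2l // -invfM -exprSr ler_peMl ?invr_ge0 ?(ltW xs) //.
  by rewrite ler1n.
have up : forall x y, M <= x -> x <= y -> g x - hh x <= g y - hh y.
  apply: (nondecr_of_derive (f := fun x => g x - hh x)
    (df := fun x => dg x - C * (- s.+1%:R * ((x ^+ s.+1)^-1 / x)))) => x Mx;
    have [[Dx _] x1] := HM x Mx; have x0 : 0 < x by rewrite (lt_le_trans _ x1).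
    by apply: is_deriveB => //; exact: dh.
  rewrite mulNr mulrN opprK; have := key x Mx; rewrite ler_norml => /andP[h1 _].
  by rewrite -lerBlDr sub0r.
have dn : forall x y, M <= x -> x <= y -> g y + hh y <= g x + hh x.
  apply: (nonincr_of_derive (f := fun x => g x + hh x)
    (df := fun x => dg x + C * (- s.+1%:R * ((x ^+ s.+1)^-1 / x)))) => x Mx;
    have [[Dx _] x1] := HM x Mx; have x0 : 0 < x by rewrite (lt_le_trans _ x1).
    by apply: is_deriveD => //; exact: dh.
  rewrite mulNr mulrN subr_le0; have := key x Mx; rewrite ler_norml => /andP[_ h1].
  exact: h1.
have hh0 x : M <= x -> 0 <= hh x.
  move=> Mx; have [_ x1] := HM x Mx.
  by rewrite /hh mulr_ge0 // invr_ge0 exprn_ge0 // (le_trans _ x1).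
have cross x y : M <= x -> M <= y -> g x - hh x <= g y + hh y.
  move=> Mx My; have [xy|/ltW yx] := leP x y.
    by apply: (le_trans (up x y Mx xy)); have := hh0 y My; lra.
  by apply: (le_trans _ (dn y x My yx)); have := hh0 x Mx; lra.
pose E := [set g x - hh x | x in [set x | M <= x]]%classic.
have En : E !=set0 by exists (g M - hh M); exists M => /=.
have Eu : has_ubound E by exists (g M + hh M) => _ [x /= Mx <-]; exact: cross.
exists (sup E), C; exists M => x Mx; have [_ x1] := HM x Mx.
have xs : 0 < x ^+ s.+1 by rewrite exprn_gt0 // (lt_le_trans _ x1).
rewrite -ler_pdivlMr // -/(hh x) ler_norml.
have l1 : g x - hh x <= sup E by apply: ub_le_sup => //; exists x.
have l2 : sup E <= g x + hh x by apply: ge_sup => // _ [y /= My <-]; exact: cross.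
by apply/andP; split; lra.
Qed.

Lemma antiderivative (P : {poly R}) :
  exists2 Q : {poly R}, Q^`() = P & (size Q <= (size P).+1)%N.
Proof.
exists (\poly_(i < (size P).+1) (P`_i.-1 / i%:R)); last exact: size_poly.
apply/polyP => i; rewrite coef_deriv coef_poly ltnS.
case: ltnP => iP; last by rewrite mul0rn nth_default.
by rewrite /= -[_ *+ i.+1]mulr_natr divfK ?pnatr_eq0.
Qed.

(** Integrating back from order i+j, each step costs one power of decay and adds one constant of
    integration, the limit of the remainder. *)
Lemma poly_of_decay a (C : R) :
  (forall i, evt (fun x => is_derive x 1 (a i) (a i.+1 x))) ->
  forall j s i, evt (fun x => `|a (i + j)%N x| * x ^+ (j + s).+1 <= C) ->
  exists2 P : {poly R}, (size P <= j)%N &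
    exists C', evt (fun x => `|a i x - P.[x]| * x ^+ s.+1 <= C').
Proof.
move=> D; elim=> [|j IH] s i h.
  exists 0; rewrite ?size_poly0 //; exists C; move: h; apply: evt_mono => x.
  by rewrite addn0 horner0 subr0.
have [|P sP [C' hP]] := IH s.+1 i.+1.
  by move: h; rewrite addSnnS addSnnS.
have [Q QP sQ] := antiderivative P.
have Dg : evt (fun x => is_derive x 1 (fun y => a i y - Q.[y]) (a i.+1 x - P.[x])).
  apply: evt_mono (D i) => x Dx; apply: is_deriveB.
  by rewrite -QP; exact: is_derive_poly.
have [L [C2 hL]] := limit_of_decay Dg hP.
exists (Q + L%:P).
  apply: (leq_trans (size_polyD _ _)); rewrite geq_max (leq_trans sQ) ?ltnS //=.
  by rewrite (leq_trans (size_polyC_leq1 _)).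
by exists C2; move: hL; apply: evt_mono => x; rewrite hornerD hornerC opprD addrA.
Qed.

(** Adding [C * ln] makes be nondecreasing, subtracting it makes be nonincreasing. *)
Lemma log_bound (be dbe : R -> R) (C : R) : 0 <= C ->
  evt (fun x => is_derive x 1 be (dbe x)) -> evt (fun x => `|dbe x| * x <= C) ->
  exists B, evt (fun x => `|be x| <= B + C * ln x).
Proof.
move=> C0 D h; have [M HM] := evt_and (evt_and D h) (evt_ge 1).
have dln (x : R) : M <= x -> is_derive x 1 (fun y => C * ln y) (C * x^-1).
  move=> /HM[_ x1]; apply: is_deriveZ; apply: is_derive1_ln.
  exact: lt_le_trans x1.
have key (x : R) : M <= x -> `|dbe x| <= C * x^-1.
  by move=> /HM[[_ h1] x1]; rewrite ler_pdivlMr // (lt_le_trans _ x1).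
have up : forall x y, M <= x -> x <= y -> be x + C * ln x <= be y + C * ln y.
  apply: (nondecr_of_derive (f := fun x => be x + C * ln x)
    (df := fun x => dbe x + C * x^-1)) => x Mx.
    by have [[Dx _] _] := HM x Mx; apply: is_deriveD => //; exact: dln.
  by have := key x Mx; rewrite ler_norml => /andP[h1 _]; rewrite -lerBlDr sub0r.
have dn : forall x y, M <= x -> x <= y -> be y - C * ln y <= be x - C * ln x.
  apply: (nonincr_of_derive (f := fun x => be x - C * ln x)
    (df := fun x => dbe x - C * x^-1)) => x Mx.
    by have [[Dx _] _] := HM x Mx; apply: is_deriveB => //; exact: dln.
  by have := key x Mx; rewrite ler_norml => /andP[_ h1]; rewrite subr_le0.
exists (`|be M| + C * `|ln M|); exists M => x Mx.
have h1 := up M x (lexx _) Mx; have h2 := dn M x (lexx _) Mx.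
have h3 := ler_norm (be M); have h4 := ler_norm (- be M); rewrite normrN in h4.
have h5 : C * ln M <= C * `|ln M| by rewrite ler_wpM2l // ler_norm.
have h6 : - (C * ln M) <= C * `|ln M| by rewrite -mulrN ler_wpM2l // -normrN ler_norm.
by rewrite ler_norml; apply/andP; split; lra.
Qed.

(** [poly_of_decay] stops at order 1 with error O(1 / x); one more integration gives Q with
    logarithmic error. If th0 made all nonconstant coefficients of th0 Q rational, alpha would be
    within O(log x) of a real multiple of a rational polynomial. *)
Lemma polynomial_regime_of_decay a D C : growth_profile a D -> (0 < D)%N ->
  almost_polynomial a D C ->
  (forall (p : {poly rat}) (c B : R),
     evt (fun x => B <= `|a 0%N x - c * (map_poly ratr p).[x]| / ln x)) ->
  exists Ca Cb P, polynomial_regime a D Ca Cb P.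
Proof.
move=> pr D0 [aD adec] hlog.
have Dev i : evt (fun x => is_derive x 1 (a i) (a i.+1 x)).
  by apply: evt_mono (profile_chain pr i.+1) => x ch; apply: ch.
have [|P1 sP1 [C1 hP1]] := @poly_of_decay a C Dev D 0 1.
  by move: adec; rewrite addn0 add1n.
have [Q QP sQ] := antiderivative P1.
pose Cb := `|C1| + 1; have Cb0 : 0 < Cb by rewrite ltr_wpDl.
pose be x := a 0%N x - Q.[x].
have Dbe : evt (fun x => is_derive x 1 be (a 1%N x - P1.[x])).
  apply: evt_mono (Dev 0%N) => x Dx; apply: is_deriveB.
  by rewrite -QP; exact: is_derive_poly.
have dbe : evt (fun x => `|a 1%N x - P1.[x]| * x <= Cb).
  move: hP1; apply: evt_mono => x; rewrite expr1 => h; apply: (le_trans h).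
  by rewrite /Cb (le_trans (ler_norm C1)) // lerDl.
exists C, Cb, Q; split => //.
- by apply: (leq_trans sQ); rewrite ltnS.
- have [M HM] := evt_and (evt_and Dbe dbe) (evt_ge 1); exists M => x Mx y xy.
  have [z /andP[xz _]|z /andP[xz zy] ->] := @mean_value R be (fun x => a 1%N x - P1.[x]) x y xy.
    by have [[]] := HM z (le_trans Mx xz).
  have [[_ hz] _] := HM z (le_trans Mx xz); have [_ x1] := HM x Mx.
  have yx : 0 <= y - x by rewrite subr_ge0.
  rewrite normrM (ger0_norm yx) mulrAC ler_wpM2r //; apply: le_trans hz.
  by rewrite ler_wpM2l.
move=> th0 th00; apply: contrapT => N.
have ratQ t : (0 < t <= D)%N -> rational (th0 * Q`_t).
  by move=> tD; apply: contrapT => nr; apply: N; exists t.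
pose r t : rat := xget 0 [set r | th0 * Q`_t = ratr r]%classic.
have rE t : (0 < t <= D)%N -> th0 * Q`_t = ratr (r t).
  by move=> /ratQ[x hx]; rewrite /r; apply: (@xgetPex _ 0 [set r | th0 * Q`_t = ratr r]%classic); exists x.
(* The constant term may be irrational and is dropped, a bounded error being absorbed by [ln x]. *)
pose p : {poly rat} := \poly_(t < D.+1) (if t == 0%N then 0 else r t).
have pE x : th0^-1 * (map_poly ratr p).[x] = Q.[x] - Q`_0.
  have -> : map_poly ratr p = th0 *: (Q - (Q`_0)%:P) :> {poly R}.
    apply/polyP => t; rewrite coef_map /= coef_poly coefZ coefB coefC.
    have [->|t0] := eqVneq t 0%N; first by rewrite /= subrr mulr0 rmorph0.
    rewrite subr0 ltnS; case: leqP => tD; first by rewrite rE // lt0n t0.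
    by rewrite rmorph0 nth_default ?mulr0 // (leq_trans sQ) // (leq_trans _ tD).
  by rewrite hornerZ mulKf ?gt_eqF // hornerD hornerN hornerC.
have [B hB] := log_bound (ltW Cb0) Dbe dbe.
pose B1 := `|B| + `|Q`_0| + Cb + 1.
have [x [[h1 h2] h3]] := evt_ex (evt_and (evt_and hB (hlog p th0^-1 B1)) (evt_ge (expR 1))).
have lx : 1 <= ln x.
  by rewrite -[1]expRK ler_ln ?posrE ?expR_gt0 // (lt_le_trans _ h3) // expR_gt0.
move: h2; rewrite pE ler_pdivlMr; last by rewrite (lt_le_trans _ lx).
have -> : a 0%N x - (Q.[x] - Q`_0) = be x + Q`_0 by rewrite /be; ring.
have h4 := ler_normD (be x) Q`_0; have h5 := ler_norm B.
have h6 : (`|B| + `|Q`_0| + 1) * 1 <= (`|B| + `|Q`_0| + 1) * ln x.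
  by rewrite ler_wpM2l // !addr_ge0.
rewrite /B1 => h7; move: h1 h4 h5 h6 h7; rewrite !mulrDl; lra.
Qed.

End PolynomialRegime.

(** * Counting representations by finite Fourier analysis *)

Section Counting.
Variable R : realType.

(** The size condition turns divisibility of z by Q into z = 0. *)
Lemma orthogonality (Q : nat) (z : int) : (`|z| < Q)%N ->
  \sum_(m < Q) e2pi (m%:R / Q%:R * z%:~R : R) = (Q * (z == 0))%:R%:C.
Proof.
move=> zQ; have Q0 : (0 < Q)%N by exact: leq_ltn_trans zQ.
have Qr : Q%:R != 0 :> R by rewrite pnatr_eq0 -lt0n.
have [->|z0] := eqVneq z 0.
  rewrite muln1 (eq_bigr (fun=> 1)); last by move=> m _; rewrite mulr0 e2pi0.
  by rewrite sumr_const card_ord rmorph_nat.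
rewrite muln0 rmorph0.
pose w : R[i] := e2pi (z%:~R / Q%:R).
have wm (m : 'I_Q) : e2pi (m%:R / Q%:R * z%:~R) = w ^+ m.
  by rewrite /w -e2piMn -[_ *+ m]mulr_natr; congr e2pi; ring.
under eq_bigr do rewrite wm.
have wQ : w ^+ Q = 1.
  by rewrite /w -e2piMn -[_ *+ Q]mulr_natr divfK // e2pi_int.
have w1 : w != 1.
  apply/eqP => /e2pi_eq1[j hj].
  have hz : z = j * Q%:Z.
    apply/eqP; rewrite -(eqr_int R) intrM -pmulrn -hj divfK //.
  move: zQ; rewrite hz abszM /= ltnNge leq_pmull // lt0n absz_eq0.
  by apply: contra_neq z0 => j0; rewrite hz j0 mul0r.
have := subrX1 w Q; rewrite wQ subrr => /esym/eqP.
by rewrite mulf_eq0 subr_eq0 (negbTE w1) /= => /eqP.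
Qed.

Lemma geometric_bound (th : R) (b : nat) :
  normc (\sum_(i < b) e2pi (th * i%:R)) * normc (1 - e2pi th) <= 2.
Proof.
rewrite -normcM.
have -> : (\sum_(i < b) e2pi (th * i%:R)) * (1 - e2pi th) = 1 - e2pi th ^+ b.
  rewrite (eq_bigr (fun i : 'I_b => e2pi th ^+ i)); last first.
    by move=> i _; rewrite -e2piMn mulr_natr.
  have := subrX1 (e2pi th) b => /(congr1 -%R); rewrite opprB => ->.
  by rewrite -mulNr opprB mulrC.
apply: (le_trans (le_normcB _ _)).
by rewrite -e2piMn normc1 normc_e2pi.
Qed.

Lemma normc_sum_e2pi_le (I : finType) (f : I -> R) :
  normc (\sum_i e2pi (f i)) <= #|I|%:R.
Proof.
apply: (le_trans (normc_le_sum _ _ _)).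
by under eq_bigr do rewrite normc_e2pi; rewrite sumr_const.
Qed.

Lemma parseval (T : finType) (phi : T -> nat) (Q : nat) : injective phi ->
  (forall t, (phi t < Q)%N) ->
  \sum_(m < Q) normc (\sum_t e2pi (m%:R / Q%:R * (phi t)%:R)) ^+ 2 = Q%:R * #|T|%:R :> R.
Proof.
move=> inj lt.
have E : (\sum_(m < Q) normc (\sum_t e2pi (m%:R / Q%:R * (phi t)%:R)) ^+ 2)%:C =
    (Q%:R * #|T|%:R)%:C :> R[i].
  rewrite rmorph_sum /=.
  transitivity (\sum_t \sum_t' \sum_(m < Q)
      e2pi (m%:R / Q%:R * ((phi t)%:Z - (phi t')%:Z)%:~R : R)).
    rewrite (eq_bigr (fun m : 'I_Q => \sum_t \sum_t'
        e2pi (m%:R / Q%:R * ((phi t)%:Z - (phi t')%:Z)%:~R : R))).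
      by rewrite exchange_big; apply: eq_bigr => t _; rewrite exchange_big.
    move=> m _; rewrite normc_sqr rmorph_sum mulr_suml; apply: eq_bigr => t _.
    rewrite mulr_sumr; apply: eq_bigr => t' _.
    by rewrite -e2piB -mulrBr intrB -!pmulrn.
  transitivity (\sum_(t : T) \sum_(t' : T) (if t' == t then (Q%:R)%:C else 0 : R[i])).
    apply: eq_bigr => t _; apply: eq_bigr => t' _.
    rewrite orthogonality; last by have := lt t; have := lt t'; lia.
    rewrite subr_eq0 eqz_nat (inj_eq inj) (eq_sym t).
    by case: eqVneq; rewrite ?muln1 ?muln0 ?rmorph0.
  under eq_bigr do rewrite -big_mkcond big_pred1_eq.
  by rewrite sumr_const -rmorphMn mulr_natr.
by have [] := E.
Qed.

Lemma mulr_sum3 (K : comNzRingType) (I1 I2 I3 : finType) (c : K)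
    (f1 : I1 -> K) (f2 : I2 -> K) (f3 : I3 -> K) :
  c * ((\sum_i f1 i) * (\sum_i f2 i) * (\sum_i f3 i)) =
  \sum_i \sum_j \sum_k c * (f1 i * f2 j * f3 k).
Proof.
rewrite !mulr_suml mulr_sumr; apply: eq_bigr => i _.
rewrite [f1 i * _]mulr_sumr mulr_suml mulr_sumr; apply: eq_bigr => j _.
by rewrite !mulr_sumr.
Qed.

(** A circle method over the frequencies m / Q. Without solutions the sum of [A] against the
    conjugate of [U V I] vanishes, so replacing [S] by [S - L] does not change the smoothed count.
    The spectral hypothesis then bounds that count by E times the sum of |U| |V|, which Parseval
    evaluates. *)
Lemma sparse_count (T : finType) (phi psi : T -> nat) (b L X : nat) (a : nat -> int)
    (cnt E : R) :
  injective phi -> injective psi -> (0 < #|T|)%N ->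
  (forall n t t' i, (n < X)%N -> (i < b)%N -> a n <> (phi t + psi t' + i)%N) ->
  (forall t t' i, (i < b)%N ->
     cnt <= \sum_(n < X) \sum_(s < L) (a n + s%:Z == (phi t + psi t' + i)%N :> int)%:R) ->
  (forall th : R, 0 <= th < 1 ->
     normc (\sum_(n < X) e2pi (th * (a n)%:~R)) *
     normc (\sum_(s < L) e2pi (th * s%:R) - L%:R) *
     normc (\sum_(i < b) e2pi (th * i%:R)) <= E) ->
  cnt * b%:R * #|T|%:R <= E.
Proof.
move=> iphi ipsi T0 nosol Hcnt spec.
(* Larger than every difference that occurs, so that congruences modulo Q are equalities. *)
pose Q := (\sum_(n < X) `|a n| + L + \sum_t phi t + \sum_t psi t + b).+1%N.
have Q0 : (0 < Q)%N by [].
have Qr : 0 < Q%:R :> R by rewrite ltr0n.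
have phiQ t : (phi t <= \sum_t phi t)%N by rewrite (bigD1 t) //= leq_addr.
have psiQ t : (psi t <= \sum_t psi t)%N by rewrite (bigD1 t) //= leq_addr.
have aQ (n : 'I_X) : (`|a n| <= \sum_(n < X) `|a n|)%N by rewrite (bigD1 n) //= leq_addr.
pose th (m : 'I_Q) : R := m%:R / Q%:R.
have th01 m : 0 <= th m < 1.
  by rewrite /th divr_ge0 //= ltr_pdivrMr // mul1r ltr_nat.
pose A m := \sum_(n < X) e2pi (th m * (a n)%:~R).
pose S m := \sum_(s < L) e2pi (th m * s%:R).
pose I m := \sum_(i < b) e2pi (th m * i%:R).
pose U m := \sum_t e2pi (th m * (phi t)%:R).
pose V m := \sum_t e2pi (th m * (psi t)%:R).
have expand (J : finType) (f : J -> int) (m : 'I_Q) :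
    (\sum_j e2pi (th m * (f j)%:~R)) * (U m * V m * I m)^* =
    \sum_t \sum_t' \sum_(i < b) \sum_j e2pi (th m * (f j - (phi t + psi t' + i)%N%:Z)%:~R).
  rewrite !rmorphM !rmorph_sum mulr_sum3; apply: eq_bigr => t _.
  apply: eq_bigr => t' _; apply: eq_bigr => i _; rewrite mulr_suml; apply: eq_bigr => j _.
  transitivity (e2pi (th m * (f j)%:~R) * (e2pi (th m * (phi t)%:R))^* *
    (e2pi (th m * (psi t')%:R))^* * (e2pi (th m * i%:R))^*); first by ring.
  by rewrite -!e2piB; congr e2pi; rewrite intrB -pmulrn !natrD; ring.
have total (J : finType) (f : J -> int) :
    (forall j t t' i, (i < b)%N -> (`|f j - (phi t + psi t' + i)%N%:Z| < Q)%N) ->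
    \sum_(m < Q) (\sum_j e2pi (th m * (f j)%:~R)) * (U m * V m * I m)^* =
    (Q%:R * \sum_t \sum_t' \sum_(i < b) \sum_j
      (f j == (phi t + psi t' + i)%N :> int)%:R)%:C.
  move=> fQ; rewrite (eq_bigr _ (fun m _ => expand J f m)) mulr_sumr rmorph_sum exchange_big /=.
  apply: eq_bigr => t _; rewrite mulr_sumr rmorph_sum exchange_big /=.
  apply: eq_bigr => t' _; rewrite mulr_sumr rmorph_sum exchange_big /=.
  apply: eq_bigr => i _; rewrite mulr_sumr rmorph_sum exchange_big /=.
  apply: eq_bigr => j _; rewrite orthogonality ?fQ //.
  by rewrite subr_eq0 natrM.
have bound0 (n : 'I_X) t t' i : (i < b)%N -> (`|a n| + L + phi t + psi t' + i < Q)%N.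
  move=> ib; have := aQ n; have := phiQ t; have := psiQ t'; rewrite /Q; lia.
have Z0 : \sum_(m < Q) A m * (U m * V m * I m)^* = 0.
  rewrite (total 'I_X (fun n => a n)); last first.
    by move=> n t t' i ib; have := bound0 n t t' i ib; lia.
  rewrite big1 ?mulr0 ?rmorph0 // => t _; apply: big1 => t' _; apply: big1 => i _.
  by apply: big1 => n _; case: eqP => // /nosol; case.
pose N : R := \sum_t \sum_t' \sum_(i < b) \sum_(n < X) \sum_(s < L)
  (a n + s%:Z == (phi t + psi t' + i)%N :> int)%:R.
have Z1 : \sum_(m < Q) (A m * S m) * (U m * V m * I m)^* = (Q%:R * N)%:C.
  have ASE m : A m * S m = \sum_(p : 'I_X * 'I_L) e2pi (th m * (a p.1 + p.2%:Z)%:~R).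
    rewrite /A /S mulr_suml -(pair_bigA _ (fun (n : 'I_X) (s : 'I_L) => e2pi (th m * (a n + s%:Z)%:~R))) /=.
    apply: eq_bigr => n _; rewrite mulr_sumr; apply: eq_bigr => s _.
    by rewrite -e2piD intrD -pmulrn mulrDr.
  under eq_bigr do rewrite ASE.
  rewrite (total _ (fun p : 'I_X * 'I_L => a p.1 + p.2%:Z)); last first.
    move=> [n s] t t' i ib /=; have := bound0 n t t' i ib; have := ltn_ord s; lia.
  congr (_ * _)%:C; apply: eq_bigr => t _; apply: eq_bigr => t' _; apply: eq_bigr => i _.
  by rewrite -(pair_bigA _ (fun (n : 'I_X) (s : 'I_L) =>
    ((a n + s%:Z == (phi t + psi t' + i)%N :> int)%:R : R))).
have Z2 : \sum_(m < Q) A m * (S m - L%:R) * (U m * V m * I m)^* = (Q%:R * N)%:C.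
  transitivity (\sum_(m < Q) (A m * S m) * (U m * V m * I m)^* -
      \sum_(m < Q) L%:R * (A m * (U m * V m * I m)^*)).
    by rewrite -sumrB; apply: eq_bigr => m _; ring.
  by rewrite Z1 -mulr_sumr Z0 mulr0 subr0.
have N0 : 0 <= N by do 5 (apply: sumr_ge0 => ? _).
have QN : Q%:R * N <= E * (Q%:R * #|T|%:R).
  rewrite -(normc_real_ge0 (mulr_ge0 (ltW Qr) N0)) -Z2.
  apply: (le_trans (normc_le_sum _ _ _)).
  apply: (@le_trans _ _ (\sum_(m < Q) E * ((normc (U m) ^+ 2 + normc (V m) ^+ 2) / 2))).
    apply: ler_sum => m _; rewrite !normcM normc_conj !normcM.
    have := spec (th m) (th01 m); rewrite -/(A m) -/(S m) -/(I m) => sp.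
    have -> : normc (A m) * normc (S m - L%:R) * (normc (U m) * normc (V m) * normc (I m)) =
      normc (A m) * normc (S m - L%:R) * normc (I m) * (normc (U m) * normc (V m)) by ring.
    have uv : normc (U m) * normc (V m) <= (normc (U m) ^+ 2 + normc (V m) ^+ 2) / 2.
      by have := sqr_ge0 (normc (U m) - normc (V m)); lra.
    by apply: ler_pM => //; rewrite !mulr_ge0 // normc_ge0.
  rewrite -mulr_sumr -mulr_suml big_split /=.
  rewrite !parseval //; first by apply: le_of_eq; field.
    by move=> t; have := psiQ t; rewrite /Q; lia.
  by move=> t; have := phiQ t; rewrite /Q; lia.
have Nlow : cnt * b%:R * #|T|%:R * #|T|%:R <= N.
  rewrite /N [leLHS]mulr_natr -sumr_const; apply: ler_sum => t _.
  rewrite [leLHS]mulr_natr -sumr_const; apply: ler_sum => t' _.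
  rewrite -[b in b%:R]card_ord mulr_natr -sumr_const; apply: ler_sum => i _.
  exact: Hcnt.
have T0r : 0 < #|T|%:R :> R by rewrite ltr0n.
rewrite -(ler_pM2r T0r) -(ler_pM2l Qr); apply: (le_trans (ler_wpM2l (ltW Qr) Nlow)).
by apply: (le_trans QN); apply: le_of_eq; ring.
Qed.

End Counting.

(** * The three frequency ranges *)

Section Spectral.
Variable R : realType.

(** At integers th and 1 - th give conjugate values, and moduli do not see conjugation. *)
Lemma reduce_frequency (th : R) : 0 <= th < 1 ->
  exists2 tau, 0 <= tau <= 1 / 2 &
    (forall z : int, e2pi (th * z%:~R) = e2pi (tau * z%:~R)) \/
    (forall z : int, e2pi (th * z%:~R) = (e2pi (tau * z%:~R))^*).
Proof.
move=> /andP[th0 th1]; have [h|h] := leP th (1 / 2).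
  by exists th; [rewrite th0|left].
exists (1 - th); first by apply/andP; split; lra.
right=> z; rewrite -e2piN.
have -> : th * z%:~R = z%:~R + - ((1 - th) * z%:~R) by ring.
by rewrite e2piD e2pi_int mul1r.
Qed.

Lemma spectral_bound (al : nat -> R) (X L b : nat) (eta th1 K0 : R) :
  0 < eta -> (0 < L)%N -> (0 < b)%N -> 0 < th1 ->
  12 <= eta * th1 -> 64 * th1 <= eta * (3 * b)%:R ->
  (forall th, K0 <= th -> th <= th1 ->
    normc (\sum_(n < X) e2pi (th * al n)) <= eta / 4 * X%:R) ->
  K0 <= eta * (3 * b)%:R / (16 * L%:R) ->
  forall th : R, 0 <= th < 1 ->
     normc (\sum_(n < X) e2pi (th * (Num.floor ((3 * b)%:R * al n))%:~R)) *
     normc (\sum_(s < L) e2pi (th * s%:R) - L%:R) *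
     normc (\sum_(i < b) e2pi (th * i%:R)) <= eta * X%:R * L%:R * b%:R.
Proof.
move=> eta0 L0 b0 th10 h12 h64 weyl hK th /reduce_frequency[tau /andP[tau0 tau1] E].
set B := (3 * b)%:R; pose a n := Num.floor (B * al n).
have Lr : 0 < L%:R :> R by rewrite ltr0n.
have br : 0 < b%:R :> R by rewrite ltr0n.
have BE : B = 3 * b%:R by rewrite /B natrM.
have B0 : 0 < B by rewrite BE mulr_gt0.
have [-> -> ->] : [/\
    normc (\sum_(n < X) e2pi (th * (a n)%:~R)) = normc (\sum_(n < X) e2pi (tau * (a n)%:~R)),
    normc (\sum_(s < L) e2pi (th * s%:R) - L%:R) = normc (\sum_(s < L) e2pi (tau * s%:R) - L%:R) &
    normc (\sum_(i < b) e2pi (th * i%:R)) = normc (\sum_(i < b) e2pi (tau * i%:R))].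
  case: E => E.
    split; congr normc; [|congr (_ - _)|]; apply: eq_bigr => j _; first exact: E.
      by have := E j%:Z; rewrite -pmulrn.
    by have := E j%:Z; rewrite -pmulrn.
  have E' (j : nat) : e2pi (th * j%:R) = (e2pi (tau * j%:R))^*.
    by have := E j%:Z; rewrite -pmulrn.
  split; rewrite -[RHS]normc_conj; congr normc; rewrite ?rmorphB ?rmorph_sum.
  - by apply: eq_bigr => j _; exact: E.
  - congr (_ - _); last by rewrite rmorph_nat.
    by apply: eq_bigr => j _; exact: E'.
  - by apply: eq_bigr => j _; exact: E'.
set nA := normc (\sum_(n < X) _); set nS := normc (_ - _); set nI := normc (\sum_(i < b) _).
have nA0 : 0 <= nA by exact: normc_ge0.
have nS0 : 0 <= nS by exact: normc_ge0.
have nI0 : 0 <= nI by exact: normc_ge0.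
have X0 : 0 <= X%:R :> R by [].
have nAX : nA <= X%:R.
  by have := normc_sum_e2pi_le (fun n : 'I_X => tau * (a n)%:~R); rewrite card_ord.
have nIb : nI <= b%:R.
  by have := normc_sum_e2pi_le (fun n : 'I_b => tau * n%:R); rewrite card_ord.
have nSL : nS <= 2 * L%:R.
  apply: (le_trans (le_normcB _ _)).
  have := normc_sum_e2pi_le (fun n : 'I_L => tau * n%:R); rewrite card_ord.
  have -> : normc (L%:R : R[i]) = L%:R.
    by rewrite -(rmorph_nat (real_complex R)) normc_real_ge0.
  by lra.
have combine (u v w : R) : nA <= u -> nS <= v -> nI <= w -> nA * nS * nI <= u * v * w.
  by move=> h1 h2 h3; apply: ler_pM => //; [rewrite mulr_ge0|apply: ler_pM].
(* Lowest range: e(tau s) stays near 1 for s < L, so the smoothing factor is close to L. *)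
have [t1|t1] := leP (tau * (16 * L%:R)) eta.
  have hS : nS <= eta * L%:R.
    have -> : nS = normc (\sum_(s < L) (e2pi (tau * s%:R) - 1)).
      by rewrite /nS sumrB sumr_const card_ord.
    apply: (le_trans (normc_le_sum _ _ _)).
    rewrite -[L in leRHS]card_ord mulr_natr -sumr_const; apply: ler_sum => s _.
    rewrite -(e2pi0 R); apply: (le_trans (normc_e2piB _ _)).
    rewrite subr0 normrM !ger0_norm //; apply: le_trans t1.
    rewrite mulrCA ler_wpM2l // ler_wpM2l // ler_nat; exact: ltnW.
  by apply: (le_trans (combine _ _ _ nAX hS nIb)); apply: le_of_eq; ring.
(* Middle range: alpha is met at frequency tau B, in reach of the Weyl estimate, and floor costs at
   most 16 tau <= eta / 4 per term. *)
have [t2|t2] := leP (tau * B) th1.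
  have hA : nA <= eta / 2 * X%:R.
    pose d n := e2pi (tau * (a n)%:~R) - e2pi (tau * B * al n).
    have -> : nA = normc (\sum_(n < X) e2pi (tau * B * al n) + \sum_(n < X) d n).
      by rewrite /nA -big_split /=; congr normc; apply: eq_bigr => n _; rewrite addrC subrK.
    apply: (le_trans (le_normcD _ _)).
    have h1 : normc (\sum_(n < X) e2pi (tau * B * al n)) <= eta / 4 * X%:R.
      apply: weyl => //; apply: (le_trans hK).
      rewrite ler_pdivrMr ?mulr_gt0 // mulrAC ler_wpM2r ?(ltW B0) //.
      exact: ltW.
    have h2 : normc (\sum_(n < X) d n) <= eta / 4 * X%:R.
      apply: (le_trans (normc_le_sum _ _ _)).
      rewrite -[X in leRHS]card_ord mulr_natr -sumr_const; apply: ler_sum => n _.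
      apply: (le_trans (normc_e2piB _ _)).
      have -> : tau * (a n)%:~R - tau * B * al n = tau * ((a n)%:~R - B * al n) by ring.
      rewrite normrM (ger0_norm tau0).
      have hf : `|(a n)%:~R - B * al n| <= 1.
        have /andP[f1 f2] := floor_itv (B * al n).
        rewrite /a distrC ger0_norm ?subr_ge0 //.
        by move: f2; rewrite intrD => /ltW; lra.
      have h3 : tau * B * 64 <= eta * B.
        by apply: le_trans h64; rewrite mulrC ler_wpM2l.
      rewrite mulrAC ler_pM2r // in h3.
      have h4 : tau * `|(a n)%:~R - B * al n| <= tau by rewrite ler_piMr.
      by lra.
    by lra.
  by apply: (le_trans (combine _ _ _ hA nSL nIb)); apply: le_of_eq; field.
(* Top range: the geometric sum is at most 2 / tau, and tau > th1 / (3 b). *)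
have hI : nI <= eta / 2 * b%:R.
  have tn : `|tau| <= 1 / 2 by rewrite ger0_norm.
  have h1 := e2pi_lower tn; rewrite (ger0_norm tau0) in h1.
  have h2 := geometric_bound tau b; rewrite -/nI in h2.
  have h3 : nI * tau <= 2 by apply: le_trans h2; rewrite ler_wpM2l.
  have h4 : nI * th1 <= 6 * b%:R.
    apply: (@le_trans _ _ (nI * (tau * B))); first by rewrite ler_wpM2l // ltW.
    by rewrite mulrA BE; have := ler_wpM2r (ltW br) h3; lra.
  have h5 : nI * 12 <= nI * (eta * th1) by rewrite ler_wpM2l.
  have h6 : eta * (nI * th1) <= eta * (6 * b%:R) by rewrite ler_wpM2l // ltW.
  by lra.
by apply: (le_trans (combine _ _ _ nAX nSL hI)); apply: le_of_eq; field.
Qed.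

End Spectral.

(** * Gaps of alpha and visits to an interval *)

Section Gaps.
Variable R : realType.
Implicit Types (a : nat -> R -> R).

(** If a_1 decreases, it still lies between its lower bound c and its value at M, whence the factor
    a_1(M) / c. *)
Lemma almost_increasing_derive a D : growth_profile a D -> (0 < D)%N ->
  exists2 E, 0 < E & evt (fun u => forall y x, u <= y -> y <= x -> a 1%N y <= E * a 1%N x).
Proof.
move=> pr D0; have [c c0 hc] := profile_lower pr D0.
have ch : evt (fun x => is_derive x 1 (a 1%N) (a 2%N x)).
  by apply: evt_mono (profile_chain pr 2) => x ch; apply: ch.
case: (trich_nge (profile_trich pr 2)) => s.
  exists 1; first exact: ltr01.
  have [M hM] := evt_and ch s; exists M => u Mu y x uy yx; rewrite mul1r.
  apply: (@nondecr_of_derive R (a 1%N) (a 2%N) M) => //; last exact: le_trans uy.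
    by move=> z /hM[].
  by move=> z /hM[].
have [M hM] := evt_and (evt_and ch s) hc.
have B0 := (hM M (lexx M)).2.
have E0 : 0 < a 1%N M / c by rewrite divr_gt0 // (lt_le_trans c0).
exists (a 1%N M / c) => //; exists M => u Mu y x uy yx.
have h1 : a 1%N y <= a 1%N M.
  apply: (@nonincr_of_derive R (a 1%N) (a 2%N) M) => //; last exact: le_trans uy.
    by move=> z /hM[[]].
  by move=> z /hM[[]].
apply: (le_trans h1); rewrite -mulrA -ler_pdivrMl ?(lt_le_trans c0) //.
rewrite mulVf ?gt_eqF ?(lt_le_trans c0) // ler_pdivlMl // mulr1.
by have [] := hM x (le_trans Mu (le_trans uy yx)).
Qed.

(** The mean value theorem on [x / 2, x], where a_1 is comparable to a_1(x) and a_0 is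
    nonnegative. *)
Lemma derive_ratio a D : growth_profile a D -> (0 < D)%N ->
  exists2 C, 0 < C & evt (fun x => a 1%N x * x <= C * a 0%N x).
Proof.
move=> pr D0; have h2 : 0 < 1 / 2 :> R by lra.
have [|C C1 hC] := profile_comparable pr D0 h2; first by lra.
exists (2 * C); first by lra.
have ch : evt (fun x => is_derive x 1 (a 0%N) (a 1%N x)).
  by apply: evt_mono (profile_chain pr 1) => x ch; apply: ch.
have hh := evt_scale h2 (evt_and (evt_tail ch) (profile_unbounded pr 0)).
have := evt_and (evt_and hC hh) (evt_ge 1); apply: evt_mono => x [[K [c pos]] x1].
have [||y /andP[y1 y2] E] := @mean_value R (a 0%N) (a 1%N) (1 / 2 * x) x.
- lra.
- by move=> z /andP[z1 z2]; exact: c.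
have [|_ _ k] := K y; first by apply/andP; split; lra.
have : a 1%N x * x <= C * a 1%N y * x by rewrite ler_wpM2r //; lra.
have -> : C * a 1%N y * x = 2 * C * (a 1%N y * (x - 1 / 2 * x)) by field.
move=> h; apply: (le_trans h); rewrite -E ler_wpM2l ?gerBl //; lra.
Qed.

Lemma gap_bound a D : growth_profile a D -> (0 < D)%N ->
  exists2 C, 0 < C & exists n0 : nat, forall n X : nat, (n0 <= n)%N -> (n < X)%N ->
  a 0%N n%:R <= a 0%N n.+1%:R /\
  (a 0%N n.+1%:R - a 0%N n%:R) * X%:R <= C * a 0%N X%:R.
Proof.
move=> pr D0; have [E E0 hE] := almost_increasing_derive pr D0.
have [C C0 hC] := derive_ratio pr D0; have [c c0 hc] := profile_lower pr D0.
have ch : evt (fun x => is_derive x 1 (a 0%N) (a 1%N x)).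
  by apply: evt_mono (profile_chain pr 1) => x ch; apply: ch.
exists (E * C); first exact: mulr_gt0.
have [n0 hn0] := evt_nat (evt_and (evt_tail (evt_and hc ch)) (evt_and hE (evt_tail hC))).
exists n0 => n X n0n nX; have [k1 [k2 k3]] := hn0 n n0n.
have n1 : (n%:R : R) <= n.+1%:R by rewrite ler_nat.
have nX' : (n.+1%:R : R) <= X%:R by rewrite ler_nat.
have [|y /andP[y1 y2] F] := @mean_value R (a 0%N) (a 1%N) n%:R n.+1%:R n1.
  by move=> z /andP[z1 _]; exact: (k1 z z1).2.
have G : a 0%N n.+1%:R - a 0%N n%:R = a 1%N y by rewrite F -natr1 addrAC subrr add0r mulr1.
have := (k1 y y1).1 => ay; split; first by rewrite -subr_ge0 G (le_trans (ltW c0)).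
rewrite G; have h1 := k2 y X%:R y1 (le_trans y2 nX').
apply: (@le_trans _ _ (E * a 1%N X%:R * X%:R)); first by rewrite ler_wpM2r.
by rewrite -!mulrA ler_wpM2l ?(ltW E0) //; apply: k3; rewrite ler_nat ltnW.
Qed.

(** B al moves up by at most B g per step, so it needs at least cnt steps to cross an interval of
    length L; each visit yields one s with floor + s = z. *)
Lemma window_count (al : nat -> R) (B g : R) (n0 X L cnt : nat) (z : int) :
  0 < B -> (n0 <= X)%N -> (forall n, (n0 <= n)%N -> (n < X)%N -> al n <= al n.+1 /\ al n.+1 - al n <= g) ->
  B * al n0 < z%:~R - L%:R + 1 -> z%:~R + 1 <= B * al X -> cnt%:R * (B * g) <= L%:R ->
  (cnt%:R : R) <= \sum_(n < X) \sum_(s < L) (Num.floor (B * al n) + s%:Z == z)%:R.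
Proof.
move=> B0 n0X gap lo hi hcnt.
have mon n m : (n0 <= n)%N -> (n <= m)%N -> (m <= X)%N -> al n <= al m.
  move=> n0n; elim: m => [|m IH]; first by rewrite leqn0 => /eqP ->.
  rewrite leq_eqVlt => /orP[/eqP -> //|nm mX].
  have mX' := ltnW mX; rewrite ltnS in nm.
  exact: le_trans (IH nm mX') (gap m (leq_trans n0n nm) mX).1.
case: cnt hcnt => [|cnt] hcnt.
  by rewrite sumr_ge0 // => n _; rewrite sumr_ge0.
have g0B : 0 <= g.
  have n0X' : (n0 < X)%N.
    rewrite ltn_neqAle n0X andbT; apply/eqP => E; move: lo hi; rewrite E.
    have : 0 <= L%:R :> R by []. lra.
  by have [h1 h2] := gap n0 (leqnn _) n0X'; lra.
have Bg : 0 <= B * g by rewrite mulr_ge0 // ltW.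
have ex : exists n, (n0 <= n)%N && (z%:~R - L%:R + 1 <= B * al n).
  by exists X; rewrite n0X /=; have : 0 <= L%:R :> R by []; lra.
(* [n1] is the index of entry into [z - L + 1, z + 1). *)
case: (ex_minnP ex) => n1 /andP[n01 hn1] minn1.
have n0n1 : (n0 < n1)%N.
  by rewrite ltn_neqAle n01 andbT; apply/eqP => E; move: lo hn1; rewrite E; lra.
have n1X : (n1 <= X)%N by apply: minn1; rewrite n0X /=; have : 0 <= L%:R :> R by []; lra.
have lo1 : B * al n1.-1 < z%:~R - L%:R + 1.
  rewrite ltNge; apply/negP => h.
  have : (n1 <= n1.-1)%N by apply: minn1; rewrite h andbT -ltnS prednK // (leq_trans _ n0n1).
  by move: n0n1; clear; lia.
have step i : (i <= cnt)%N -> (n1 + i < X)%N /\ B * al (n1 + i)%N < z%:~R - L%:R + 1 + i.+1%:R * (B * g).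
  have key n : (n0 <= n)%N -> (n < X)%N -> B * al n.+1 <= B * al n + B * g.
    by move=> a1 a2; have [_ h] := gap n a1 a2; rewrite -mulrDr ler_wpM2l ?(ltW B0) //; lra.
  have inX m (i0 : nat) : (i0 <= cnt)%N -> (m <= X)%N -> B * al m < z%:~R - L%:R + 1 + i0.+1%:R * (B * g) -> (m < X)%N.
    move=> ic mX h; rewrite ltn_neqAle mX andbT; apply/eqP => E; move: hi; rewrite -E.
    have : i0.+1%:R * (B * g) <= cnt.+1%:R * (B * g) by rewrite ler_wpM2r // ler_nat.
    by lra.
  elim: i => [|i IH] ic.
    have h : B * al n1 < z%:~R - L%:R + 1 + 1%:R * (B * g).
      have := key n1.-1; rewrite prednK ?(leq_trans _ n0n1) //.
      have a1 : (n0 <= n1.-1)%N by rewrite -ltnS prednK // (leq_trans _ n0n1).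
      by move=> /(_ a1 n1X); rewrite mul1r; lra.
    by rewrite addn0; split=> //; exact: (inX _ 0%N).
  have [h1 h2] := IH (ltnW ic).
  have h : B * al (n1 + i.+1)%N < z%:~R - L%:R + 1 + i.+2%:R * (B * g).
    have := key (n1 + i)%N (leq_trans n01 (leq_addr _ _)) h1.
    by rewrite addnS -[i.+2%:R]natr1 mulrDl mul1r; lra.
  by split=> //; apply: (inX _ i.+1) => //; rewrite addnS.
have hit i : (i <= cnt)%N ->
    1 <= \sum_(s < L) (Num.floor (B * al (n1 + i)%N) + s%:Z == z)%:R :> R.
  move=> ic; have [h1 h2] := step i ic.
  have h3 : z%:~R - L%:R + 1 <= B * al (n1 + i)%N.
    by apply: (le_trans hn1); rewrite ler_wpM2l ?(ltW B0) // mon // ?leq_addr // ltnW.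
  have h4 : i.+1%:R * (B * g) <= cnt.+1%:R * (B * g) by rewrite ler_wpM2r // ler_nat.
  have f1 : (Num.floor (B * al (n1 + i)%N) < z + 1)%R.
    by rewrite floor_lt_int intrD; lra.
  have f2 : (z - L%:Z + 1 <= Num.floor (B * al (n1 + i)%N))%R.
    by rewrite floor_ge_int intrD intrB.
  have sL : (`|z - Num.floor (B * al (n1 + i)%N)| < L)%N by move: f1 f2; clear; lia.
  rewrite (bigD1 (Ordinal sL)) //= ler_wpDr ?sumr_ge0 //.
  by rewrite (_ : _ == z) //; apply/eqP; move: f1 f2; clear; lia.
have X1 : (n1 + cnt < X)%N by have [] := step cnt (leqnn _).
rewrite -(big_mkord xpredT (fun n => \sum_(s < L) (Num.floor (B * al n) + s%:Z == z)%:R)).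
rewrite (big_cat_nat _ n1X) //= ler_wpDl ?sumr_ge0 // => [n _|]; first by rewrite sumr_ge0.
have X2 : (n1 + cnt.+1 <= X)%N by rewrite addnS.
rewrite (big_cat_nat _ X2) ?leq_addr //= ler_wpDr ?sumr_ge0 // => [n _|]; first by rewrite sumr_ge0.
rewrite -{1}[n1]addn0 addnC big_addn addKn big_mkord.
rewrite -[cnt.+1 in X in X <= _]card_ord -sumr_const; apply: ler_sum => i _.
by rewrite addnC; apply: hit; rewrite -ltnS.
Qed.
End Gaps.

(** * Scales at which A is dense *)

Section Density.
Variable R : realType.

(** Any del strictly below the upper limit must be exceeded at arbitrarily large N. *)
Lemma dense_scales (A : set nat) : (0 < upper_density R A)%E ->
  exists2 del : R, 0 < del & forall N0 : nat, exists2 N, (N0 <= N)%N &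
    del * N%:R <= (#|` fset_set (A `&` [set n | (1 <= n <= N)%N])|%:R : R).
Proof.
rewrite /upper_density; set u := (fun N : nat => _) => hpos.
have [del del0 hdel] : exists2 del : R, 0 < del & (del%:E < limn_esup u)%E.
  move: hpos; case: (limn_esup u) => [r||] //.
    by rewrite lte_fin => r0; exists (r / 2); [lra|rewrite lte_fin; lra].
  by exists 1; rewrite ?ltry.
exists del => // N0; apply: contrapT => none.
have small N : (N0 <= N)%N -> (u N <= del%:E)%E.
  move=> NN; rewrite /u lee_fin.
  (* At N = 0 the quotient is 0 by convention, which lies below del. *)
  have [->|N1] := posnP N; first by rewrite invr0 mulr0 ltW.
  rewrite ler_pdivrMr ?ltr0n // leNgt; apply/negP => h; apply: none; exists N => //.
  exact: ltW.
move: hdel; rewrite ltNge => /negP; apply; rewrite limn_esup_lim.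
apply: lime_le; first exact: is_cvg_esups.
exists N0 => //= n Nn; apply: ge_ereal_sup => _ [m /= nm <-].
by apply: small; exact: leq_trans nm.
Qed.

(** Small elements are discarded so that all targets k x + l y lie where alpha is already
    monotone. *)
Lemma truncated_count (A : set nat) (N c : nat) :
  (#|` fset_set (A `&` [set n | (1 <= n <= N)%N])| <=
   #|[set x : 'I_N.+1 | (val x \in A) && (c < x)%N]%SET| + c)%N.
Proof.
set S := fset_set _; set P := [set x | _]%SET.
have fin : finite_set (A `&` [set n | (1 <= n <= N)%N]).
  apply: (sub_finite_set _ (finite_II N.+1)) => n /= [_ /andP[_]].
  by rewrite ltnS.
rewrite -[X in (_ + X)%N](size_iota 1) cardE -(size_map val) -size_cat.
apply: uniq_leq_size; first exact: fset_uniq.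
move=> x; rewrite (in_fset_set fin) inE /= => -[Ax /andP[x1 xN]].
rewrite mem_cat mem_iota; have [cx|xc] := ltnP c x; last by rewrite x1 add1n ltnS xc orbT.
have xN' : (x < N.+1)%N by [].
apply/orP; left; apply/mapP; exists (Ordinal xN') => //.
by rewrite mem_enum inE /= cx andbT; apply/mem_set.
Qed.
End Density.

(** * From exponential sums to a solution at one scale *)

Section Solutions.
Variable R : realType.

Lemma floor_of_scaled (B w r : nat) (x : R) : (r < B)%N ->
  Num.floor (B%:R * x) = (B * w + r)%N -> Num.floor x = w.
Proof.
move=> rB E; have B0 : 0 < B%:R :> R by rewrite ltr0n (leq_ltn_trans _ rB).
have h1 := floor_le (B%:R * x); have h2 := floorD1_gt (B%:R * x).
rewrite E intrD -!pmulrn natrD natrM in h1 h2.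
have r0 : 0 <= r%:R :> R by []. 
have r1 : r%:R + 1 <= B%:R :> R by rewrite natr1 ler_nat.
apply: floor_def; rewrite intrD -!pmulrn; apply/andP; split.
  by rewrite -(ler_pM2l B0); lra.
by rewrite -(ltr_pM2l B0); lra.
Qed.

(** A pair (x, i) of [T] stands for B k x + i or B l x + i. One factor [#|T| = #|P| * b] survives in
    [sparse_count], so the powers of b cancel and [#|P|] is compared with eta g X alone. *)
Lemma hit_at_scale (al : nat -> R) (N : nat) (P : {set 'I_N.+1}) (k l b X L n0 c : nat)
    (eta g : R) :
  (0 < k)%N -> (0 < l)%N -> (0 < b)%N -> (0 < L)%N -> 0 < g -> (0 < #|P|)%N ->
  (forall x, x \in P -> (c < x)%N) -> (n0 <= X)%N ->
  (forall n, (n0 <= n)%N -> (n < X)%N -> al n <= al n.+1 /\ al n.+1 - al n <= g) ->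
  (3 * b)%:R * al n0 < (3 * b)%:R * c.+1%:R - L%:R + 1 ->
  ((k + l) * N).+1%:R <= al X -> 2 <= L%:R / ((3 * b)%:R * g) ->
  (forall th : R, 0 <= th < 1 ->
     normc (\sum_(n < X) e2pi (th * (Num.floor ((3 * b)%:R * al n))%:~R)) *
     normc (\sum_(s < L) e2pi (th * s%:R) - L%:R) *
     normc (\sum_(i < b) e2pi (th * i%:R)) <= eta * X%:R * L%:R * b%:R) ->
  6 * eta * g * X%:R < #|P|%:R ->
  exists x y n, [/\ x \in P, y \in P, (n < X)%N & (k * x + l * y)%N%:Z = Num.floor (al n)].
Proof.
move=> k0 l0 b0 L0 g0 P0 cP n0X gap lo hi big spec dense; apply: contrapT => none.
have b0' : 0 < b%:R :> R by rewrite ltr0n.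
have L0' : 0 < L%:R :> R by rewrite ltr0n.
pose T : finType := ({x | x \in P} * 'I_b)%type.
pose phi (m : nat) (t : T) := ((3 * b) * (m * val (val t.1)) + t.2)%N.
have iphi m : (0 < m)%N -> injective (phi m).
  move=> m0 [[x Px] i] [[y Py] j]; rewrite /phi /= => E.
  have xy : x = y :> nat.
    have := congr1 (fun n => n %/ (3 * b))%N E.
    rewrite ![(3 * b * _)%N]mulnC !divnMDl ?muln_gt0 //.
    rewrite !divn_small ?addn0; try by rewrite (leq_trans (ltn_ord _)) // leq_pmull.
    by move/eqP; rewrite eqn_pmul2l // => /eqP.
  have ij : i = j by apply/val_inj; move: E; rewrite xy => /addnI.
  have xy' : x = y by exact: val_inj.
  by subst y; rewrite ij; congr (_, _); apply: val_inj.
have cardT : #|T| = (#|P| * b)%N by rewrite card_prod card_sig card_ord.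
have zE t t' i : (phi k t + phi l t' + i)%N =
    (3 * b * (k * val (val t.1) + l * val (val t'.1)) + (t.2 + t'.2 + i))%N.
  by rewrite /phi; ring.
(* Three digits below b sum to less than B = 3 b, so no carry reaches the multiple of B. *)
have rb (t t' : T) i : (i < b)%N -> ((t.2 + t'.2 + i).+2 < 3 * b)%N.
  by move: (ltn_ord t.2) (ltn_ord t'.2); clear; lia.
pose cnt := Num.truncn (L%:R / ((3 * b)%:R * g)).
have /andP[cnt1 cnt2] := truncn_half big.
have Bg : 0 < (3 * b)%:R * g by rewrite mulr_gt0 // ltr0n muln_gt0.
(* The 6 of the density hypothesis is 3 from B = 3 b times 2 from rounding [cnt]. *)
suff : cnt%:R * b%:R * #|T|%:R <= eta * X%:R * L%:R * b%:R.
  apply/negP; rewrite -ltNge cardT.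
  apply: (@lt_le_trans _ _ (L%:R / ((3 * b)%:R * g) / 2 * b%:R * (#|P| * b)%:R)); last first.
    by rewrite !ler_wpM2r.
  have -> : L%:R / ((3 * b)%:R * g) / 2 * b%:R * (#|P| * b)%:R = L%:R * b%:R / (6 * g) * #|P|%:R :> R.
    by rewrite !natrM; field; rewrite !gt_eqF.
  have -> : eta * X%:R * L%:R * b%:R = L%:R * b%:R / (6 * g) * (6 * eta * g * X%:R).
    by field; rewrite !gt_eqF.
  by rewrite ltr_pM2l // divr_gt0 ?mulr_gt0.
apply: (@sparse_count R T (phi k) (phi l) b L X (fun n => Num.floor ((3 * b)%:R * al n))) => //.
- exact: iphi.
- exact: iphi.
- by rewrite cardT muln_gt0 P0.
- move=> n t t' i nX ib; rewrite zE => /floor_of_scaled E.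
  apply: none; exists (val t.1), (val t'.1), n; split=> //.
  + exact: valP t.1.
  + exact: valP t'.1.
  + by rewrite E // ltnW // ltnW // rb.
move=> t t' i ib; apply: (@window_count R al (3 * b)%:R g n0) => //.
- by rewrite ltr0n muln_gt0.
- apply: (lt_le_trans lo); rewrite -pmulrn lerD2r lerD2r -natrM ler_nat zE.
  apply: leq_trans (leq_addr _ _); rewrite leq_mul2l; apply/orP; right.
  have := cP _ (valP t.1); move=> h; apply: (leq_trans h).
  by apply: leq_trans (leq_addr _ _); rewrite leq_pmull.
- apply: (@le_trans _ _ ((3 * b)%:R * ((k + l) * N).+1%:R)); last by rewrite ler_wpM2l.
  rewrite -pmulrn -natrM natr1 ler_nat zE.
  have h1 : (k * val (val t.1) <= k * N)%N by rewrite leq_mul2l -ltnS ltn_ord orbT.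
  have h2 : (l * val (val t'.1) <= l * N)%N by rewrite leq_mul2l -ltnS ltn_ord orbT.
  have h3 := rb t t' i ib.
  apply: (@leq_trans (3 * b * ((k + l) * N) + 3 * b)); last by rewrite mulnS addnC.
  have : (3 * b * (k * val (val t.1) + l * val (val t'.1)) <= 3 * b * ((k + l) * N))%N.
    by rewrite leq_mul2l mulnDl leq_add ?orbT.
  by move=> h; rewrite -addnS leq_add // ltnW // ltnW.
- by rewrite -ler_pdivlMr.
Qed.

(** At the least X with al X >= T the last gap is at most Cg al X / X <= al X / 2, so al X is at
    most twice the preceding value, itself below T. *)
Lemma first_crossing (al : nat -> R) (Cg : R) (n1 : nat) (T : R) :
  (forall n X, (n1 <= n)%N -> (n < X)%N -> (al n.+1 - al n) * X%:R <= Cg * al X) ->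
  2 * Cg <= n1%:R -> 0 < n1%:R :> R -> 0 < T -> al n1 < T -> (exists X, (n1 <= X)%N /\ T <= al X) ->
  exists X, [/\ (n1 < X)%N, T <= al X & al X <= 2 * T].
Proof.
move=> gap hn1 n10 T0 lo [X0 [nX0 hX0]].
have ex : exists X, (n1 <= X)%N && (T <= al X) by exists X0; rewrite nX0.
case: (ex_minnP ex) => X /andP[nX hX] minX; exists X.
have X1 : (n1 < X)%N.
  by rewrite ltn_neqAle nX andbT; apply/eqP => E; move: lo; rewrite E; move: hX; lra.
split=> //; case: X nX hX minX X1 => // X nX hX minX X1.
have lo' : al X < T.
  rewrite ltNge; apply/negP => h; have := minX X; rewrite h andbT -ltnS => /(_ X1).
  by rewrite ltnn.
have h := gap X X.+1 X1 (ltnSn X).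
have Xr : 0 < X.+1%:R :> R by [].
have a0 : 0 < al X.+1 by exact: lt_le_trans hX.
have h2 : 2 * (Cg * al X.+1) <= X.+1%:R * al X.+1.
  rewrite mulrA ler_wpM2r ?(ltW a0) // (le_trans hn1) // ler_nat; exact: ltnW.
have : 2 * (al X.+1 - al X) <= al X.+1.
  rewrite -(ler_pM2r Xr); move: h h2; clear; lra.
by lra.
Qed.
End Solutions.

(** * Choice of parameters and the slow case *)

Section FromWeylSums.
Variable R : realType.

Lemma nat_above (x : R) : exists n : nat, x < n%:R.
Proof. by exists (Num.truncn x).+1; exact: truncnS_gt. Qed.

Lemma sumset_hit (A : set nat) (al : nat -> R) (k l n0 : nat) (Cg : R) :
  (0 < k)%N -> (0 < l)%N -> (0 < upper_density R A)%E ->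
  (forall C : R, exists n1 : nat, forall n, (n1 <= n)%N -> C <= al n) ->
  0 < Cg ->
  (forall n X, (n0 <= n)%N -> (n < X)%N ->
     al n <= al n.+1 /\ (al n.+1 - al n) * X%:R <= Cg * al X) ->
  (forall eta th1 : R, 0 < eta -> 0 < th1 ->
     exists2 K, 0 < K & exists X0 : nat, forall (X : nat) (th : R), (X0 <= X)%N ->
       K <= th * al X -> th <= th1 -> normc (\sum_(n < X) e2pi (th * al n)) <= eta * X%:R) ->
  exists x y n, [/\ A x, A y, (0 < n)%N & (k * x + l * y)%N%:Z = Num.floor (al n)].
Proof.
move=> k0 l0 /dense_scales[del del0 scales] unb Cg0 gap weyl.
have [m mE] : exists m : R, m = (k + l)%:R + 1 by exists ((k + l)%:R + 1).
have m0 : 0 < m by rewrite mE ltr_wpDl.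
(* With this eta the Fourier error is a fraction of the expected number of solutions. *)
have [eta etaE] : exists eta, eta = del / (48 * Cg * m) by exists (del / (48 * Cg * m)).
have eta0 : 0 < eta by rewrite etaE divr_gt0 ?mulr_gt0.
have [th1 th1E] : exists th1, th1 = 12 / eta by exists (12 / eta).
have th10 : 0 < th1 by rewrite th1E divr_gt0.
have [[|b] hb] := nat_above (64 * th1 / eta).
  have : 0 < 64 * th1 / eta by rewrite divr_gt0 // mulr_gt0.
  by move: hb => /lt_trans h /h; rewrite ltxx.
pose B : R := (3 * b.+1)%:R; have B0 : 0 < B by rewrite /B.
have hB : 64 * th1 <= eta * B.
  by rewrite -ler_pdivrMl // mulrC (le_trans (ltW hb)) // /B ler_nat leq_pmull.
have [K K0 [X0 hK]] := weyl (eta / 4) th1 (divr_gt0 eta0 (ltr0Sn _ _)) th10.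
(* With L about lam N, the first bound keeps L well below the smallest target, and the second makes
   the lowest frequency range reach up to the start K / al X of the Weyl range. *)
pose lam := Num.min (B * del / 16) (eta * B / (16 * K)).
have lam0 : 0 < lam by rewrite lt_min !divr_gt0 ?mulr_gt0.
have lam1 : lam <= B * del / 16 by rewrite /lam ge_min lexx.
have lam2 : lam <= eta * B / (16 * K) by rewrite /lam ge_min lexx orbT.
(* The first term is for [first_crossing]; the second makes X so large that a gap B g is at most L /
   2. *)
have [v hv] := nat_above (2 * Cg + 8 * B * Cg * m / lam).
have V0 : 0 < 8 * B * Cg * m / lam by rewrite divr_gt0 // !mulr_gt0.
pose n1 := maxn n0 (maxn X0 v).
have n1v : (v%:R : R) <= n1%:R by rewrite ler_nat !leq_max leqnn !orbT.
have [w hw] := nat_above (`|al n1| + 4 * (`|al n0| + `|al 0%N|) / del + 2 / lam).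
have [N wN hN] := scales w.
have wN' : (w%:R : R) <= N%:R by rewrite ler_nat.
have [N1 N2 N3 N4] : [/\ `|al n1| < N%:R, 4 * `|al n0| < del * N%:R,
    4 * `|al 0%N| < del * N%:R & 2 <= lam * N%:R].
  have p1 : 0 <= `|al n1| by []. have p2 : 0 <= 2 / lam by rewrite divr_ge0 // ltW.
  have p3 : 0 <= 4 * `|al n0| / del by rewrite divr_ge0 ?mulr_ge0 // ltW.
  have p4 : 0 <= 4 * `|al 0%N| / del by rewrite divr_ge0 ?mulr_ge0 // ltW.
  have s : 4 * (`|al n0| + `|al 0%N|) / del = 4 * `|al n0| / del + 4 * `|al 0%N| / del.
    by rewrite mulrDr mulrDl.
  rewrite s in hw; split; first by move: p2 p3 p4 hw wN'; clear; lra.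
  - by rewrite -ltr_pdivrMl // mulrC; move: p1 p2 p3 p4 hw wN'; clear; lra.
  - by rewrite -ltr_pdivrMl // mulrC; move: p1 p2 p3 p4 hw wN'; clear; lra.
  - by rewrite -ler_pdivrMl // mulrC; move: p1 p3 p4 hw wN'; clear; lra.
have Np : 0 < N%:R :> R by rewrite (le_lt_trans _ N1).
have N1' : 1 <= N%:R :> R by rewrite ler1n -(ltr0n R).
have delN : 0 < del * N%:R by rewrite mulr_gt0.
(* At most half of the guaranteed count is discarded, and the elements kept exceed a fixed
   proportion of N. *)
pose c := Num.truncn (del * N%:R / 2).
have /andP[c1 c2] : c%:R <= del * N%:R / 2 < c.+1%:R by rewrite truncn_itv // divr_ge0 // ltW.
pose P := [set x : 'I_N.+1 | (val x \in A) && (c < x)%N]%SET.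
have hP : del * N%:R / 2 <= #|P|%:R.
  have := truncated_count A N c; rewrite -(ler_nat R) natrD -/P; move: hN c1; clear; lra.
pose T : R := ((k + l) * N).+1%:R.
have TE : T = (m - 1) * N%:R + 1 by rewrite /T -natr1 natrM mE addrK.
have kl1 : 1 <= (k + l)%:R :> R by rewrite ler1n addn_gt0 k0.
have T1 : N%:R < T.
  by rewrite TE mE addrK; have := ler_wpM2r (ltW Np) kl1; clear; lra.
have T2 : T <= m * N%:R by rewrite TE mulrBl mul1r; move: N1'; clear; lra.
have n0n1 : (n0 <= n1)%N by rewrite leq_max leqnn.
have [||||||X [X1 X2 X3]] := @first_crossing R al Cg n1 T.
- by move=> n X h1 h2; exact: (gap n X (leq_trans n0n1 h1) h2).2.
- by move: V0 hv n1v; clear; lra.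
- by move: Cg0 V0 hv n1v; clear; lra.
- exact: lt_trans T1.
- exact: le_lt_trans (ler_norm _) (lt_trans N1 T1).
- have [u hu] := unb T; exists (maxn u n1); split; first by rewrite leq_maxr.
  by apply: hu; rewrite leq_maxl.
have Xp : 0 < X%:R :> R by rewrite ltr0n (leq_ltn_trans _ X1).
have aX0 : 0 < al X by apply: lt_le_trans X2; exact: lt_trans T1.
pose g := Cg * al X / X%:R; have g0 : 0 < g by rewrite divr_gt0 ?mulr_gt0.
pose L := Num.truncn (lam * N%:R); have /andP[L1 L2] := truncn_half N4.
rewrite -/L in L1 L2.
have L0 : (0 < L)%N by rewrite -(ltr0n R); move: L1 N4; clear; lra.
have Lp : 0 < L%:R :> R by rewrite ltr0n.
have [||||||||||||||x [y [n [xP yP nX E]]]] :=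
    @hit_at_scale R al N P k l b.+1 X L n0 c eta g.
- exact: k0.
- exact: l0.
- by [].
- exact: L0.
- exact: g0.
- by rewrite -(ltr0n R); move: hP delN; clear; lra.
- by move=> x; rewrite inE => /andP[].
- exact: leq_trans n0n1 (ltnW X1).
- move=> n h1 h2; have [h3 h4] := gap n X h1 h2; split=> //.
  by rewrite /g ler_pdivlMr.
- have q1 : B * (4 * al n0) < B * (del * N%:R).
    by rewrite ltr_pM2l // (le_lt_trans _ N2) // ler_wpM2l // ler_norm.
  have q2 : B * (del * N%:R / 2) < B * c.+1%:R by rewrite ltr_pM2l.
  have q3 : lam * N%:R <= B * del / 16 * N%:R by rewrite ler_wpM2r // ltW.
  have q4 : 0 < B * (del * N%:R) by rewrite mulr_gt0.
  by rewrite -/B; move: q1 q2 q3 q4 L2; clear; lra.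
- exact: X2.
- rewrite -/B ler_pdivlMr; last exact: mulr_gt0.
  have q1 : 8 * B * Cg * m / lam <= X%:R.
    have : (n1%:R : R) <= X%:R by rewrite ler_nat ltnW.
    by move: Cg0 hv n1v; clear; lra.
  have q2 : g * X%:R <= 2 * Cg * (m * N%:R).
    rewrite /g divfK ?gt_eqF // -mulrA mulrCA ler_wpM2l ?(ltW Cg0) //.
    by move: X3 T2; clear; lra.
  have q3 : 8 * B * Cg * m <= lam * X%:R by rewrite -ler_pdivrMl // mulrC.
  have q4 : N%:R * (8 * B * Cg * m) <= N%:R * (lam * X%:R) by rewrite ler_wpM2l ?(ltW Np).
  have q5 : B * (g * X%:R) <= B * (2 * Cg * (m * N%:R)) by rewrite ler_wpM2l ?(ltW B0).
  have q6 : lam * N%:R / 2 * X%:R <= L%:R * X%:R by rewrite ler_wpM2r ?(ltW Xp).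
  rewrite -(ler_pM2r Xp); move: q4 q5 q6; clear; lra.
- apply: (@spectral_bound R al X L b.+1 eta th1 (K / al X)) => //.
  + by rewrite th1E mulrCA divff ?gt_eqF // mulr1.
  + move=> th h1 h2; apply: hK => //; last by rewrite -ler_pdivrMr.
    by apply: leq_trans (ltnW X1); rewrite !leq_max leqnn orbT.
  + rewrite -/B ler_pdivlMr ?mulr_gt0 // mulrAC ler_pdivrMr //.
    have q1 : lam * (16 * K) <= eta * B by rewrite -ler_pdivlMr ?mulr_gt0.
    have q2 : L%:R * (16 * K) <= lam * N%:R * (16 * K) by rewrite ler_wpM2r // mulr_ge0 // ltW.
    have q3 : lam * (16 * K) * N%:R <= eta * B * N%:R by rewrite ler_wpM2r // ltW.
    have q4 : eta * B * N%:R <= eta * B * al X.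
      by apply: ler_wpM2l; [rewrite mulr_ge0 // ltW|exact: ltW (lt_le_trans T1 X2)].
    by move: q2 q3 q4; clear; lra.
- have -> : 6 * eta * g * X%:R = del / (8 * m) * al X.
    by rewrite etaE /g; field; rewrite !gt_eqF.
  have q1 : del / (8 * m) * al X <= del / (8 * m) * (2 * (m * N%:R)).
    by apply: ler_wpM2l; [rewrite divr_ge0 ?mulr_ge0 // ltW|move: X3 T2; clear; lra].
  have q2 : del / (8 * m) * (2 * (m * N%:R)) = del * N%:R / 4 by field; rewrite gt_eqF.
  by rewrite q2 in q1; move: q1 hP delN; clear; lra.
have [xA cx] : A x /\ (c < x)%N by move: xP; rewrite inE => /andP[/set_mem].
have yA : A y by move: yP; rewrite inE => /andP[/set_mem].
(* The index 0 is excluded because [al 0] is below del N / 4, while k x + l y exceeds c. *)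
exists x, y, n; split=> //; rewrite lt0n; apply/eqP => n00.
have := floor_le (al n); rewrite -E n00 -pmulrn leNgt => /negP; apply.
apply: (@lt_le_trans _ _ c.+1%:R); first by
  have := ler_norm (al 0%N); move: N3 c2 delN; clear; lra.
by rewrite ler_nat (leq_trans cx) // (leq_trans _ (leq_addr _ _)) // leq_pmull.
Qed.

(** Increments below 1 let floor skip no integer on the way up, so one large x in A with y = x
    suffices. *)
Lemma sumset_hit_slow (A : set nat) (al : nat -> R) (k l n0 : nat) :
  (0 < k)%N -> (0 < l)%N -> (0 < upper_density R A)%E ->
  (forall C : R, exists n1 : nat, forall n, (n1 <= n)%N -> C <= al n) ->
  (forall n, (n0 <= n)%N -> al n.+1 - al n < 1) ->
  exists x y n, [/\ A x, A y, (0 < n)%N & (k * x + l * y)%N%:Z = Num.floor (al n)].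
Proof.
move=> k0 l0 /dense_scales[del del0 scales] unb gap.
(* A target above this value is not reached at [n0.+1], so the least index reaching it has a
   predecessor to which the gap bound applies. *)
have [v hv] := nat_above (al n0.+1).
have [w hw] := nat_above (v%:R / del).
have [N wN hN] := scales w.+1.
have [x Ax vx] : exists2 x, A x & (v < x)%N.
  have vN : v%:R < del * N%:R.
    rewrite mulrC -ltr_pdivrMr // (lt_le_trans hw) // ler_nat; exact: ltnW.
  have : (0 < #|[set x : 'I_N.+1 | (val x \in A) && (v < x)%N]%SET|)%N.
    have := truncated_count A N v; rewrite -(ler_nat R) natrD -(ltr0n R); lra.
  by case/card_gt0P => x; rewrite inE => /andP[/set_mem Ax vx]; exists x.
pose z := ((k + l) * x)%N.
have ex : exists n, (n0 < n)%N && (z%:R <= al n).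
  have [u hu] := unb z%:R; exists (maxn u n0.+1).
  by rewrite leq_maxr hu // leq_maxl.
case: (ex_minnP ex) => n /andP[n0n hn] minn.
exists x, x, n; split=> //; first by case: n n0n {hn minn}.
rewrite -mulnDl -/z; apply/esym/floor_def; rewrite intrD -pmulrn hn /=.
have vz : (v%:R : R) <= z%:R.
  by rewrite ler_nat (leq_trans (ltnW vx)) // leq_pmull // addn_gt0 k0.
case: n n0n hn minn => // n n0n hn minn.
move: n0n; rewrite ltnS leq_eqVlt => /orP[/eqP E|n0n].
  by move: hn; rewrite -E; lra.
have : al n < z%:R.
  by rewrite ltNge; apply/negP => h; have := minn n; rewrite n0n h ltnn => /(_ isT).
by have := gap n (ltnW n0n); lra.
Qed.
End FromWeylSums.

(** * Assembling the theorem *)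

Lemma small_of_powR (R : realType) (alpha : R -> R) (e : R) (m : nat) : e <= m%:R ->
  alpha x / x `^ e @[x --> +oo] --> (0 : R) -> small alpha m.
Proof.
move=> em cv c c0; have h : evt (fun x => `|alpha x / x `^ e| <= c).
  by apply: near_evt; exact: cvgr0_norm_le.
have := evt_and h (evt_ge 1); apply: evt_mono => x [hx x1].
have x0 : 0 < x by exact: lt_le_trans x1.
have p0 := powR_gt0 e x0.
rewrite normrM normfV (gtr0_norm p0) ler_pdivrMr // in hx.
apply: (le_trans hx); rewrite ler_wpM2l ?(ltW c0) //.
by rewrite -powR_mulrn ?(ltW x0) // ler_powR.
Qed.

Unset Implicit Arguments.

Theorem theorem1p14 (R : realType) (alpha : R -> R)
  (halpha : sub_polynomial alpha)
  (hlim : alpha x @[x --> +oo] --> +oo)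
  (hlog : forall (p : {poly rat}) (c : R),
     `|alpha x - c * (map_poly ratr p).[x]| / ln x @[x --> +oo] --> +oo)
  (k l : nat) (hk : (0 < k)%N) (hl : (0 < l)%N)
  (A : set nat) (hA : A `<=` [set n | (0 < n)%N])
  (hdens : (0 < upper_density R A)%E) :
  exists x y n : nat,
    [/\ A x, A y, (0 < n)%N &
        (k * x + l * y)%N%:Z = Num.floor (alpha n%:R)].
Proof.
have [[H hH Ha] [e e0 he]] := halpha.
have [m /ltW em] := nat_above e.
have sm := small_of_powR em he.
have hinf C : evt (fun x => C <= alpha x) by apply: near_evt; exact: cvgry_ge.
have hlog' (p : {poly rat}) (c B : R) :
    evt (fun x => B <= `|alpha x - c * (map_poly ratr p).[x]| / ln x).
  by apply: near_evt; exact: (cvgry_ge (hlog p c)).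
have unb C : exists n1 : nat, forall n : nat, (n1 <= n)%N -> C <= alpha n%:R := evt_nat (hinf C).
have [[|D] [// _ Dm sD minD]] := vanishing_order hH Ha hinf sm.
have pr := profile_of_order hH Ha hinf sm Dm sD minD.
(* D = 0 means that alpha' tends to 0; then increments fall below 1 by the mean value theorem. *)
have [D0|D0] := posnP D.
  rewrite D0 in sD.
  have ch : evt (fun x => is_derive x 1 alpha (alpha^`()%classic x)).
    exact: (hardy_is_derive hH).
  have h2 : 0 < 1 / 2 :> R by lra.
  have [n0 hn0] := evt_nat (evt_tail (evt_and ch (sD _ h2))).
  apply: (@sumset_hit_slow R A (fun n => alpha n%:R) k l n0) => // n n0n.
  have n1 : (n%:R : R) <= n.+1%:R by rewrite ler_nat.
  have [z /andP[z1 _]|y /andP[y1 y2] ->] := @mean_value R alpha (alpha^`()%classic) n%:R n.+1%:R n1.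
    exact: (hn0 n n0n z z1).1.
  rewrite -natr1 addrAC subrr add0r mulr1.
  have [_] := hn0 n n0n y y1; rewrite expr0 derive1n1 /=.
  by have := ler_norm (alpha^`()%classic y); lra.
have [C C0 [n0 gap]] := gap_bound pr D0.
apply: (@sumset_hit R A (fun n => alpha n%:R) k l n0 C) => //.
apply: (uniform_bound pr D0); have [[s hs]|[Ca ap]] := vanishing_dichotomy hH Ha hinf D0 Dm sD minD.
  by left; exists s.
by right; exact: (polynomial_regime_of_decay pr D0 ap).
Qed.
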